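(* Let $\tilde D$ be a $d\times d$ dilation matrix with $m=|\det\tilde D|$, and let $n$ be an integer. For $p,q\in\hat X_n$, $$[\![p,q]\!]_{n-1}(\zeta)=\frac1m\sum_{\hat\Delta(\omega)=\zeta}[\![p,q]\!]_n(\omega).$$ This implies that $$m^{-1/2}\|p\|_{X_n}\le\|p\|_{X_{n-1}}\le\|p\|_{X_n}.$$ Therefore the Hilbert $C^*(\mathbb{Z}^d)$-modules $(X_n)_{n\in\mathbb{Z}}$ all share the same linear space, and the Hilbert $C(\mathbb{T}^d)$-modules $(\hat X_n)_{n\in\mathbb{Z}}$ also all share the same linear space.
   Context: Conventions. $\mathbb{T}^d=\mathbb{R}^d/\mathbb{Z}^d$; $\widehat{\mathbb{R}^d}$ is identified with $\mathbb{R}^d$ through $(x,\xi)=e^{2\pi i x\cdot\xi}$; $(\gamma,\zeta)=e^{2\pi i\gamma\cdot\zeta}$ for $\gamma\in\mathbb{Z}^d,\zeta\in\mathbb{T}^d$. The Fourier transform on $\mathbb{R}^d$ is $\hat f(\xi)=\int f(x)(x,\xi)\,dx$ (extended to $L^2$), and on $\mathbb{Z}^d$ it is $\hat a(\zeta)=\sum_\gamma a(\gamma)(\gamma,\zeta)$; the latter extends to the identification $C^*(\mathbb{Z}^d)\cong C(\mathbb{T}^d)$. A dilation matrix is an integer $d\times d$ matrix $\tilde D$ all of whose eigenvalues are greater than $1$ in absolute value. $\hat\iota:\widehat{\mathbb{R}^d}\to\mathbb{T}^d$ is the quotient map and $\hat\iota_n(\xi)=\hat\iota(\tilde D^{*-n}\xi)$.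 The homomorphism $\hat\Delta:\mathbb{T}^d\to\mathbb{T}^d$ is the one induced by $\tilde D^*$ on the quotient $\mathbb{T}^d=\widehat{\mathbb{R}^d}/\mathbb{Z}^d$ (it is dual to $\Delta(\gamma)=\tilde D\gamma$ on $\mathbb{Z}^d$). Define $[f,g]_n(\gamma)=\int_{\mathbb{R}^d}\overline{f(x-\tilde D^{-n}\gamma)}g(x)\,dx$, $(f\circ_n a)(x)=\sum_{\gamma\in\mathbb{Z}^d}a(\gamma)f(x-\tilde D^{-n}\gamma)$, and for $p,q\in L^2(\widehat{\mathbb{R}^d})$, $b\in C(\mathbb{T}^d)$, $[\![p,q]\!]_n(\zeta)=m^n\sum_{\hat\iota_n(\xi)=\zeta}\overline{p(\xi)}q(\xi)$ (for a.e. $\zeta\in\mathbb{T}^d$), $(p\,\widehat{\circ_n}\,b)(\xi)=p(\xi)b(\hat\iota_n(\xi))$. For $f\in C_c(\mathbb{R}^d)$, $\|f\|_{X_n}=\sup_{\zeta\in\mathbb{T}^d}\sqrt{\widehat{[f,f]_n}(\zeta)}$. $X_n$ is the completion of $C_c(\mathbb{R}^d)$ in this norm, regarded as a subspace of $L^2(\mathbb{R}^d)$ via the continuous extension of the inclusion (one has $\|f\|_2\le\|f\|_{X_n}$); it is a Hilbert $C^*(\mathbb{Z}^d)$-module with $[\cdot,\cdot]_n$ and $\circ_n$ extended by continuity. $\hat X_n\subset L^2(\widehat{\mathbb{R}^d})$ is its image under the Fourier transform on $\mathbb{R}^d$, a Hilbert $C(\mathbb{T}^d)$-module with $[\![\cdot,\cdot]\!]_n$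 and $\widehat{\circ_n}$. For $p\in\hat X_n$, $\|p\|_{X_n}=\sup_{\zeta\in\mathbb{T}^d}\sqrt{[\![p,p]\!]_n(\zeta)}$, where $[\![p,p]\!]_n$ denotes the corresponding element of $C(\mathbb{T}^d)$; this is the Hilbert module norm of $\hat X_n$. *)

(* Defs.v *)
From HB Require Import structures.
From mathcomp Require Import all_boot all_order all_algebra.
From mathcomp Require Import all_classical all_reals all_analysis.
From mathcomp Require Import complex.
Set Implicit Arguments.
Unset Strict Implicit.
Unset Printing Implicit Defensive.
Import Order.TTheory GRing.Theory Num.Theory.
Import numFieldNormedType.Exports.
Local Open Scope classical_set_scope.
Local Open Scope ring_scope.

(* Points of R^d and of Z^d are row vectors, so a matrix A sends x to
   x *m A^T, and its adjoint A^* sends xi to xi *m A. *)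

Definition rV_display : measure_display.
Proof. exact: default_measure_display. Qed.

Section measurable_rV.
Context (R : realType) (n : nat).

Definition rV_coord (i : 'I_n) (x : 'rV[R]_n) : R := x ord0 i.

Let rV_set0 : g_sigma_preimage rV_coord set0.
Proof. exact: sigma_algebra0. Qed.

Let rV_setC A :
  g_sigma_preimage rV_coord A -> g_sigma_preimage rV_coord (~` A).
Proof. exact: sigma_algebraC. Qed.

Let rV_bigcup (F : (set 'rV[R]_n)^nat) :
  (forall i, g_sigma_preimage rV_coord (F i)) ->
  g_sigma_preimage rV_coord (\bigcup_i (F i)).
Proof. exact: sigma_algebra_bigcup. Qed.

(* The product sigma-algebra, which is the Borel sigma-algebra of R^n. *)
HB.instance Definition _ := @isMeasurable.Build rV_display 'rV[R]_n
  (g_sigma_preimage rV_coord) rV_set0 rV_setC rV_bigcup.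

End measurable_rV.

Section lebesgue_rV.
Context (R : realType).

Lemma measurable_rV_coord n (i : 'I_n) :
  measurable_fun [set: 'rV[R]_n] (@rV_coord R n i).
Proof.
move=> _ Y mY; rewrite setTI; apply: sub_sigma_algebra => /=.
rewrite -bigcup_seq/=; exists i => /=; first by rewrite mem_index_enum.
by exists Y => //; rewrite setTI.
Qed.

Lemma measurable_fun_rV d (T : measurableType d) n (f : T -> 'rV[R]_n) :
  (forall i, measurable_fun [set: T] (@rV_coord R n i \o f)) ->
  measurable_fun [set: T] f.
Proof.
move=> mf _ A mA; rewrite setTI.
suff : g_sigma_preimage (@rV_coord R n) `<=` [set B | measurable (f @^-1` B)].
  exact.
apply: smallest_sub.
  split=> /=.
  - by rewrite preimage_set0.
  - by move=> B mB; rewrite setTD preimage_setC; exact: measurableC.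
  - by move=> F mF; rewrite preimage_bigcup; exact: bigcupT_measurable.
rewrite -bigcup_seq; apply: bigcup_sub => i _ _ [B mB <-] /=.
by rewrite setTI -comp_preimage -[X in measurable X]setTI; exact: mf.
Qed.

Definition rV_rcons n (vx : 'rV[R]_n * measurableTypeR R) : 'rV[R]_n.+1 :=
  \row_i oapp (vx.1 ord0) vx.2 (unlift ord_max i).

Lemma measurable_rV_rcons n : measurable_fun setT (@rV_rcons n).
Proof.
apply: measurable_fun_rV => i; case: (unliftP ord_max i) => [j|] ij.
  rewrite [X in measurable_fun _ X](_ : _ = @rV_coord R n j \o fst).
    exact: measurableT_comp (measurable_rV_coord j) measurable_fst.
  by apply/funext => vx; rewrite /= /rV_coord mxE ij liftK.
rewrite [X in measurable_fun _ X](_ : _ = snd); first exact: measurable_snd.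
by apply/funext => vx; rewrite /= /rV_coord mxE ij unlift_none.
Qed.

End lebesgue_rV.

Section rV_product_measure.
Context (R : realType) (n : nat) (mu : {measure set 'rV[R]_n -> \bar R}).
Local Open Scope ereal_scope.

Definition rV_product_measure : set 'rV[R]_n.+1 -> \bar R :=
  pushforward (mu \x @lebesgue_measure R) (@rV_rcons R n).

HB.instance Definition _ := Measure.copy rV_product_measure
  (measure_function_pushforward__canonical__measure_function_Measure
     (mu \x @lebesgue_measure R) (@measurable_rV_rcons R n)).

End rV_product_measure.

Fixpoint lebesgue_rV (R : realType) (n : nat) :
    {measure set 'rV[R]_n -> \bar R} :=
  if n is n'.+1 then rV_product_measure (lebesgue_rV R n')
  else dirac (0 : 'rV[R]_0).

Lemma lebesgue_rV_box (R : realType) n (A : 'I_n -> set (measurableTypeR R)) :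
  (forall i, measurable (A i)) ->
  lebesgue_rV R n [set x | forall i, A i (x ord0 i)] =
  (\prod_(i < n) lebesgue_measure (A i))%E.
Proof.
elim: n A => [|n IH] A mA.
  rewrite big_ord0 /= /dirac indicE mem_set//.
  by case.
rewrite big_ord_recr /= /rV_product_measure /pushforward.
rewrite (_ : _ @^-1` _ = [set v : 'rV[R]_n | forall i,
    A (widen_ord (leqnSn n) i) (v ord0 i)] `*` A ord_max); last first.
  have wE (j : 'I_n) : widen_ord (leqnSn n) j = lift ord_max j.
    by apply: val_inj; rewrite /= /bump leqNgt ltn_ord.
  apply/seteqP; split => -[v y] /=.
    move=> h; split => [j|].
      by have := h (lift ord_max j); rewrite mxE liftK wE.
    by have := h ord_max; rewrite mxE unlift_none.
  move=> [h1 h2] i; rewrite mxE; case: unliftP => [j ->|->] //=.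
  by rewrite -wE; exact: h1.
rewrite product_measure1E//; first by congr (_ * _)%E; exact: IH.
rewrite (_ : [set v | _] = \bigcap_(i in [set: 'I_n])
    (@rV_coord R n i @^-1` A (widen_ord (leqnSn n) i))); last first.
  by apply/seteqP; split => [v h i _|v h i]; exact: h.
apply: fin_bigcap_measurable; first exact: finite_finset.
move=> i _; rewrite -[X in measurable X]setTI.
by apply: measurable_rV_coord; [exact: measurableT | exact: mA].
Qed.

Section complex_valued.
Context (R : realType).

(* e^(2 pi i t) *)
Definition expi2pi (t : R) : R[i] :=
  (cos (2 * pi * t) +i* sin (2 * pi * t))%C.

(* Unconditional sum of a family; meaningful when it is absolutely summable. *)
Definition rsum (T : choiceType) (A : set T) (a : T -> R) : R :=
  fine (\esum_(t in A) (Num.max (a t) 0)%:E) -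
  fine (\esum_(t in A) (Num.max (- a t) 0)%:E).

Definition csum (T : choiceType) (A : set T) (a : T -> R[i]) : R[i] :=
  (rsum A (fun t => complex.Re (a t)) +i* rsum A (fun t => complex.Im (a t)))%C.

Context (n : nat).
Local Notation Rn := 'rV[R]_n.

Definition cintegral (f : Rn -> R[i]) : R[i] :=
  (Rintegral (lebesgue_rV R n) setT (fun x => complex.Re (f x)) +i*
   Rintegral (lebesgue_rV R n) setT (fun x => complex.Im (f x)))%C.

Definition L2norm (f : Rn -> R[i]) : \bar R :=
  Lnorm (lebesgue_rV R n) 2%:E (fun x => (complex.Re `|f x|)%:E).

(* Elements of L^2 are represented by measurable functions. The sets L2, X and
   X_hat below are stable under almost everywhere equality, so equalities
   between them are equalities of subspaces of L^2. *)
Definition L2 : set (Rn -> R[i]) := [set f |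
  [/\ measurable_fun setT (fun x => complex.Re (f x)),
      measurable_fun setT (fun x => complex.Im (f x)) &
      (L2norm f < +oo)%E]].

Definition cvg_L2 (u : nat -> Rn -> R[i]) (f : Rn -> R[i]) : Prop :=
  L2norm (fun x => u k x - f x) @[k --> \oo] --> 0%E.

(* The topology of R[i] is carried by R[i]^o. *)
Definition Cc : set (Rn -> R[i]) := [set f |
  continuous (f : Rn -> R[i]^o) /\ compact (closure [set x | f x != 0])].

Definition dotr (x y : Rn) : R := (x *m y^T) ord0 ord0.

Definition fourier (f : Rn -> R[i]) (xi : Rn) : R[i] :=
  cintegral (fun x => f x * expi2pi (dotr x xi)).

(* p is the Fourier transform of f in L^2: continuous extension of [fourier]
   from the dense subspace C_c(R^n). *)
Definition fourier_L2 (f p : Rn -> R[i]) : Prop :=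
  [/\ L2 f, L2 p & exists u : nat -> Rn -> R[i],
    [/\ forall k, Cc (u k), cvg_L2 u f & cvg_L2 (fun k => fourier (u k)) p]].

End complex_valued.

Section torus.
Context (R : realType) (n : nat).

Definition eq_mod_Zn (x y : 'rV[R]_n) : bool :=
  [forall i, (x - y) ord0 i \is a Num.int].

Lemma eq_mod_Zn_refl : reflexive eq_mod_Zn.
Proof. by move=> x; apply/forallP => i; rewrite subrr mxE rpred0. Qed.

Lemma eq_mod_Zn_sym : symmetric eq_mod_Zn.
Proof.
by move=> x y; apply: eq_forallb => i; rewrite -opprB mxE rpredN.
Qed.

Lemma eq_mod_Zn_trans : transitive eq_mod_Zn.
Proof.
move=> y x z /forallP xy /forallP yz; apply/forallP => i.
by rewrite -(subrKA y) mxE rpredD.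
Qed.

Canonical eq_mod_Zn_equiv :=
  EquivRel eq_mod_Zn eq_mod_Zn_refl eq_mod_Zn_sym eq_mod_Zn_trans.

Definition torus : Type := quotient_topology {eq_quot eq_mod_Zn}%qT.
HB.instance Definition _ := PointedTopological.on torus.
HB.instance Definition _ := Choice.on torus.
HB.instance Definition _ := Quotient.on torus.

Definition iota_hat (xi : 'rV[R]_n) : torus := (\pi_torus xi)%qT.

Lemma iota_hatP (x y : 'rV[R]_n) :
  reflect (iota_hat x = iota_hat y) (eq_mod_Zn x y).
Proof. exact: (eqmodP eq_mod_Zn_equiv x y). Qed.

(* A subset of the torus is Haar-null iff its preimage in R^n is
   Lebesgue-null. *)
Definition ae_torus (P : torus -> Prop) : Prop :=
  {ae lebesgue_rV R n, forall xi, P (iota_hat xi)}.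

Definition fourier_Zn (a : 'rV[int]_n -> R[i]) (zeta : torus) : R[i] :=
  csum setT (fun gamma => a gamma * expi2pi (dotr (map_mx intr gamma) (repr zeta))).

End torus.

Definition dilation_matrix (R : realType) (d : nat) (D : 'M[int]_d) : Prop :=
  forall a : R[i], eigenvalue (map_mx intr D : 'M[R[i]]_d) a -> 1 < `|a|.

Section modules.
Context (R : realType) (d : nat) (D : 'M[int]_d.+1).
Implicit Types (n : int) (zeta omega : torus R d.+1).
Local Notation Rd := 'rV[R]_d.+1.
Local Notation Zd := 'rV[int]_d.+1.

Definition realmx : 'M[R]_d.+1 := map_mx intr D.

Definition absdet : nat := `|\det D|%N.

Definition dil n (x : Rd) : Rd := x *m (realmx^T) ^ n.

Definition adj_dil n (xi : Rd) : Rd := xi *m realmx ^ n.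

Definition iota_hat_n n (xi : Rd) : torus R d.+1 := iota_hat (adj_dil (- n) xi).

Definition Delta_hat zeta : torus R d.+1 := iota_hat (adj_dil 1 (repr zeta)).

Lemma Delta_hat_iota_hat (xi : Rd) :
  Delta_hat (iota_hat xi) = iota_hat (adj_dil 1 xi).
Proof.
rewrite /Delta_hat /adj_dil expr1z; apply/iota_hatP.
have /iota_hatP/forallP h : iota_hat (repr (iota_hat xi)) = iota_hat xi.
  exact: reprK.
apply/forallP => i; rewrite -mulmxBl mxE.
by apply: rpred_sum => j _; rewrite rpredM// mxE intr_int.
Qed.

Definition bracket n (f g : Rd -> R[i]) (gamma : Zd) : R[i] :=
  cintegral (fun x => (f (x - dil (- n) (map_mx intr gamma)))^* * g x).

Definition X_norm_Cc n (f : Rd -> R[i]) : R :=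
  sup (range (fun zeta =>
    Num.sqrt (complex.Re (fourier_Zn (bracket n f f) zeta)))).

(* The completion of C_c(R^d) for [X_norm_Cc n], inside L^2(R^d): the L^2
   limits of the sequences of C_c(R^d) that are Cauchy for this norm. *)
Definition X n : set (Rd -> R[i]) := [set f | L2 f /\
  exists u : nat -> Rd -> R[i],
    [/\ forall k, Cc (u k),
        forall e : R, 0 < e -> exists N : nat, forall j k : nat,
          (N <= j)%N -> (N <= k)%N ->
          X_norm_Cc n (fun x => u j x - u k x) < e &
        cvg_L2 u f]].

Definition X_hat n : set (Rd -> R[i]) :=
  [set p | exists2 f, X n f & fourier_L2 f p].

Definition hat_bracket_sum n (p q : Rd -> R[i]) zeta : R[i] :=
  (absdet%:R : R[i]) ^ n *
  csum [set xi | iota_hat_n n xi = zeta] (fun xi => (p xi)^* * q xi).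

(* [[p, q]]_n as an element of C(T^d): the continuous function equal almost
   everywhere to the sum over the fibre (unique, since null sets have empty interior;
   the default value 0 is never used for p, q in X_hat n). *)
Definition hat_bracket n (p q : Rd -> R[i]) : torus R d.+1 -> R[i] :=
  xget (fun=> 0) [set b | continuous (b : torus R d.+1 -> R[i]^o) /\
                  ae_torus (fun zeta => b zeta = hat_bracket_sum n p q zeta)].

Definition X_hat_norm n (p : Rd -> R[i]) : R :=
  sup (range (fun zeta => Num.sqrt (complex.Re (hat_bracket n p p zeta)))).

End modules.

(* Main.v *)
Require Import Defs.
From HB Require Import structures.
From mathcomp Require Import all_boot all_order all_algebra perm.
From mathcomp Require Import all_classical all_reals all_analysis.
From mathcomp Require Import measurable_realfun complex.
From mathcomp Require Import ring lra zify.
Set Implicit Arguments.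
Unset Strict Implicit.
Unset Printing Implicit Defensive.
Import Order.TTheory GRing.Theory Num.Theory.
Import numFieldNormedType.Exports.
Local Open Scope classical_set_scope.
Local Open Scope ring_scope.

(** Write m for |det D|, M for D as a real matrix and, for p on the dual copy
    of R^d, S_n p (xi) = m^n sum_k |p((xi + k) M^n)|^2, the sum over Z^d
    defining [[p, p]]_n. The points of the torus above zeta for Delta_hat are
    indexed by representatives of the m cosets of Z^d D in Z^d, and regrouping
    the sum over Z^d along these cosets gives
      S_(n-1) p (zeta) = m^-1 sum_(Delta_hat omega = zeta) S_n p (omega)
    ([sqsum_pred], [sum_Delta_hat_fiber]). The theorem follows once this
    identity, which for p in L^2 only makes sense almost everywhere, is carried
    over to the continuous functions that represent the sums.

    For u in C_c(R^d) there is nothing exceptional: the Fourier series of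
    [u, u]_n equals S_n u^ at every point ([bracket_parseval]). At xi this is
    Parseval's equality sum_k |w^(k)|^2 = sum_g int conj(w(x - g)) w(x) dx
    ([parseval]) for w(y) = u(y B) e^(2 pi i y.xi), B the inverse of the n-th
    power of the transpose of M. It is obtained by integrating the convolution
    of w with Fejer kernels against conj w. Hence the norm of u in X_n is the
    supremum of the square root of S_n u^. A mean of m nonnegative numbers is at
    most their maximum and at least 1/m times each of them, so the norms of X_n
    and X_(n-1) are equivalent on C_c(R^d) ([sup_sqrt_mean],
    [X_norm_Cc_pred]); they have the same Cauchy sequences, and X_n and its
    Fourier image do not depend on n.

    An element p of X_hat_n is the L^2 limit of Fourier transforms u_j^ of
    functions of C_c(R^d) that are Cauchy for the norm of X_n
    ([X_hat_approximates], by Plancherel). The triangle inequality of l^2 on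
    each fibre makes the functions sqrt(S_n u_j^) uniformly convergent, so their
    limit is continuous; since the integral of S_n (u_j^ - p) over a fundamental
    cell is |u_j^ - p|_2^2, the limit is sqrt(S_n p) almost everywhere
    ([fnorm_lim_ae]). So [[p, p]]_n is the square of this limit, and the
    identity passes to the limit from the u_j. It extends to pairs p, q by
    polarization through p + q and i p + q ([hat_bracket_polar]). *)

(** * Lebesgue measure on R^n: linear changes of variables, periodization *)

Section measure_rV.
Context (R : realType).

Definition box n (A : 'I_n -> set (measurableTypeR R)) : set 'rV[R]_n :=
  [set x | forall i, A i (x ord0 i)].

Lemma measurable_box n (A : 'I_n -> set (measurableTypeR R)) :
  (forall i, measurable (A i)) -> measurable (box A).
Proof.
move=> mA; rewrite (_ : box _ = \bigcap_(i in [set: 'I_n])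
    (@rV_coord R n i @^-1` A i)); last first.
  by apply/seteqP; split => [v h i _|v h i]; exact: h.
apply: fin_bigcap_measurable; first exact: finite_finset.
move=> i _; rewrite -[X in measurable X]setTI.
by apply: measurable_rV_coord; [exact: measurableT | exact: mA].
Qed.

Definition cube n (k : nat) : set 'rV[R]_n := box (fun=> `[- k%:R, k%:R]%classic).

Lemma measurable_cube n k : measurable (@cube n k).
Proof. by apply: measurable_box => i; exact: measurable_itv. Qed.

Lemma bigcup_cube n : \bigcup_k (@cube n k) = setT.
Proof.
apply/seteqP; split => // x _.
exists (\max_(i < n) Num.truncn `|x ord0 i|).+1 => //= i.
rewrite set_itvE /= -ler_norml (le_trans (ltW (truncnS_gt _)))// ler_nat ltnS.
exact: (leq_bigmax (F := fun i => Num.truncn `|x ord0 i|)).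
Qed.

Lemma lebesgue_cube_lty n k : (lebesgue_rV R n (cube k) < +oo)%E.
Proof.
rewrite lebesgue_rV_box//.
rewrite (eq_bigr (fun=> (k%:R + k%:R)%:E)) => [|i _].
  by rewrite prodEFin ltry.
rewrite lebesgue_measure_itv /= lte_fin; case: ifPn => [_|].
  by rewrite -EFinD opprK.
rewrite -leNgt => h; have : k%:R == 0 :> R.
  by rewrite eq_le ler0n andbT; have := ler0n R k; lra.
by move=> /eqP ->; rewrite addr0.
Qed.

Lemma rV_measure_unique n (m1 m2 : {measure set 'rV[R]_n -> \bar R}) :
  (forall A : 'I_n -> set (measurableTypeR R), (forall i, measurable (A i)) ->
    m1 (box A) = m2 (box A)) ->
  (forall k, (m1 (cube k) < +oo)%E) ->
  forall S, measurable S -> m1 S = m2 S.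
Proof.
move=> m12 m1oo S mS.
pose G : set (set 'rV[R]_n) := [set S | exists2 A : 'I_n -> set (measurableTypeR R),
  (forall i, measurable (A i)) & S = box A].
apply: (@g_sigma_algebra_measure_unique _ _ _ G _ (@cube n)) => //.
- by move=> _ [A mA ->]; exact: measurable_box.
- by move=> k; exists (fun=> `[- k%:R, k%:R]%classic) => // i.
- exact: bigcup_cube.
- move=> _ _ [A mA ->] [B mB ->]; exists (fun i => A i `&` B i).
    by move=> i; exact: measurableI.
  apply/seteqP; split => x /= => [[h1 h2] i|h]; first by split.
  by split => i; have [] := h i.
- by move=> _ [A mA ->]; exact: m12.
- suff : g_sigma_preimage (@rV_coord R n) `<=` <<s G >> by exact.
  apply: smallest_sub; first exact: smallest_sigma_algebra.
  rewrite -bigcup_seq; apply: bigcup_sub => i _ _ [B mB <-] /=.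
  apply: sub_sigma_algebra; exists (fun j => if j == i then B else setT).
    by move=> j; case: ifP.
  apply/seteqP; split => [x [_ Bx] j|x h].
    by case: ifPn => [/eqP ->|].
  by split => //; have := h i; rewrite eqxx.
Qed.

(** The type of [lebesgue_rV] carries a bare measure; this copy carries
    sigma-finiteness as well, which Fubini's theorem needs. *)
Definition leb n : set 'rV[R]_n -> \bar R := lebesgue_rV R n.
HB.instance Definition _ n := Measure.copy (leb (n:=n)) (lebesgue_rV R n).

Lemma leb_sigma_finite n : sigma_finite setT (@leb n).
Proof.
exists (@cube n); first by rewrite bigcup_cube.
by move=> k; split; [exact: measurable_cube|exact: lebesgue_cube_lty].
Qed.

HB.instance Definition _ n :=
  Measure_isSigmaFinite.Build _ _ _ (@leb n) (@leb_sigma_finite n).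

Lemma measurable_affine (b c : R) :
  measurable_fun setT (fun y : measurableTypeR R => (c + y * b : measurableTypeR R)).
Proof.
have h : measurable_fun setT (fun y : R => c + y * b : R).
  by apply: measurable_funD => //; apply: measurable_funM.
exact: h.
Qed.

Lemma lebesgue_measure_affine (b c : R) (A : set (measurableTypeR R)) :
  b != 0 -> measurable A ->
  (`|b|%:E * lebesgue_measure ((fun y : measurableTypeR R => c + y * b)%R @^-1` A) = lebesgue_measure A)%E.
Proof.
move=> b0 mA.
have nb : 0 <= `|b| by [].
pose m2 := mscale (NngNum nb) (measure_function_pushforward__canonical__measure_function_Measure lebesgue_measure (measurable_affine b c)).
suff -> : lebesgue_measure A = m2 A by [].
apply: lebesgue_measure_unique => // _ [[x y] _ <-].
rewrite /m2 /mscale /= /pushforward /=.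
change (lebesgue_measure `]x, y] = (`|b|%:E * lebesgue_measure
  ((fun y : measurableTypeR R => c + y * b)%R @^-1` `]x, y]))%E).
have [bp|bn] := ltP 0 b.
  rewrite (_ : _ @^-1` _ = `](x - c) / b, (y - c) / b]%classic); last first.
    apply/seteqP; split => z /=; rewrite !in_itv/= ltr_pdivrMr// ler_pdivlMr// ltrBlDl lerBrDl//.
  rewrite !lebesgue_measure_itv /= !lte_fin ltr_pM2r ?invr_gt0// ltrD2r.
  case: ifP => _; last by rewrite mule0.
  by rewrite -!EFinD -EFinM gtr0_norm// -mulrBl mulrC divfK// opprB addrA addrNK.
have {}bn : b < 0 by rewrite lt_neqAle b0.
rewrite (_ : _ @^-1` _ = `[(y - c) / b, (x - c) / b[%classic); last first.
  apply/seteqP; split => z /=; rewrite !in_itv/= ler_ndivrMr// ltr_ndivlMr// ltrBlDl lerBrDl andbC//.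
rewrite !lebesgue_measure_itv /= !lte_fin ltr_nM2r ?invr_lt0// ltrD2r.
case: ifP => _; last by rewrite mule0.
rewrite -!EFinD -EFinM ltr0_norm// -mulrBl mulrC mulrN divfK//.
by congr (_%:E); ring.
Qed.

Lemma measurable_addrV n (v : 'rV[R]_n) : measurable_fun setT (fun x : 'rV[R]_n => x + v).
Proof.
apply: measurable_fun_rV => i.
rewrite [X in measurable_fun _ X](_ : _ = fun x => rV_coord i x + v ord0 i).
  by apply: measurable_funD => //; exact: measurable_rV_coord.
by apply/funext => x; rewrite /= /rV_coord mxE.
Qed.

Lemma measurable_mulmxrV m n (B : 'M[R]_(m, n)) :
  measurable_fun setT (fun x : 'rV[R]_m => x *m B).
Proof.
apply: measurable_fun_rV => i.
rewrite [X in measurable_fun _ X](_ : _ = fun x => \sum_j rV_coord j x * B j i).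
  apply: measurable_sum => j.
  apply: measurable_funM => //; exact: measurable_rV_coord.
by apply/funext => x; rewrite /= /rV_coord mxE.
Qed.

Lemma lebesgue_rV_translate n (v : 'rV[R]_n) (S : set 'rV[R]_n) : measurable S ->
  lebesgue_rV R n ((fun x => x + v) @^-1` S) = lebesgue_rV R n S.
Proof.
move=> mS; pose m2 := measure_function_pushforward__canonical__measure_function_Measure (lebesgue_rV R n) (measurable_addrV v).
suff : lebesgue_rV R n S = m2 S by [].
apply: rV_measure_unique => [A mA||//]; last exact: lebesgue_cube_lty.
rewrite /m2 /= /pushforward.
rewrite (_ : _ @^-1` _ = box (fun i => (fun y : measurableTypeR R => v ord0 i + y * 1)%R @^-1` A i)); last first.
  by apply/seteqP; split => x h i; have := h i; rewrite /= mxE mulr1 addrC.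
rewrite !lebesgue_rV_box //.
  apply: eq_bigr => i _; rewrite -(lebesgue_measure_affine (v ord0 i) (oner_neq0 _) (mA i)).
  by rewrite normr1 mul1e.
by move=> i; rewrite -[X in measurable X]setTI; exact: measurable_affine.
Qed.

(** The change of variables formula for x |-> x *m B, as a property of B stable
    under products, so that the LUP decomposition reduces it to permutation and
    triangular matrices. *)
Definition scales n (B : 'M[R]_n) := forall S, measurable S ->
  (`|\det B|%:E * lebesgue_rV R n ((fun x => x *m B) @^-1` S) = lebesgue_rV R n S)%E.

Lemma scales_mul n (B C : 'M[R]_n) : scales B -> scales C -> scales (B *m C).
Proof.
move=> sB sC S mS; rewrite -[RHS]sC// -[in RHS]sB; last first.
  by rewrite -[X in measurable X]setTI; exact: measurable_mulmxrV.
rewrite det_mulmx normrM EFinM muleAC muleC; congr (_ * (_ * lebesgue_rV R n _))%E.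
by apply/seteqP; split => x /=; rewrite mulmxA.
Qed.

Lemma scales_perm n (s : 'S_n) : scales (perm_mx s).
Proof.
move=> S mS; rewrite det_perm normr_sign mul1e.
pose m2 := measure_function_pushforward__canonical__measure_function_Measure (lebesgue_rV R n) (measurable_mulmxrV (perm_mx s)).
suff : lebesgue_rV R n S = m2 S by [].
apply: rV_measure_unique => [A mA||//]; last exact: lebesgue_cube_lty.
rewrite /m2 /= /pushforward.
have E (x : 'rV[R]_n) i : (x *m perm_mx s) ord0 i = x ord0 ((s^-1)%g i).
  by rewrite -[s in LHS]invgK -col_permE mxE.
rewrite (_ : _ @^-1` _ = box (fun i => A (s i))); last first.
  apply/seteqP; split => x h i /=.
    by have := h (s i); rewrite E permK.
  by rewrite E; have := h ((s^-1)%g i); rewrite permKV.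
by rewrite !lebesgue_rV_box // [LHS](reindex_inj (@perm_inj _ s)).
Qed.

Lemma scales_integral n (B : 'M[R]_n) (f : 'rV[R]_n -> \bar R) :
  scales B -> measurable_fun setT f -> (forall x, 0 <= f x)%E ->
  (`|\det B|%:E * \int[lebesgue_rV R n]_x f (x *m B) = \int[lebesgue_rV R n]_x f x)%E.
Proof.
move=> sB mf f0; have nb : 0 <= `|\det B| by [].
pose m1 := measure_function_pushforward__canonical__measure_function_Measure (lebesgue_rV R n) (measurable_mulmxrV B).
pose m2 := mscale (NngNum nb) m1.
transitivity (\int[m2]_x f x)%E; last first.
  by apply: eq_measure_integral => S mS _; exact: sB.
rewrite ge0_integral_mscale//=; congr (_ * _)%E.
by rewrite (ge0_integral_pushforward (measurable_mulmxrV B)).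
Qed.

Lemma integral_translate n (v : 'rV[R]_n) (f : 'rV[R]_n -> \bar R) :
  measurable_fun setT f -> (forall x, 0 <= f x)%E ->
  (\int[lebesgue_rV R n]_x f (x + v)%R = \int[lebesgue_rV R n]_x f x)%E.
Proof.
move=> mf f0.
pose m1 := measure_function_pushforward__canonical__measure_function_Measure (lebesgue_rV R n) (measurable_addrV v).
transitivity (\int[m1]_x f x)%E; last first.
  by apply: eq_measure_integral => S mS _; exact: lebesgue_rV_translate.
by rewrite (ge0_integral_pushforward (measurable_addrV v)).
Qed.

(** By induction on the dimension: the last coordinate of x *m B is an affine
    function of the last coordinate of x, with slope the last diagonal entry and
    with a constant term depending on the other coordinates. Integrating it out
    first scales lengths by the slope. *)
Lemma scales_upper n (B : 'M[R]_n) :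
  (forall i j : 'I_n, (j < i)%N -> B i j = 0) -> \det B != 0 -> scales B.
Proof.
elim: n B => [|n IH] B uB dB.
  move=> S mS; rewrite det_mx00 normr1 mul1e; congr (lebesgue_rV R _ _).
  by apply/seteqP; split => x /=; rewrite !(thinmx0 (_ *m _)) !(thinmx0 x).
pose B' := row' ord_max (col' ord_max B); set b := B ord_max ord_max.
have detB : \det B = b * \det B'.
  rewrite (expand_det_row _ ord_max) (bigD1 ord_max)//= big1 ?addr0 => [|j jm].
    by rewrite /cofactor /= addnn -signr_odd odd_double expr0 mul1r.
  by rewrite uB ?mul0r// ltn_neqAle -ltnS ltn_ord andbT.
move: dB; rewrite detB mulf_eq0 negb_or => /andP[b0 dB'].
have sB' : scales B'.
  apply: IH => // i j ji; rewrite !mxE uB// /lift/= /bump.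
  by rewrite (leqNgt n j) (leqNgt n i) !ltn_ord.
pose c (v : 'rV[R]_n) := \sum_j v ord0 j * B (lift ord_max j) ord_max.
have E v y : rV_rcons (v, y) *m B = rV_rcons (v *m B', c v + y * b).
  apply/rowP => j; rewrite !mxE big_ord_recr /= !mxE unlift_none /=.
  have W i : widen_ord (leqnSn n) i = lift ord_max i.
    by apply: val_inj; rewrite /= /bump leqNgt ltn_ord.
  case: (unliftP ord_max j) => [k|] -> /=.
    rewrite mxE (uB ord_max) ?mulr0 ?addr0; last first.
      by rewrite -(W k) /= ltn_ord.
    by apply: eq_bigr => i _; rewrite !mxE W liftK.
  rewrite /b; congr (_ + _); apply: eq_bigr => i _.
  by rewrite mxE W liftK.
move=> S mS; pose T := @rV_rcons R n @^-1` S.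
have mT : measurable T.
  by rewrite -[X in measurable X]setTI; exact: measurable_rV_rcons.
pose phi v := lebesgue_measure (xsection T v).
have mphi : measurable_fun setT phi by exact: measurable_fun_xsection.
transitivity (\int[lebesgue_rV R n]_v phi v)%E; last by [].
rewrite detB -[RHS](scales_integral sB') // normrM EFinM -muleA muleCA; congr (_ * _)%E.
rewrite -ge0_integralZl//; last first.
  apply: measurable_fun_xsection.
  rewrite -[X in measurable X]setTI; apply: measurable_rV_rcons => //.
  by rewrite -[X in measurable X]setTI; exact: measurable_mulmxrV.
apply: eq_integral => v _.
rewrite /phi -(lebesgue_measure_affine (c v) b0); last exact: measurable_xsection.
congr (_ * lebesgue_measure _)%E.
apply/seteqP; split => y /=.
  by rewrite /xsection /= !inE /T /= E.
by rewrite /xsection /= !inE /T /= E.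
Qed.

(** Conjugation by the permutation reversing the order of the coordinates turns
    lower into upper triangular matrices. *)
Lemma scales_lower n (B : 'M[R]_n) :
  (forall i j : 'I_n, (i < j)%N -> B i j = 0) -> \det B != 0 -> scales B.
Proof.
move=> lB dB; pose r := perm_mx (perm (@rev_ord_inj n)) : 'M[R]_n.
have rr : r *m r = 1%:M.
  rewrite -perm_mxM (_ : (_ * _)%g = 1%g) ?perm_mx1//.
  by apply/permP => i; rewrite permM !permE rev_ordK.
have -> : B = r *m (r *m B *m r) *m r.
  by rewrite !mulmxA rr mul1mx -mulmxA rr mulmx1.
have dr : \det r != 0.
  have /(congr1 determinant) := rr; rewrite det_mulmx det1 => h.
  by apply/eqP => r0; move: h; rewrite r0 mul0r => /esym/eqP; rewrite oner_eq0.
apply: scales_mul; last exact: scales_perm.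
apply: scales_mul; first exact: scales_perm.
apply: scales_upper => [i j ij|]; last first.
  by rewrite !det_mulmx !mulf_neq0.
rewrite /r -row_permE.
have -> (C : 'M[R]_n) : C *m perm_mx (perm (@rev_ord_inj n)) = col_perm (perm (@rev_ord_inj n))^-1 C.
  by rewrite col_permE invgK.
rewrite !mxE lB //.
have -> : ((perm (@rev_ord_inj n))^-1)%g = perm (@rev_ord_inj n).
  apply/permP => k; apply: (@perm_inj _ (perm (@rev_ord_inj n))).
  by rewrite permKV !permE rev_ordK.
by rewrite !permE /=; have := ltn_ord i; lia.
Qed.

Lemma scales_unit n (B : 'M[R]_n) : \det B != 0 -> scales B.
Proof.
case: n B => [|n] B dB; first by apply: scales_upper => // -[].
have := cormen_lup_correct B; have := cormen_lup_perm B.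
have := @cormen_lup_lower _ _ B; have := @cormen_lup_upper _ _ B.
have := cormen_lup_detL B.
case: (cormen_lup B) => [[P L] U] /= dL uU lL /is_perm_mxP[s ->] PB.
have {}PB : B = perm_mx s^-1 *m L *m U.
  by rewrite -mulmxA -[L *m U]PB mulmxA -perm_mxM mulVg perm_mx1 mul1mx.
move: dB; rewrite PB !det_mulmx !mulf_eq0 !negb_or => /andP[/andP[_ dL'] dU].
apply: scales_mul; last by apply: scales_upper => // i j; exact: uU.
apply: scales_mul; first exact: scales_perm.
apply: scales_lower => // i j ij; rewrite lL ?(ltnW ij)//.
by case: eqP => // h; rewrite h ltnn in ij.
Qed.

(** Unconditional sums over a countable type as series, for which exchange with
    integrals and measurability are known. *)
Lemma esum_pickle (T : countType) (a : T -> \bar R) : (forall t, 0 <= a t)%E ->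
  (\esum_(t in [set: T]) a t = \sum_(i <oo) oapp a 0 (pickle_inv i))%E.
Proof.
move=> a0; rewrite nneseries_esumT; last by move=> i; case: (pickle_inv i) => /=.
rewrite [RHS](_ : _ = \esum_(i in range (@pickle T)) oapp a 0%E (pickle_inv i)).
  rewrite (esum_image _ pickle) => [|x y _ _]; last exact: (pcan_inj pickleK).
  by apply: eq_esum => x _; rewrite pickleK_inv.
rewrite [RHS]esum_mkcond; apply: eq_esum => i _.
case: ifPn => //; rewrite notin_setE /=.
case e : (pickle_inv i) => [x|//] []; exists x => //.
by have := @pickle_invK T i; rewrite e.
Qed.

Definition cell n : set 'rV[R]_n := box (fun=> `[- 2^-1, 2^-1[%classic).
Arguments cell : clear implicits.

Lemma measurable_cell n : measurable (cell n).
Proof. by apply: measurable_box => i; exact: measurable_itv. Qed.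

Lemma lebesgue_cell n : lebesgue_rV R n (cell n) = 1%E.
Proof.
rewrite lebesgue_rV_box// big1// => i _.
rewrite lebesgue_measure_itv /= lte_fin ifT; last by lra.
by rewrite -EFinD; congr (_%:E); lra.
Qed.

Definition intV n (k : 'rV[int]_n) : 'rV[R]_n := map_mx intr k.

Definition nearZ n (x : 'rV[R]_n) : 'rV[int]_n := \row_i Num.floor (x ord0 i + 2^-1).

Lemma cellP n (x : 'rV[R]_n) k : cell n (x - intV k) <-> k = nearZ x.
Proof.
split => [h|->].
  apply/rowP => i; rewrite mxE; apply/esym/floor_def.
  have := h i; rewrite !mxE /= in_itv/= intrD; lra.
move=> i; rewrite /= in_itv/= !mxE.
have := floor_le_tmp (x ord0 i + 2^-1); have := floorD1_gt (x ord0 i + 2^-1).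
rewrite intrD; lra.
Qed.

(** The translates of the cell by Z^n tile R^n. *)
Lemma integral_periodize n (f : 'rV[R]_n -> \bar R) :
  measurable_fun setT f -> (forall x, 0 <= f x)%E ->
  (\int[lebesgue_rV R n]_x f x =
   \int[lebesgue_rV R n]_(x in cell n) \esum_(k in [set: 'rV[int]_n]) f (x + intV k)%R)%E.
Proof.
move=> mf f0.
pose F i : set 'rV[R]_n := if pickle_inv i is Some k then (fun x => x - intV k) @^-1` cell n else set0.
have mF i : measurable (F i).
  rewrite /F; case: pickle_inv => // k.
  by rewrite -[X in measurable X]setTI; apply: measurable_addrV => //; exact: measurable_cell.
have FT : \bigcup_i F i = setT.
  apply/seteqP; split => // x _; exists (pickle (nearZ x)) => //.
  by rewrite /F pickleK_inv; apply/cellP.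
have tF : trivIset setT F.
  apply/trivIsetP => i j _ _ ij; apply/seteqP; split => // x [].
  rewrite /F; case ei : (pickle_inv i) => [k|//]; case ej : (pickle_inv j) => [l|//] /= /cellP ki /cellP lj.
  have := @pickle_invK 'rV[int]_n i; have := @pickle_invK 'rV[int]_n j.
  by rewrite ei ej /= ki lj => h1 h2; move: ij; rewrite -h1 -h2 eqxx.
rewrite -FT ge0_integral_bigcup//; last by rewrite FT.
transitivity (\sum_(i <oo) \int[lebesgue_rV R n]_(x in cell n)
    oapp (fun k => f (x + intV k)%R) 0 (pickle_inv i))%E.
  apply: eq_eseriesr => i _; rewrite /F; case ei : (pickle_inv i) => [k|]; last first.
    by rewrite integral_set0 /= integral0.
  rewrite integral_mkcond -(integral_translate (intV k)); last 2 first.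
  - have mFi := mF i; rewrite /F ei in mFi.
    by apply/(measurable_restrictT f mFi); exact: measurable_funS mf.
  - by move=> x; rewrite /patch; case: ifP.
  rewrite [RHS]integral_mkcond; apply: eq_integral => x _.
  rewrite !patchE; congr (if _ then _ else _).
  by apply/idP/idP; rewrite !inE /= addrK.
rewrite -integral_nneseries//.
- by apply: eq_integral => x _; rewrite esum_pickle.
- exact: measurable_cell.
- move=> i; case: (pickle_inv i) => [k|] /=; last exact: measurable_cst.
  by apply: measurable_funTS; apply: (measurableT_comp mf); exact: measurable_addrV.
- by move=> i x _; case: pickle_inv => /=.
Qed.

(** An open set is the union of the countably many boxes with rational corners
    that it contains. *)
Lemma open_measurable_rV n (U : set 'rV[R]_n) : open U -> measurable U.
Proof.
move=> oU.
pose B (p : nat * 'rV[int]_n) : set 'rV[R]_n :=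
  box (fun i => `[(p.2 ord0 i)%:~R / p.1.+1%:R, ((p.2 ord0 i)%:~R + 1) / p.1.+1%:R]%classic).
have -> : U = \bigcup_p (if `[< B p `<=` U >] then B p else set0).
  apply/seteqP; split => [x Ux|x [p _]]; last first.
    by case: ifPn => // /asboolP; exact.
  move: oU; rewrite openE => /(_ x Ux)/nbhs_ballP[e /= e0 xe].
  pose j := Num.truncn e^-1.
  have j1 : (j.+1%:R : R)^-1 < e.
    by rewrite -[ltRHS]invrK ltf_pV2 ?posrE ?invr_gt0 ?ltr0n// truncnS_gt.
  have j0 : 0 < j.+1%:R :> R by rewrite ltr0n.
  pose k := \row_i Num.floor (x ord0 i * j.+1%:R).
  have xk i : (k ord0 i)%:~R / j.+1%:R <= x ord0 i < ((k ord0 i)%:~R + 1) / j.+1%:R.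
    rewrite ler_pdivrMr// ltr_pdivlMr// mxE; apply/andP; split; first exact: floor_le_tmp.
    by have := floorD1_gt (x ord0 i * j.+1%:R); rewrite intrD.
  exists (j, k) => //; rewrite ifT.
    by move=> i; have := xk i; rewrite /= in_itv/= => /andP[-> /ltW ->].
  apply/asboolP => y By; apply: xe; split => // i0 i; rewrite (_ : i0 = ord0); last by rewrite ord1.
  rewrite /ball /=.
  have H (a b u v : R) : a <= u <= a + b -> a <= v < a + b -> `|v - u| <= b.
    by rewrite ler_norml; lra.
  apply: (le_lt_trans _ j1); have := xk i; have := By i.
  rewrite /= in_itv/= mulrDl mul1r => h1 h2; exact: H h1 h2.
apply: countable_bigcupT_measurable => // p; case: ifP => // _.
by apply: measurable_box => i; exact: measurable_itv.
Qed.

Lemma continuous_measurable_rV n (f : 'rV[R]_n -> R) : continuous f -> measurable_fun setT f.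
Proof.
move=> /continuousP cf; apply: (measurability _ (RGenOpens.measurableE R)).
move=> _ [_ [a [b ->] <-]]; rewrite setTI; apply: open_measurable_rV.
exact/cf/interval_open.
Qed.

Lemma open_lebesgue_gt0 n (U : set 'rV[R]_n) x : open U -> U x -> (0 < lebesgue_rV R n U)%E.
Proof.
move=> oU Ux; have mU := open_measurable_rV oU.
move: oU; rewrite openE => /(_ x Ux)/nbhs_ballP[e /= e0 xe].
pose B : set 'rV[R]_n := box (fun i => `[x ord0 i, x ord0 i + e / 2]%classic).
have mB : measurable B by apply: measurable_box => i; exact: measurable_itv.
apply: (@lt_le_trans _ _ (lebesgue_rV R n B)); last first.
  apply: le_measure; rewrite ?inE// => y By; apply: xe; split => // i0 i.
  rewrite (_ : i0 = ord0); last by rewrite ord1.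
  rewrite /ball /=; have := By i; rewrite /= in_itv/= ltr_norml; lra.
rewrite lebesgue_rV_box//; elim/big_ind : _ => // [a b|i _].
  exact: mule_gt0.
rewrite lebesgue_measure_itv /= lte_fin ltrDl divr_gt0//.
by rewrite -EFinD lte_fin; lra.
Qed.

(** Tonelli for the positive and negative parts. *)
Lemma measurable_integral_param d (T : measurableType d) n (F : T -> 'rV[R]_n -> R) :
  measurable_fun setT (fun p : T * 'rV[R]_n => F p.1 p.2) ->
  measurable_fun setT (fun t => Rintegral (lebesgue_rV R n) setT (F t)).
Proof.
move=> mF; apply: (measurableT_comp (@fine_measurable R _ measurableT)).
pose G (p : T * 'rV[R]_n) := (F p.1 p.2)%:E.
have mG : measurable_fun setT G by exact/measurable_EFinP.
rewrite [X in measurable_fun _ X](_ : _ = fun t =>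
   (fubini_F (@leb n) G^\+%E t - fubini_F (@leb n) G^\-%E t)%E).
  apply: emeasurable_funB; apply: measurable_fun_fubini_tonelli_F => //.
  - exact: measurable_funepos.
  - exact: measurable_funeneg.
apply/funext => t; rewrite [LHS]integralE.
by congr (_ - _)%E; apply: eq_integral => x _; rewrite ?funeposE ?funenegE.
Qed.

Lemma measurable_periodize n (f : 'rV[R]_n -> \bar R) (D : set 'rV[R]_n) :
  measurable_fun setT f -> (forall x, 0 <= f x)%E -> measurable D ->
  measurable_fun D (fun x => \esum_(k in [set: 'rV[int]_n]) f (x + intV k)%R)%E.
Proof.
move=> mf f0 mD.
rewrite (_ : (fun _ => _) = fun x => (\sum_(i <oo) oapp (fun k => f (x + intV k)%R) 0 (pickle_inv i))%E).
  apply: ge0_emeasurable_sum => [i x _ _|i _]; case: pickle_inv => //= [k].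
  by apply: measurable_funTS; apply: (measurableT_comp mf); exact: measurable_addrV.
by apply/funext => x; rewrite esum_pickle.
Qed.

(** Lets statements on the torus be checked almost everywhere on one cell. *)
Lemma cell_null_periodic n (N : set 'rV[R]_n) : measurable N ->
  (forall x k, N (x + intV k) -> N x) -> lebesgue_rV R n (N `&` cell n) = 0%E ->
  lebesgue_rV R n N = 0%E.
Proof.
move=> mN pN N0; rewrite -(setIT N) -integral_indic//.
have m1 : measurable_fun setT (fun x => (\1_N x : R)%:E) by apply/measurable_EFinP; exact: measurable_indic.
have p1 x : (0 <= (\1_N x : R)%:E)%E by rewrite lee_fin.
rewrite (integral_periodize m1 p1).
transitivity (\int[lebesgue_rV R n]_(x in cell n) (cst 0%E x : \bar R))%E; last by rewrite integral0.
apply: ae_eq_integral => //; first exact: measurable_cell.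
  exact: measurable_periodize m1 p1 (@measurable_cell n).
exists (N `&` cell n); split => //.
  by apply: measurableI => //; exact: measurable_cell.
move=> x /= /not_implyP[cx h]; split => //; apply: contrapT => Nx; apply: h.
apply: esum1 => k _; rewrite indicE memNset// => /pN.
exact: Nx.
Qed.

End measure_rV.

Arguments cell R n : clear implicits.

(** * Complex numbers and complex-valued integrals *)

Section complex_basics.
Context (R : realType).
Implicit Types (z w : R[i]) (t : R).

Lemma cReD z w : complex.Re (z + w) = complex.Re z + complex.Re w.
Proof. by case: z; case: w. Qed.
Lemma cImD z w : complex.Im (z + w) = complex.Im z + complex.Im w.
Proof. by case: z; case: w. Qed.
Lemma cReN z : complex.Re (- z) = - complex.Re z.
Proof. by case: z. Qed.
Lemma cImN z : complex.Im (- z) = - complex.Im z.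
Proof. by case: z. Qed.
Lemma cReM z w : complex.Re (z * w) = complex.Re z * complex.Re w - complex.Im z * complex.Im w.
Proof. by case: z; case: w. Qed.
Lemma cImM z w : complex.Im (z * w) = complex.Re z * complex.Im w + complex.Im z * complex.Re w.
Proof. by case: z; case: w. Qed.
Lemma cReJ z : complex.Re (z^*) = complex.Re z.
Proof. by case: z. Qed.
Lemma cImJ z : complex.Im (z^*) = - complex.Im z.
Proof. by case: z. Qed.
Lemma complexP z w : complex.Re z = complex.Re w -> complex.Im z = complex.Im w -> z = w.
Proof. by case: z; case: w => a b c d /= -> ->. Qed.

Lemma cRe_sum (I : Type) (s : seq I) (P : pred I) (F : I -> R[i]) :
  complex.Re (\sum_(i <- s | P i) F i) = \sum_(i <- s | P i) complex.Re (F i).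
Proof. by apply: (big_morph _ cReD). Qed.
Lemma cIm_sum (I : Type) (s : seq I) (P : pred I) (F : I -> R[i]) :
  complex.Im (\sum_(i <- s | P i) F i) = \sum_(i <- s | P i) complex.Im (F i).
Proof. by apply: (big_morph _ cImD). Qed.

(** The modulus as a real number; the norm of R[i] takes its values in R[i]. *)
Definition nrm z : R := complex.Re `|z|.

Lemma nrmE z : nrm z = Num.sqrt (complex.Re z ^+ 2 + complex.Im z ^+ 2).
Proof. by rewrite /nrm normc_def. Qed.
Lemma nrmC z : (nrm z)%:C%C = `|z|.
Proof. by rewrite /nrm normc_def. Qed.
Lemma nrm_ge0 z : 0 <= nrm z.
Proof. by rewrite nrmE sqrtr_ge0. Qed.
Lemma nrmM z w : nrm (z * w) = nrm z * nrm w.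
Proof. by apply: (@complexI R); rewrite rmorphM /= !nrmC normrM. Qed.
Lemma nrmJ z : nrm (z^*) = nrm z.
Proof. by rewrite !nrmE cReJ cImJ sqrrN. Qed.
Lemma nrmN z : nrm (- z) = nrm z.
Proof. by rewrite /nrm normrN. Qed.
Lemma nrm0 : nrm 0 = 0.
Proof. by rewrite /nrm normr0. Qed.
Lemma le_nrmD z w : nrm (z + w) <= nrm z + nrm w.
Proof. by rewrite -lecR rmorphD /= !nrmC ler_normD. Qed.
Lemma nrm_sum (I : Type) (s : seq I) (P : pred I) (F : I -> R[i]) :
  nrm (\sum_(i <- s | P i) F i) <= \sum_(i <- s | P i) nrm (F i).
Proof.
elim/big_ind2 : _ => [|z a w b za wb|//]; first by rewrite nrm0.
by rewrite (le_trans (le_nrmD _ _))// lerD.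
Qed.
Lemma sqr_nrm z : nrm z ^+ 2 = complex.Re z ^+ 2 + complex.Im z ^+ 2.
Proof. by rewrite nrmE sqr_sqrtr// addr_ge0 ?sqr_ge0. Qed.
Lemma cReJM z : complex.Re (z^* * z) = nrm z ^+ 2.
Proof. by rewrite sqr_nrm cReM cReJ cImJ; ring. Qed.
Lemma cImJM z : complex.Im (z^* * z) = 0.
Proof. by rewrite cImM cReJ cImJ; ring. Qed.
Lemma cJM z : z^* * z = (nrm z ^+ 2)%:C%C.
Proof. by apply: complexP; rewrite ?cReJM ?cImJM. Qed.
Lemma le_Re_nrm z : `|complex.Re z| <= nrm z.
Proof. by rewrite nrmE -sqrtr_sqr ler_wsqrtr// lerDl sqr_ge0. Qed.
Lemma le_Im_nrm z : `|complex.Im z| <= nrm z.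
Proof. by rewrite nrmE -sqrtr_sqr ler_wsqrtr// lerDr sqr_ge0. Qed.
Lemma le_nrm_ReIm z : nrm z <= `|complex.Re z| + `|complex.Im z|.
Proof.
rewrite -[leLHS]ger0_norm ?nrm_ge0// -ler_sqr ?nnegrE ?addr_ge0// ?real_normK ?num_real//.
rewrite sqr_nrm sqrrD !real_normK ?num_real//.
by rewrite -addrA [_ *+ 2 + _]addrC addrA lerDl mulrn_wge0// mulr_ge0.
Qed.
Lemma nrm_real t : nrm t%:C%C = `|t|.
Proof. by rewrite nrmE /= expr0n addr0 sqrtr_sqr. Qed.

Lemma expi2piD (s t : R) : expi2pi (s + t) = expi2pi s * expi2pi t.
Proof. by rewrite /expi2pi mulrDr cosD sinD; apply: complexP; rewrite ?cReM ?cImM /=; ring. Qed.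
Lemma expi2pi0 : expi2pi (0 : R) = 1.
Proof. by rewrite /expi2pi mulr0 cos0 sin0. Qed.
Lemma expi2piJ t : (expi2pi t)^* = expi2pi (- t).
Proof. by apply: complexP; rewrite ?cReJ ?cImJ /= mulrN ?cosN ?sinN. Qed.
Lemma nrm_expi2pi t : nrm (expi2pi t) = 1.
Proof. by rewrite nrmE /= cos2Dsin2 sqrtr1. Qed.
Lemma expi2pi_int (k : int) : expi2pi (k%:~R : R) = 1.
Proof.
have nat1 (m : nat) : expi2pi (m%:R : R) = 1.
  elim: m => [|m IH]; first exact: expi2pi0.
  rewrite -natr1 expi2piD IH mul1r /expi2pi mulr1 mulr_natl cos2pi sin2pi //.
case: k => m; first exact: nat1.
by rewrite NegzE mulrNz -[LHS]conjCK expi2piJ opprK (nat1 m.+1) conjC1.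
Qed.
Lemma expi2pi_half : expi2pi (2^-1 : R) = -1.
Proof. by apply: complexP; rewrite /= mulrAC divff ?pnatr_eq0// mul1r ?cospi ?sinpi ?oppr0. Qed.

End complex_basics.

Section complex_integral.
Context (R : realType) (n : nat).
Local Notation Rn := 'rV[R]_n.
Local Notation mu := (lebesgue_rV R n).
Implicit Types (f g : Rn -> R[i]) (c : R[i]).

Definition cmeasurable f :=
  measurable_fun setT (fun x => complex.Re (f x)) /\
  measurable_fun setT (fun x => complex.Im (f x)).

Lemma cmeasurableD f g : cmeasurable f -> cmeasurable g -> cmeasurable (fun x => f x + g x).
Proof.
move=> [f1 f2] [g1 g2]; split.
  by under eq_fun do rewrite cReD; exact: measurable_funD.
by under eq_fun do rewrite cImD; exact: measurable_funD.
Qed.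

Lemma cmeasurableM f g : cmeasurable f -> cmeasurable g -> cmeasurable (fun x => f x * g x).
Proof.
move=> [f1 f2] [g1 g2]; split.
  by under eq_fun do rewrite cReM; apply: measurable_funB; exact: measurable_funM.
by under eq_fun do rewrite cImM; apply: measurable_funD; exact: measurable_funM.
Qed.

Lemma cmeasurable_cst c : cmeasurable (fun=> c).
Proof. by split; exact: measurable_cst. Qed.

Lemma cmeasurableN f : cmeasurable f -> cmeasurable (fun x => - f x).
Proof.
by move=> mf; under eq_fun do rewrite -mulN1r; apply: cmeasurableM => //; exact: cmeasurable_cst.
Qed.

Lemma cmeasurable_comp f (h : Rn -> Rn) : measurable_fun setT h ->
  cmeasurable f -> cmeasurable (fun x => f (h x)).
Proof. by move=> mh [f1 f2]; split; [exact: (measurableT_comp f1)|exact: (measurableT_comp f2)]. Qed.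

Lemma cmeasurable_sum (I : Type) (s : seq I) (F : I -> Rn -> R[i]) :
  (forall i, cmeasurable (F i)) -> cmeasurable (fun x => \sum_(i <- s) F i x).
Proof.
move=> mF; elim: s => [|i s IH].
  by under eq_fun do rewrite big_nil; exact: cmeasurable_cst.
by under eq_fun do rewrite big_cons; exact: cmeasurableD.
Qed.

Lemma measurable_nrm f : cmeasurable f -> measurable_fun setT (fun x => nrm (f x)).
Proof.
move=> [f1 f2]; under eq_fun do rewrite nrmE.
apply: (measurableT_comp (continuous_measurable_fun (@sqrt_continuous R))).
by apply: measurable_funD; apply: measurable_funX.
Qed.

Definition cintegrable f :=
  mu.-integrable setT (EFin \o (fun x => complex.Re (f x))) /\
  mu.-integrable setT (EFin \o (fun x => complex.Im (f x))).

Lemma eq_cintegral f g : (forall x, f x = g x) -> cintegral f = cintegral g.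
Proof. by move=> fg; congr cintegral; apply/funext. Qed.

Lemma cintegrableD f g : cintegrable f -> cintegrable g -> cintegrable (fun x => f x + g x).
Proof.
move=> [f1 f2] [g1 g2]; split.
  rewrite (_ : _ \o _ = (EFin \o (fun x => complex.Re (f x))) \+ (EFin \o (fun x => complex.Re (g x))))%E; first exact: integrableD.
  by apply/funext => x /=; rewrite cReD.
rewrite (_ : _ \o _ = (EFin \o (fun x => complex.Im (f x))) \+ (EFin \o (fun x => complex.Im (g x))))%E; first exact: integrableD.
by apply/funext => x /=; rewrite cImD.
Qed.

Lemma cintegralD f g : cintegrable f -> cintegrable g ->
  cintegral (fun x => f x + g x) = cintegral f + cintegral g.
Proof.
move=> [f1 f2] [g1 g2]; apply: complexP => /=.
  by rewrite -RintegralD//; apply: eq_Rintegral => x _; rewrite cReD.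
by rewrite -RintegralD//; apply: eq_Rintegral => x _; rewrite cImD.
Qed.

Lemma integrableZ_real (r : R) (h : Rn -> R) : mu.-integrable setT (EFin \o h) ->
  mu.-integrable setT (EFin \o (fun x => r * h x)).
Proof.
move=> hi; rewrite (_ : _ \o _ = fun x => (r%:E * (EFin \o h) x)%E); last by apply/funext.
exact: integrableZl.
Qed.

Lemma cintegrableZ c f : cintegrable f -> cintegrable (fun x => c * f x).
Proof.
move=> [f1 f2]; split.
  rewrite (_ : _ \o _ = ((EFin \o (fun x => (complex.Re c * complex.Re (f x))%R)) \- (EFin \o (fun x => (complex.Im c * complex.Im (f x))%R)))%E).
    by apply: integrableB => //; exact: integrableZ_real.
  by apply/funext => x /=; rewrite cReM.
rewrite (_ : _ \o _ = ((EFin \o (fun x => (complex.Re c * complex.Im (f x))%R)) \+ (EFin \o (fun x => (complex.Im c * complex.Re (f x))%R)))%E).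
  by apply: integrableD => //; exact: integrableZ_real.
by apply/funext => x /=; rewrite cImM.
Qed.

Lemma cintegralZ c f : cintegrable f ->
  cintegral (fun x => c * f x) = c * cintegral f.
Proof.
move=> [f1 f2]; apply: complexP; rewrite ?cReM ?cImM /=.
  rewrite -!RintegralZl// -RintegralB//; try exact: integrableZ_real.
  by apply: eq_Rintegral => x _; rewrite cReM.
rewrite -!RintegralZl// -RintegralD//; try exact: integrableZ_real.
by apply: eq_Rintegral => x _; rewrite cImM.
Qed.

Lemma cintegrable0 : cintegrable (fun=> 0).
Proof. by split; exact: integrable0. Qed.

Lemma cintegral0 : cintegral (fun _ : Rn => (0 : R[i])) = 0.
Proof.
by apply: complexP; rewrite /= /Rintegral (eq_integral (cst 0%E)) ?integral0.
Qed.

Lemma cintegrable_sum (I : Type) (s : seq I) (F : I -> Rn -> R[i]) :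
  (forall i, cintegrable (F i)) -> cintegrable (fun x => \sum_(i <- s) F i x).
Proof.
move=> iF; elim: s => [|i s IH].
  by under eq_fun do rewrite big_nil; exact: cintegrable0.
by under eq_fun do rewrite big_cons; exact: cintegrableD.
Qed.

Lemma cintegral_sum (I : Type) (s : seq I) (F : I -> Rn -> R[i]) :
  (forall i, cintegrable (F i)) ->
  cintegral (fun x => \sum_(i <- s) F i x) = \sum_(i <- s) cintegral (F i).
Proof.
move=> iF; elim: s => [|i s IH].
  by rewrite big_nil -[RHS]cintegral0; apply: eq_cintegral => x; rewrite big_nil.
rewrite big_cons -IH -cintegralD//; last exact: cintegrable_sum.
by apply: eq_cintegral => x; rewrite big_cons.
Qed.

Lemma cintegralJ f : cintegrable f -> cintegral (fun x => (f x)^*) = (cintegral f)^*.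
Proof.
move=> [f1 f2]; apply: complexP; rewrite ?cReJ ?cImJ /=.
  by apply: eq_Rintegral => x _; rewrite cReJ.
rewrite -mulN1r -RintegralZl//; apply: eq_Rintegral => x _.
by rewrite cImJ mulN1r.
Qed.

Lemma Rintegral_translate (v : Rn) (h : Rn -> R) : measurable_fun setT h ->
  Rintegral mu setT (fun x => h (x + v)) = Rintegral mu setT h.
Proof.
move=> mh; rewrite /Rintegral; congr fine; rewrite [LHS]integralE [RHS]integralE.
have mE : measurable_fun setT (EFin \o h) by exact/measurable_EFinP.
rewrite -(integral_translate v (measurable_funepos mE))//.
rewrite -(integral_translate v (measurable_funeneg mE))//.
by congr (_ - _)%E; apply: eq_integral => x _; rewrite ?funeposE ?funenegE.
Qed.

Lemma cintegral_translate (v : Rn) f : cmeasurable f ->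
  cintegral (fun x => f (x + v)) = cintegral f.
Proof.
by move=> [f1 f2]; apply: complexP; [exact: Rintegral_translate f1|exact: Rintegral_translate f2].
Qed.

Lemma Rintegral_mulmx (B : 'M[R]_n) (h : Rn -> R) : \det B != 0 -> measurable_fun setT h ->
  `|\det B| * Rintegral mu setT (fun x => h (x *m B)) = Rintegral mu setT h.
Proof.
move=> dB mh; rewrite /Rintegral -[X in X * _]/(fine `|\det B|%:E).
have mE : measurable_fun setT (EFin \o h) by exact/measurable_EFinP.
have dB0 : (0 < `|\det B|)%R by rewrite normr_gt0.
have -> : (\int[mu]_x (h x)%:E = `|\det B|%:E * \int[mu]_x (h (x *m B))%:E)%E.
  rewrite [LHS]integralE [in RHS]integralE.
  rewrite -(scales_integral (scales_unit dB) (measurable_funepos mE))//.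
  rewrite -(scales_integral (scales_unit dB) (measurable_funeneg mE))//.
  have E (a b : \bar R) : (`|\det B|%:E * a - `|\det B|%:E * b = `|\det B|%:E * (a - b))%E.
    by case: a => [a| |]; case: b => [b| |];
      rewrite ?(gt0_muley, gt0_muleNy, lte_fin)//= -?EFinM -?EFinB -?EFinM ?mulrBr.
  rewrite E; congr (_ * (_ - _))%E.
    by apply: eq_integral => x _; rewrite ?funeposE ?funenegE.
  by apply: eq_integral => x _; rewrite ?funeposE ?funenegE.
by case: (\int[mu]_x _)%E => //= [|]; rewrite ?mulr0// ?(gt0_muley, gt0_muleNy, lte_fin).
Qed.

Lemma cintegral_mulmx (B : 'M[R]_n) f : \det B != 0 -> cmeasurable f ->
  `|\det B|%:C%C * cintegral (fun x => f (x *m B)) = cintegral f.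
Proof.
move=> dB [f1 f2]; apply: complexP => /=; rewrite mul0r ?subr0 ?addr0.
  exact: Rintegral_mulmx.
exact: Rintegral_mulmx.
Qed.

Lemma cintegrable_le f (h : Rn -> R) : cmeasurable f ->
  mu.-integrable setT (EFin \o h) -> (forall x, nrm (f x) <= h x) -> cintegrable f.
Proof.
move=> [f1 f2] ih fh; split.
  apply: (le_integrable _ _ _ ih) => //; first exact/measurable_EFinP.
  move=> x _; rewrite /= lee_fin (le_trans (le_Re_nrm _))// (le_trans (fh x))//.
  exact: ler_norm.
apply: (le_integrable _ _ _ ih) => //; first exact/measurable_EFinP.
move=> x _; rewrite /= lee_fin (le_trans (le_Im_nrm _))// (le_trans (fh x))//.
exact: ler_norm.
Qed.

Lemma integrable_indic_bounded (A : set Rn) (C : R) : measurable A -> (mu A < +oo)%E ->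
  mu.-integrable setT (EFin \o (fun x => C * \1_A x)).
Proof.
move=> mA Aoo; apply: integrableZ_real.
have h : (integral mu setT (EFin \o (\1_A : Rn -> R)) < +oo)%E.
  by rewrite integral_indic// setIT.
apply/integrableP; split; first by apply/measurable_EFinP; exact: measurable_indic.
by under eq_integral do rewrite gee0_abs ?lee_fin//.
Qed.

Lemma cintegrable_bounded f (A : set Rn) (C : R) : measurable A -> (mu A < +oo)%E ->
  cmeasurable f -> (forall x, nrm (f x) <= C * \1_A x) -> cintegrable f.
Proof.
by move=> mA Aoo mf fC; apply: (cintegrable_le mf (integrable_indic_bounded C mA Aoo)).
Qed.

(** The factor 2 comes from bounding real and imaginary parts separately; only
    convergence to 0 is at stake where this is used. *)
Lemma le_nrm_cintegral f (h : Rn -> R) : cintegrable f ->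
  mu.-integrable setT (EFin \o h) -> (forall x, nrm (f x) <= h x) ->
  nrm (cintegral f) <= 2 * Rintegral mu setT h.
Proof.
move=> [f1 f2] ih fh; rewrite (le_trans (le_nrm_ReIm _))// mulrDl mul1r /=.
apply: lerD.
  apply: (le_trans (le_normr_Rintegral measurableT f1)).
  apply: le_Rintegral => //; first exact: integrable_norm f1.
  by move=> x _; rewrite (le_trans (le_Re_nrm _)).
apply: (le_trans (le_normr_Rintegral measurableT f2)).
apply: le_Rintegral => //; first exact: integrable_norm f2.
by move=> x _; rewrite (le_trans (le_Im_nrm _)).
Qed.

End complex_integral.

(** * Continuous functions of bounded support *)

Section compactly_supported.
Context (R : realType) (n : nat).
Local Notation Rn := 'rV[R]_n.
Local Notation mu := (lebesgue_rV R n).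
Implicit Types (f g : Rn -> R[i]) (h k : Rn -> R).

Lemma rV_continuousD h k : continuous h -> continuous k -> continuous (fun x => h x + k x).
Proof. by move=> ch ck x; exact: (cvgD (ch x) (ck x)). Qed.

Lemma rV_continuousB h k : continuous h -> continuous k -> continuous (fun x => h x - k x).
Proof. by move=> ch ck x; exact: (cvgB (ch x) (ck x)). Qed.

Lemma rV_continuousN h : continuous h -> continuous (fun x => - h x).
Proof. by move=> ch x; exact: (cvgN (ch x)). Qed.

Lemma rV_continuousM h k : continuous h -> continuous k -> continuous (fun x => h x * k x).
Proof. by move=> ch ck x; exact: (cvgM (ch x) (ck x)). Qed.

Lemma rV_continuous_comp (k : R -> R) h : continuous k -> continuous h ->
  continuous (fun x => k (h x)).
Proof. by move=> ck ch x; exact: (continuous_comp (ch x) (ck (h x))). Qed.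

Lemma rV_continuous_sum (I : Type) (s : seq I) (F : I -> Rn -> R) :
  (forall i, continuous (F i)) -> continuous (fun x => \sum_(i <- s) F i x).
Proof.
move=> cF; elim: s => [|i s IH].
  by under eq_fun do rewrite big_nil; exact: cst_continuous.
by under eq_fun do rewrite big_cons; exact: rV_continuousD.
Qed.

Lemma rV_continuousP m (T : Rn -> 'rV[R]_m) :
  (forall i, continuous (fun x => T x ord0 i)) -> continuous T.
Proof.
move=> cT x; have FFx := nbhs_filter (x : Rn); apply/cvg_ballP => e e0.
have H : \forall t \near (x : Rn), forall i, ball (T x ord0 i) e (T t ord0 i).
  have H1 i : \forall t \near (x : Rn), ball (T x ord0 i) e (T t ord0 i).
    exact: (cvg_ball (cT i x) e0).
  exact: (@filter_forall Rn 'I_m (fun i => [set t | ball (T x ord0 i) e (T t ord0 i)]) (nbhs (x : Rn)) FFx H1).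
apply: filterS H => t H; split => // i0 i.
by rewrite (_ : i0 = ord0)//; last by rewrite ord1.
Qed.

Lemma continuous_mulmxrV m (B : 'M[R]_(n, m)) : continuous (fun x : Rn => x *m B).
Proof.
apply: rV_continuousP => i; under eq_fun do rewrite mxE.
apply: rV_continuous_sum => j; apply: rV_continuousM; last exact: cst_continuous.
exact: coord_continuous.
Qed.

Lemma continuous_dotr (xi : Rn) : continuous (fun x : Rn => dotr x xi).
Proof.
rewrite /dotr; under eq_fun do rewrite mxE.
apply: rV_continuous_sum => j; apply: rV_continuousM; last exact: cst_continuous.
exact: coord_continuous.
Qed.

Lemma compact_cube r : compact (@cube R n r).
Proof.
have := @rV_compact R n (fun=> `[- r%:R, r%:R]%classic); apply => i.
exact: segment_compact.
Qed.

Lemma bounded_ctsupp_real h r : continuous h -> (forall x, h x != 0 -> cube r x) ->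
  exists2 C, 0 <= C & forall x, `|h x| <= C.
Proof.
move=> ch hr.
have /compact_bounded [M [_ hM]] : compact (h @` @cube R n r).
  by apply: continuous_compact (@compact_cube r); exact: continuous_subspaceT.
exists (`|M| + 1) => [|x]; first by rewrite addr_ge0.
have [->|/hr xr] := eqVneq (h x) 0; first by rewrite normr0 addr_ge0.
apply: hM; last by exists x.
by rewrite (le_lt_trans (ler_norm _))// ltrDl.
Qed.

(** Heine's theorem, in the form of near-coverings of the compact cube: the
    increments t close to 0 are uniform in x. *)
Lemma unif_ctsupp_real h r (e : R) : continuous h -> (forall x, h x != 0 -> cube r x) -> 0 < e ->
  exists2 dl, 0 < dl & forall x t : Rn, (forall i, `|t ord0 i| < dl) -> `|h (x + t) - h x| < e.
Proof.
move=> ch hr e0.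
have nr : forall x, ~ cube r x -> h x = 0.
  by move=> x nx; apply/eqP; apply: contrapT => /negP /hr.
have : \forall t \near (0 : Rn), @cube R n r `<=` (fun x => `|h (x + t) - h x| < e).
  have /compact_near_coveringP/(_ Rn (nbhs (0 : Rn)) (fun t x => `|h (x + t) - h x| < e) (nbhs_filter _)) := @compact_cube r.
  apply => x xr.
  have c2 : continuous (fun p : Rn * Rn => h (p.1 + p.2) - h p.1).
    move=> p; apply: cvgB; last by apply: cvg_comp; [exact: cvg_fst|exact: ch].
    by apply: (@cvg_comp _ _ _ (fun p : Rn * Rn => p.1 + p.2) h); [exact: add_continuous|exact: ch].
  have /cvgr_dist_lt /(_ e e0) := c2 (x, 0); rewrite /= addr0 subrr.
  by apply: filterS => p /=; rewrite sub0r normrN.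
move=> /nbhs_ballP[dl /= dl0 H]; exists dl => // x t tdl.
have [xr|nx] := pselect (cube r x).
  apply: H xr; split => // i0 i; rewrite (_ : i0 = ord0); last by rewrite ord1.
  by rewrite /ball /= mxE sub0r normrN.
(* If only x + t is in the cube, exchange the two points. *)
have [xtr|nxt] := pselect (cube r (x + t)); last by rewrite !nr// subrr normr0.
have := H (- t) _ _ xtr; rewrite addrK distrC; apply; split => // i0 i.
rewrite (_ : i0 = ord0); last by rewrite ord1.
by rewrite /ball /= !mxE sub0r opprK.
Qed.

(** The working form of [Cc], which avoids the topology of R[i] and the closure
    of the support. *)
Definition ctsupp f := [/\ continuous (fun x => complex.Re (f x)),
  continuous (fun x => complex.Im (f x)) & exists r, forall x, f x != 0 -> cube r x].

Lemma continuous_Re (f : Rn -> R[i]) : continuous (f : Rn -> R[i]^o) ->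
  continuous (fun x => complex.Re (f x)) /\ continuous (fun x => complex.Im (f x)).
Proof.
move=> cf.
have H x (e : R) : 0 < e -> \forall y \near x, nrm (f x - f y) < e.
  move=> e0; have ec : 0 < e%:C%C :> R[i] by rewrite ltcR.
  have /cvgr_dist_lt /(_ _ ec) := cf x.
  by apply: filterS => y; rewrite -nrmC ltcR.
split=> x; have FFx := nbhs_filter (x : Rn); apply/cvgrPdist_lt => e e0;
  apply: filterS (H x e e0) => y; apply: le_lt_trans.
  by rewrite -cReN -cReD le_Re_nrm.
by rewrite -cImN -cImD le_Im_nrm.
Qed.

Lemma Cc_ctsupp f : Cc f -> ctsupp f.
Proof.
move=> [/continuous_Re[cR cI] /compact_bounded[M [_ hM]]]; split => //.
exists (Num.truncn (`|M| + 1)).+1 => x fx i.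
have : `|x| <= `|M| + 1.
  apply: hM; first by rewrite (le_lt_trans (ler_norm _))// ltrDl.
  exact: subset_closure.
rewrite set_itvE /= -ler_norml => xM.
have xi : `|x ord0 i| <= `|x|.
  rewrite [leRHS]/Num.norm /= mx_normrE.
  exact: (@le_bigmax _ _ _ 0 (fun ij => `|x ij.1 ij.2|) (ord0, i)).
by rewrite (le_trans xi)// (le_trans xM)// ltW// truncnS_gt.
Qed.

Lemma ctsupp_cmeasurable f : ctsupp f -> cmeasurable f.
Proof. by move=> [cR cI _]; split; exact: continuous_measurable_rV. Qed.

Lemma ctsupp_bounded f : ctsupp f -> exists2 C, 0 <= C & forall x, nrm (f x) <= C.
Proof.
move=> [cR cI [r fr]].
have [|C1 C10 h1] := bounded_ctsupp_real cR (r := r).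
  by move=> x fx; apply: fr; apply: contra_neq fx => ->.
have [|C2 C20 h2] := bounded_ctsupp_real cI (r := r).
  by move=> x fx; apply: fr; apply: contra_neq fx => ->.
exists (C1 + C2) => [|x]; first exact: addr_ge0.
by rewrite (le_trans (le_nrm_ReIm _))// lerD.
Qed.

Lemma ctsupp_unif f (e : R) : ctsupp f -> 0 < e ->
  exists2 dl, 0 < dl & forall x t : Rn, (forall i, `|t ord0 i| < dl) -> nrm (f (x + t) - f x) <= e.
Proof.
move=> [cR cI [r fr]] e0; have e2 : 0 < e / 2 by rewrite divr_gt0.
have [|d1 d10 h1] := unif_ctsupp_real (e := e / 2) cR (r := r) _ e2.
  by move=> x fx; apply: fr; apply: contra_neq fx => ->.
have [|d2 d20 h2] := unif_ctsupp_real (e := e / 2) cI (r := r) _ e2.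
  by move=> x fx; apply: fr; apply: contra_neq fx => ->.
exists (Num.min d1 d2) => [|x t td]; first by rewrite lt_min d10.
rewrite (le_trans (le_nrm_ReIm _))// cReD cImD cReN cImN.
rewrite [leRHS](splitr e) lerD// ltW//; [apply: h1|apply: h2] => i.
  by have := td i; rewrite lt_min => /andP[].
by have := td i; rewrite lt_min => /andP[].
Qed.

Lemma ctsupp_indic f : ctsupp f ->
  exists r, exists C, forall x, nrm (f x) <= C * \1_(@cube R n r) x.
Proof.
move=> fc; have [C C0 fC] := ctsupp_bounded fc; have [_ _ [r fr]] := fc.
exists r, C => x; rewrite indicE; case: (boolP (x \in _)) => /=; first by rewrite mulr1.
rewrite notin_setE => nx; rewrite mulr0.
by have [->|/fr//] := eqVneq (f x) 0; rewrite nrm0.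
Qed.

Lemma ctsupp_integrable f : ctsupp f -> cintegrable f.
Proof.
move=> fc; have [r [C fC]] := ctsupp_indic fc.
apply: (cintegrable_bounded (@measurable_cube R n r) (lebesgue_cube_lty _ _ _)) fC.
exact: ctsupp_cmeasurable.
Qed.

Lemma ctsuppM f g : ctsupp f -> continuous (fun x => complex.Re (g x)) ->
  continuous (fun x => complex.Im (g x)) -> ctsupp (fun x => f x * g x).
Proof.
move=> [fR fI [r fr]] gR gI; split.
- by under eq_fun do rewrite cReM; apply: rV_continuousB; exact: rV_continuousM.
- by under eq_fun do rewrite cImM; apply: rV_continuousD; exact: rV_continuousM.
- by exists r => x; rewrite mulf_eq0 negb_or => /andP[/fr].
Qed.

Lemma ctsuppMl f g : ctsupp f -> ctsupp g -> ctsupp (fun x => f x * g x).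
Proof. by move=> fc [gR gI _]; exact: ctsuppM. Qed.

Lemma ctsuppZ c f : ctsupp f -> ctsupp (fun x => c * f x).
Proof.
by move=> fc; under eq_fun do rewrite mulrC; apply: ctsuppM => //; exact: cst_continuous.
Qed.

Lemma ctsuppD f g : ctsupp f -> ctsupp g -> ctsupp (fun x => f x + g x).
Proof.
move=> [fR fI [r fr]] [gR gI [s gs]]; split.
- by under eq_fun do rewrite cReD; exact: rV_continuousD.
- by under eq_fun do rewrite cImD; exact: rV_continuousD.
exists (maxn r s) => x fg.
have H (m : nat) : (m <= maxn r s)%N -> cube m x -> cube (maxn r s) x.
  move=> kr xk i; have := xk i; rewrite !set_itvE /= -!ler_norml => /le_trans; apply.
  by rewrite ler_nat.
have [fx|/fr xr] := eqVneq (f x) 0; last exact: (H r (leq_maxl _ _)).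
apply: (H s (leq_maxr _ _)); apply: gs; apply: contra_neq fg => gx.
by rewrite fx gx addr0.
Qed.

Lemma ctsuppB f g : ctsupp f -> ctsupp g -> ctsupp (fun x => f x - g x).
Proof.
move=> fc gc; apply: ctsuppD => //.
by under eq_fun do rewrite -mulN1r; exact: ctsuppZ.
Qed.

Lemma ctsuppJ f : ctsupp f -> ctsupp (fun x => (f x)^*).
Proof.
move=> [fR fI [r fr]]; split.
- by under eq_fun do rewrite cReJ.
- by under eq_fun do rewrite cImJ; exact: rV_continuousN.
- by exists r => x; rewrite conjC_eq0; exact: fr.
Qed.

Lemma ctsupp_comp f (T : Rn -> Rn) : continuous T ->
  (forall r, exists s, forall x, cube r (T x) -> cube s x) -> ctsupp f ->
  ctsupp (fun x => f (T x)).
Proof.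
move=> cT hT [fR fI [r fr]]; split.
- by move=> x; exact: (continuous_comp (cT x) (fR (T x))).
- by move=> x; exact: (continuous_comp (cT x) (fI (T x))).
- by have [s rs] := hT r; exists s => x /fr /rs.
Qed.

End compactly_supported.

(** * Characters of the torus *)

Section trig.
Context (R : realType) (n : nat).
Local Notation Rn := 'rV[R]_n.
Local Notation Zn := 'rV[int]_n.
Local Notation mu := (lebesgue_rV R n).
Local Notation Q := (cell R n).

Lemma dotrE (x y : Rn) : dotr x y = \sum_i x ord0 i * y ord0 i.
Proof. by rewrite /dotr mxE; apply: eq_bigr => i _; rewrite mxE. Qed.

Lemma dotrDl (x y z : Rn) : dotr (x + y) z = dotr x z + dotr y z.
Proof. by rewrite /dotr mulmxDl mxE. Qed.

Lemma dotrDr (x y z : Rn) : dotr z (x + y) = dotr z x + dotr z y.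
Proof. by rewrite /dotr linearD /= mulmxDr mxE. Qed.

Lemma dotrNl (x z : Rn) : dotr (- x) z = - dotr x z.
Proof. by rewrite /dotr mulNmx mxE. Qed.

Lemma dotrNr (x z : Rn) : dotr z (- x) = - dotr z x.
Proof. by rewrite /dotr linearN /= mulmxN mxE. Qed.

Lemma dotr0l (x : Rn) : dotr 0 x = 0.
Proof. by rewrite /dotr mul0mx mxE. Qed.

Lemma dotr0r (x : Rn) : dotr x 0 = 0.
Proof. by rewrite /dotr linear0 mulmx0 mxE. Qed.

Lemma dotr_mulmx m (x : 'rV[R]_m) (B : 'M[R]_(m, n)) (y : Rn) :
  dotr (x *m B) y = dotr x (y *m B^T).
Proof. by rewrite /dotr trmx_mul trmxK mulmxA. Qed.

Lemma intVD (k l : Zn) : intV R (k + l) = intV R k + intV R l.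
Proof. exact: map_mxD. Qed.

Lemma intVN (k : Zn) : intV R (- k) = - intV R k.
Proof. exact: map_mxN. Qed.

Lemma intV0 : intV R (0 : Zn) = 0.
Proof. exact: map_mx0. Qed.

Lemma intVK (k : Zn) : nearZ (intV R k) = k.
Proof.
apply/esym/cellP; rewrite subrr => i; rewrite set_itvE /= mxE.
by rewrite oppr_le0 invr_ge0 invr_gt0 ler0n ltr0n.
Qed.

Lemma intV_inj : injective (@intV R n).
Proof. by move=> k l /(congr1 (@nearZ R n)); rewrite !intVK. Qed.

Lemma expi2pi_dotr_int (k l : Zn) : expi2pi (dotr (intV R k) (intV R l)) = 1.
Proof.
rewrite dotrE (_ : \sum_i _ = (\sum_i k ord0 i * l ord0 i)%:~R) ?expi2pi_int//.
rewrite (big_morph (fun z : int => z%:~R : R) (@intrD R) (erefl _)).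
by apply: eq_bigr => i _; rewrite !mxE intrM.
Qed.

(** The character of the torus attached to k in Z^n. *)
Definition trig (k : Zn) (x : Rn) : R[i] := expi2pi (dotr x (intV R k)).

Lemma trigD k l x : trig (k + l) x = trig k x * trig l x.
Proof. by rewrite /trig intVD dotrDr expi2piD. Qed.

Lemma trigDx k x y : trig k (x + y) = trig k x * trig k y.
Proof. by rewrite /trig dotrDl expi2piD. Qed.

Lemma trigN k x : trig (- k) x = (trig k x)^*.
Proof. by rewrite /trig intVN dotrNr expi2piJ. Qed.

Lemma trigNx k x : trig k (- x) = (trig k x)^*.
Proof. by rewrite /trig dotrNl expi2piJ. Qed.

Lemma trig0 x : trig 0 x = 1.
Proof. by rewrite /trig intV0 dotr0r expi2pi0. Qed.

Lemma trig_periodic k l x : trig k (x + intV R l) = trig k x.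
Proof. by rewrite trigDx /trig expi2pi_dotr_int mulr1. Qed.

Lemma nrm_trig k x : nrm (trig k x) = 1.
Proof. exact: nrm_expi2pi. Qed.

Lemma continuous_expi2pi_dotr (xi : Rn) :
  continuous (fun x => complex.Re (expi2pi (dotr x xi))) /\
  continuous (fun x => complex.Im (expi2pi (dotr x xi))).
Proof.
split.
  apply: (@rV_continuous_comp _ _ cos (fun x => 2 * pi * dotr x xi)); first exact: continuous_cos.
  by apply: rV_continuousM; [exact: cst_continuous|exact: continuous_dotr].
apply: (@rV_continuous_comp _ _ sin (fun x => 2 * pi * dotr x xi)); first exact: continuous_sin.
by apply: rV_continuousM; [exact: cst_continuous|exact: continuous_dotr].
Qed.

Lemma cmeasurable_expi2pi_dotr (xi : Rn) : cmeasurable (fun x => expi2pi (dotr x xi)).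
Proof.
by have [cR cI] := continuous_expi2pi_dotr xi; split; exact: continuous_measurable_rV.
Qed.

Lemma esum_single (T : choiceType) (t0 : T) (a : T -> \bar R) : (forall t, 0 <= a t)%E ->
  (forall t, t <> t0 -> a t = 0%E) -> (\esum_(t in [set: T]) a t = a t0)%E.
Proof.
move=> a0 az; rewrite -(esum_set1 (a0 t0)) [RHS]esum_mkcond.
apply: eq_esum => t _; case: ifPn => //; rewrite notin_setE /= => /az.
by [].
Qed.

Lemma esum_ge_seq (T : choiceType) (s : seq T) (a : T -> \bar R) : (forall t, 0 <= a t)%E ->
  uniq s -> (\sum_(t <- s) a t <= \esum_(t in [set: T]) a t)%E.
Proof.
move=> a0 us; apply: esum_ge; exists [set` s]; last by rewrite -fsbig_seq.
by split => //; exact: finite_seq.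
Qed.

Lemma esum_le_seq (T : choiceType) (a : T -> \bar R) (L : \bar R) :
  (forall s : seq T, uniq s -> \sum_(t <- s) a t <= L)%E ->
  (\esum_(t in [set: T]) a t <= L)%E.
Proof.
move=> aL; apply: ub_ereal_sup => _ [X [fX _] <-].
by rewrite fsbig_finite//=; exact: aL.
Qed.

Lemma esum_seq (T : choiceType) (s : seq T) (a : T -> \bar R) : (forall t, 0 <= a t)%E ->
  uniq s -> (forall t, t \notin s -> a t = 0%E) ->
  (\esum_(t in [set: T]) a t = \sum_(t <- s) a t)%E.
Proof.
move=> a0 us az; apply/eqP; rewrite eq_le esum_ge_seq// andbT.
apply: esum_le_seq => u uu; rewrite (bigID (mem s))/= [X in (_ + X)%E]big1 ?adde0; last first.
  by move=> t; exact: az.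
rewrite -big_filter [leRHS](bigID (mem u)) /= -[X in (X <= _)%E]adde0.
apply: leeD; last by apply: sume_ge0.
rewrite -[leRHS]big_filter (perm_big [seq i <- s | i \in u])//=.
by apply: uniq_perm; rewrite ?filter_uniq// => t; rewrite !mem_filter andbC.
Qed.

(** A translated cell is again a fundamental domain: periodize h times the
    indicator of the translated cell; above each x exactly one integer translate
    contributes. *)
Lemma integral_cell_shift (v : Rn) (h : Rn -> \bar R) : measurable_fun setT h ->
  (forall x, 0 <= h x)%E -> (forall (x : Rn) (k : Zn), h (x + intV R k) = h x) ->
  (\int[mu]_(x in Q) h (x + v)%R = \int[mu]_(x in Q) h x)%E.
Proof.
move=> mh h0 hp.
pose F x := ((\1_Q (x - v))%:E * h x)%E.
have F0 x : (0 <= F x)%E by rewrite mule_ge0 ?lee_fin.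
have mF : measurable_fun setT F.
  apply: emeasurable_funM => //; apply/measurable_EFinP.
  apply: (measurableT_comp (f := (\1_Q : Rn -> R))); last exact: measurable_addrV.
  by apply: measurable_indic; exact: measurable_cell.
transitivity (\int[mu]_x F x)%E.
  rewrite integral_mkcond -(integral_translate v mF F0); apply: eq_integral => x _.
  by rewrite /F addrK patchE indicE; case: (x \in Q); rewrite ?mul1e ?mul0e.
rewrite (integral_periodize mF F0); apply: eq_integral => x _.
have c0 : Q (x + intV R (- nearZ (x - v)) - v).
  by rewrite intVN addrAC; apply/cellP.
rewrite (@esum_single _ (- nearZ (x - v))).
- by rewrite /F indicE mem_set// mul1e hp.
- by move=> k; exact: F0.
move=> k kn; rewrite /F indicE memNset ?mul0e// => c.
apply: kn; have : cell R n (x - v - intV R (- k)) by rewrite intVN opprK addrAC.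
by move=> /cellP <-; rewrite opprK.
Qed.

Lemma Rintegral_indicE (A : set Rn) (h : Rn -> R) : measurable A ->
  Rintegral mu setT (fun x => \1_A x * h x) = Rintegral mu A h.
Proof.
move=> mA; rewrite [RHS]Rintegral_mkcond; apply: eq_Rintegral => x _.
by rewrite patchE indicE; case: (x \in A); rewrite ?mul1r ?mul0r.
Qed.

Lemma cell_lty : (mu Q < +oo)%E.
Proof. by rewrite lebesgue_cell ltry. Qed.

Lemma integrable_cell (h : Rn -> R) (C : R) : measurable_fun setT h ->
  (forall x, `|h x| <= C) -> mu.-integrable Q (EFin \o h).
Proof.
move=> mh hC; apply: measurable_bounded_integrable => //.
- exact: measurable_cell.
- exact: cell_lty.
- exact: measurable_funTS.
by exists C; split => [|x Cx y _]; rewrite ?num_real//=; apply: le_trans (hC y) (ltW Cx).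
Qed.

(** By invariance under translation, the integral of c equals that of - c.
    Invariance is available for nonnegative functions, whence the detour through
    1 + c. *)
Lemma antiperiodic_cell (v : Rn) (c : Rn -> R) : measurable_fun setT c ->
  (forall x, `|c x| <= 1) -> (forall (x : Rn) (k : Zn), c (x + intV R k) = c x) ->
  (forall x : Rn, c (x + v) = - c x) -> Rintegral mu Q c = 0.
Proof.
move=> mc c1 cp cv.
have mQ : measurable Q := @measurable_cell R n.
have ic : mu.-integrable Q (EFin \o c) by exact: integrable_cell c1.
have i1 : mu.-integrable Q (EFin \o (fun=> 1)) by apply: (@integrable_cell _ 1) => // x; rewrite normr1.
have m1 : measurable_fun setT (fun x => (1 + c x)%:E).
  by apply/measurable_EFinP; apply: measurable_funD.
have p1 x : (0 <= (1 + c x)%:E)%E.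
  by rewrite lee_fin; have := c1 x; rewrite ler_norml => /andP[+ _]; lra.
have := @integral_cell_shift v (fun x => (1 + c x)%:E) m1 p1.
move=> /(_ (fun x k => congr1 (fun a => (1 + a)%:E) (cp x k))) /(congr1 fine).
rewrite -[fine _]/(Rintegral mu Q _) -[X in _ = X]/(Rintegral mu Q _).
have -> : Rintegral mu Q (fun x => 1 + c (x + v)) = Rintegral mu Q (fun x => 1 - c x).
  by apply: eq_Rintegral => x _; rewrite cv.
rewrite RintegralB// RintegralD//; lra.
Qed.

Definition cellint (g : Rn -> R[i]) : R[i] := cintegral (fun x => (\1_Q x)%:C%C * g x).

Lemma cellint_Re g : complex.Re (cellint g) = Rintegral mu Q (fun x => complex.Re (g x)).
Proof.
rewrite -Rintegral_indicE; last exact: measurable_cell.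
by apply: eq_Rintegral => x _; rewrite cReM /= mul0r subr0.
Qed.

Lemma cellint_Im g : complex.Im (cellint g) = Rintegral mu Q (fun x => complex.Im (g x)).
Proof.
rewrite -Rintegral_indicE; last exact: measurable_cell.
by apply: eq_Rintegral => x _; rewrite cImM /= mul0r addr0.
Qed.

Lemma cmeasurable_indic (A : set Rn) : measurable A -> cmeasurable (fun x => (\1_A x : R)%:C%C).
Proof. by move=> mA; split => /=; [exact: measurable_indic|exact: measurable_cst]. Qed.

Lemma cintegrable_cell g C : cmeasurable g -> (forall x, Q x -> nrm (g x) <= C) ->
  cintegrable (fun x => (\1_Q x)%:C%C * g x).
Proof.
move=> mg gC; apply: (cintegrable_bounded (@measurable_cell R n) cell_lty) => [|x].
  by apply: cmeasurableM => //; apply: cmeasurable_indic; exact: measurable_cell.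
rewrite nrmM nrm_real indicE; case: (boolP (x \in Q)) => [/set_mem xQ|_].
  by rewrite normr1 mul1r mulr1; exact: gC.
by rewrite normr0 mul0r mulr0.
Qed.

Lemma cmeasurable_trig k : cmeasurable (trig k).
Proof. exact: cmeasurable_expi2pi_dotr. Qed.

(** A nontrivial character changes sign under a suitable translation. *)
Lemma cell_orth k : cellint (trig k) = (k == 0)%:R.
Proof.
have [->|k0] := eqVneq k 0.
  apply: complexP; rewrite ?cellint_Re ?cellint_Im.
    rewrite (@eq_Rintegral _ _ _ _ _ (fun=> 1)) => [|x _]; last by rewrite trig0.
    by rewrite Rintegral_cst ?lebesgue_cell ?mulr1//; exact: measurable_cell.
  rewrite (@eq_Rintegral _ _ _ _ _ (fun=> 0)) => [|x _]; last by rewrite trig0.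
  by rewrite Rintegral_cst ?mul0r//; exact: measurable_cell.
have [i ki] : exists i, k ord0 i != 0.
  apply/existsP; apply: contra_neqT k0 => /existsPn h; apply/rowP => i.
  by rewrite mxE; have := h i; rewrite negbK => /eqP.
have kR : (k ord0 i)%:~R != 0 :> R by rewrite intr_eq0.
(* v . k = 1/2, so that trig k v = e^(pi i) = -1. *)
pose v : Rn := (2 * (k ord0 i)%:~R)^-1 *: delta_mx 0 i.
have kv : dotr v (intV R k) = 2^-1.
  rewrite dotrE (bigD1 i)//= big1 ?addr0 => [|j ji].
    by rewrite !mxE !eqxx mulr1 invfM -mulrA mulVf ?mulr1.
  by rewrite !mxE (negbTE ji) andbF mulr0 mul0r.
have tv x : trig k (x + v) = - trig k x.
  by rewrite trigDx {2}/trig kv expi2pi_half mulrN1.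
have [mR mI] := cmeasurable_trig k.
apply: complexP; rewrite ?cellint_Re ?cellint_Im.
  apply: (@antiperiodic_cell v (fun x => complex.Re (trig k x))) => //.
  - by move=> x; rewrite -(nrm_trig k x) le_Re_nrm.
  - by move=> x l; rewrite trig_periodic.
  - by move=> x; rewrite tv cReN.
apply: (@antiperiodic_cell v (fun x => complex.Im (trig k x))) => //.
- by move=> x; rewrite -(nrm_trig k x) le_Im_nrm.
- by move=> x l; rewrite trig_periodic.
- by move=> x; rewrite tv cImN.
Qed.

(** * Fejer kernels *)

Section fejer.
Variable N : nat.
Hypothesis N0 : (0 < N)%N.
Local Notation B := {ffun 'I_n -> 'I_N}.

Definition boxV (j : B) : Zn := \row_i (j i : nat)%:Z.

Lemma boxV_inj : injective boxV.
Proof.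
move=> j l /rowP jl; apply/ffunP => i; apply: val_inj.
by have := jl i; rewrite !mxE => -[].
Qed.

Definition cardB : R := (N ^ n)%:R.

Lemma cardB_gt0 : 0 < cardB.
Proof. by rewrite ltr0n expn_gt0 N0. Qed.

Lemma sum_cardB (c : R) : \sum_(j : B) c = cardB * c.
Proof. by rewrite sumr_const card_ffun !card_ord mulr_natl. Qed.

Definition fejer (t : Rn) : R := cardB^-1 * nrm (\sum_(j : B) trig (boxV j) t) ^+ 2.

Lemma fejer_ge0 t : 0 <= fejer t.
Proof. by rewrite mulr_ge0 ?invr_ge0 ?(ltW cardB_gt0)// sqr_ge0. Qed.

Lemma fejerE t : (fejer t)%:C%C =
  (cardB^-1)%:C%C * \sum_(j : B) \sum_(l : B) trig (boxV j - boxV l) t.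
Proof.
rewrite /fejer rmorphM /= -cJM; congr (_ * _).
rewrite mulrC mulr_suml; apply: eq_bigr => j _.
rewrite rmorph_sum mulr_sumr; apply: eq_bigr => l _.
by rewrite trigD trigN.
Qed.

(** The proportion of the indices j of the box whose translate j + k is again in
    the box; by [fejer_coef] these are the Fourier coefficients of the kernel,
    and by [frac_ge] they tend to 1 as N grows. *)
Definition frac (k : Zn) : R := cardB^-1 * \sum_(j : B) \sum_(l : B) (boxV l == boxV j + k)%:R.

Lemma fejer_coef k : cellint (fun t => trig k t * (fejer t)%:C%C) = (frac k)%:C%C.
Proof.
rewrite /cellint.
pose F (p : B * B) t := (\1_Q t)%:C%C * trig (k + (boxV p.1 - boxV p.2)) t : R[i].
have iF p : cintegrable (F p).
  by apply: (@cintegrable_cell _ 1) => [|x _]; [exact: cmeasurable_trig|rewrite nrm_trig].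
transitivity (cintegral (fun t => (cardB^-1)%:C%C * \sum_p F p t)).
  have E (a b c d : R[i]) : a * (b * (c * d)) = c * (a * (b * d)) by ring.
  apply: eq_cintegral => t; rewrite fejerE E; congr (_ * _).
  rewrite pair_big /= !mulr_sumr; apply: eq_bigr => p _.
  by rewrite /F (trigD k).
rewrite cintegralZ; last exact: cintegrable_sum.
rewrite cintegral_sum// /frac rmorphM /=; congr (_ * _).
rewrite pair_big /= rmorph_sum; apply: eq_bigr => p _ /=.
rewrite -[LHS]/(cellint _) cell_orth rmorph_nat; congr (_ %:R); congr nat_of_bool.
by rewrite addrA subr_eq0 eq_sym addrC.
Qed.

Lemma frac0 : frac 0 = 1.
Proof.
rewrite /frac (eq_bigr (fun=> 1)) => [|j _].
  by rewrite sum_cardB mulr1 mulVf// lt0r_neq0// cardB_gt0.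
rewrite (bigD1 j)//= addr0 eqxx big1 ?addr0// => l lj.
by rewrite (inj_eq boxV_inj) (negbTE lj).
Qed.

(** The indices at distance at least r from the sides of the box stay in it; their
    proportion is (1 - 2 r / N)^n, bounded below by Bernoulli's inequality. *)
Lemma frac_ge (r : nat) (k : Zn) : (forall i, `|k ord0 i| <= r%:Z) -> (2 * r <= N)%N ->
  1 - (2 * n * r)%:R / N%:R <= frac k.
Proof.
move=> kr rN.
have NR : 0 < N%:R :> R by rewrite ltr0n.
pose I := ffun_on (fun a : 'I_N => (r <= a < N - r)%N) : {pred B}.
have cI : #|I| = ((N - 2 * r) ^ n)%N.
  rewrite card_ffun_on card_ord; congr (_ ^ _)%N.
  rewrite -sum1_card (eq_bigl (fun a : 'I_N => (r <= a < N - r)%N))//.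
  rewrite (big_ord_narrow_cond (leq_subr r N)) /=.
  rewrite -(big_mkord (fun i => r <= i)%N (fun=> 1%N)).
  rewrite (eq_bigl (fun i => true && (r <= i)%N))// -big_nat_widenl//.
  by rewrite sum_nat_const_nat muln1; lia.
apply: (@le_trans _ _ (cardB^-1 * ((N - 2 * r) ^ n)%:R)).
  rewrite [leRHS]mulrC /cardB !natrX natrB// -expr_div_n mulrBl divff ?lt0r_neq0//.
  set x : R := (2 * r)%:R / N%:R.
  have x01 : 0 <= x <= 1.
    by rewrite /x divr_ge0// ler_pdivrMr// mul1r ler_nat.
  have -> : (2 * n * r)%:R / N%:R = n%:R * x :> R by rewrite /x mulnAC mulnC natrM mulrA.
  elim: (n) => [|k' IH]; first by rewrite mul0r subr0 expr0.
  rewrite exprS -natr1; have : 0 <= (1 - x) ^+ k' by rewrite exprn_ge0; lra.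
  by have : 0 <= k'%:R :> R := ler0n _ _; nra.
rewrite /frac ler_wpM2l ?invr_ge0 ?(ltW cardB_gt0)// -cI -sum1_card natr_sum.
rewrite big_mkcond /=; apply: ler_sum => j _.
case: ifPn => [/ffun_onP jI|_]; last by apply: sumr_ge0.
have jk i : 0 <= (j i : nat)%:Z + k ord0 i < N%:Z.
  by have := jI i; have := kr i; rewrite ler_norml /in_mem /=; lia.
pose l : B := [ffun i => insubd (j i) (absz ((j i : nat)%:Z + k ord0 i))].
rewrite (bigD1 l)//= (_ : boxV l == boxV j + k) ?lerDl ?sumr_ge0//.
apply/eqP/rowP => i; rewrite !mxE ffunE val_insubd; have := jk i.
by rewrite -[k 0 i]/(k ord0 i); case: ifP; lia.
Qed.

Lemma sum_const_ord (c : R) : \sum_(i < n) c = n%:R * c.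
Proof. by rewrite big_const_ord iter_addr_0 mulr_natl. Qed.

(** A trigonometric polynomial vanishing only at the integer points. It measures
    the distance from t to 0 in the cell, and its integral against the Fejer
    kernel only involves the coefficients of the kernel at the unit vectors. *)
Definition osc (t : Rn) : R := \sum_i (1 - cos (2 * pi * t ord0 i)).

Lemma oscE t : osc t = n%:R - \sum_i cos (2 * pi * t ord0 i).
Proof. by rewrite /osc sumrB sum_const_ord mulr1. Qed.

Definition unitV (i : 'I_n) : Zn := delta_mx 0 i.

Lemma Re_trig_unitV i t : complex.Re (trig (unitV i) t) = cos (2 * pi * t ord0 i).
Proof.
rewrite /trig /= dotrE (bigD1 i)//= big1 ?addr0 => [|j ji].
  by rewrite !mxE !eqxx mulr1.
by rewrite !mxE (negbTE ji) andbF mulr0.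
Qed.

Lemma cmeasurable_fejer : cmeasurable (fun t => (fejer t)%:C%C).
Proof.
split => /=; last exact: measurable_cst.
apply: measurable_funM => //; apply: measurable_funX; apply: measurable_nrm.
by apply: cmeasurable_sum => j; exact: cmeasurable_trig.
Qed.

Lemma fejer_le t : fejer t <= cardB.
Proof.
rewrite /fejer mulrC ler_pdivrMr ?cardB_gt0// -expr2 ler_sqr ?nnegrE ?nrm_ge0 ?(ltW cardB_gt0)//.
apply: (le_trans (nrm_sum _ _ _)); rewrite -[leRHS]mulr1 -sum_cardB.
by apply: ler_sum => j _; rewrite nrm_trig.
Qed.

Lemma cintegrable_trig_fejer k : cintegrable (fun t => (\1_Q t)%:C%C * (trig k t * (fejer t)%:C%C)).
Proof.
apply: (@cintegrable_cell _ cardB).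
  by apply: cmeasurableM; [exact: cmeasurable_trig|exact: cmeasurable_fejer].
by move=> x _; rewrite nrmM nrm_trig mul1r nrm_real ger0_norm ?fejer_ge0// fejer_le.
Qed.

Lemma fejer_osc (e C : R) :
  mu.-integrable setT (EFin \o (fun t => \1_Q t * ((e + C * osc t) * fejer t))) /\
  Rintegral mu setT (fun t => \1_Q t * ((e + C * osc t) * fejer t)) =
    e + C * \sum_i (1 - frac (unitV i)).
Proof.
pose T k t := (\1_Q t)%:C%C * (trig k t * (fejer t)%:C%C).
pose G t := (e + C * n%:R)%:C%C * T 0 t + (- C)%:C%C * \sum_(i <- enum 'I_n) T (unitV i) t.
have iS : cintegrable (fun t => \sum_(i <- enum 'I_n) T (unitV i) t).
  by apply: cintegrable_sum => i; exact: cintegrable_trig_fejer.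
have iG : cintegrable G.
  apply: cintegrableD; apply: cintegrableZ => //; exact: cintegrable_trig_fejer.
have GE t : complex.Re (G t) = \1_Q t * ((e + C * osc t) * fejer t).
  rewrite /G cReD !cReM /= !mul0r !subr0 cRe_sum big_enum /= oscE.
  rewrite (eq_bigr (fun i => cos (2 * pi * t ord0 i) * (\1_Q t * fejer t))) => [|i _]; last first.
    by rewrite -[LHS]/(complex.Re (T (unitV i) t)) /T cReM [complex.Re (trig _ _ * _)]cReM Re_trig_unitV /=; ring.
  by rewrite -mulr_suml intV0 dotr0r mulr0 cos0 sin0; ring.
have [iR _] := iG; split.
  by move: iR; congr (integrable _ _); apply/funext => t /=; rewrite GE.
transitivity (complex.Re (cintegral G)); first by apply: eq_Rintegral => t _; rewrite GE.
rewrite cintegralD ?cintegralZ//; [|exact: cintegrable_trig_fejer|by apply: cintegrableZ; exact: cintegrable_trig_fejer|exact: cintegrableZ].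
rewrite cintegral_sum; last by move=> i; exact: cintegrable_trig_fejer.
rewrite (eq_bigr (fun i => (frac (unitV i))%:C%C)) => [|i _]; last exact: fejer_coef.
rewrite [X in _ * X + _](fejer_coef 0) cReD !cReM /= !mul0r !subr0 cRe_sum big_enum /= sumrB sum_const_ord mulr1.
by rewrite frac0; ring.
Qed.

(** The Fejer kernel concentrates at 0 as N grows. *)
Lemma fejer_osc_le (e C : R) : (2 <= N)%N -> 0 <= C ->
  Rintegral mu setT (fun t => \1_Q t * ((e + C * osc t) * fejer t)) <= e + C * ((2 * n * n)%:R / N%:R).
Proof.
move=> N2 C0; rewrite (fejer_osc e C).2 lerD2l ler_wpM2l//.
have H i : 1 - frac (unitV i) <= (2 * n * 1)%:R / N%:R.
  rewrite lerBlDr -lerBlDl; apply: frac_ge => // j.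
  by rewrite mxE; case: (_ && _); rewrite ?normr1 ?normr0.
apply: (le_trans (ler_sum _ (fun i _ => H i))).
by rewrite sum_const_ord muln1 mulrA -natrM mulnC.
Qed.

End fejer.

(** Close to t = 0 uniform continuity gives the bound e; elsewhere in the cell
    osc t is bounded below and C osc t is at least twice a bound of |w|. *)
Lemma ctsupp_modulus (w : Rn -> R[i]) (e : R) : ctsupp w -> 0 < e ->
  exists2 C, 0 <= C & forall z t : Rn, Q t -> nrm (w (z + t) - w z) <= e + C * osc t.
Proof.
move=> wc e0; have [d d0 wd] := ctsupp_unif wc e0; have [M M0 wM] := ctsupp_bounded wc.
pose d' := Num.min d 2^-1.
have d'0 : 0 < d' by rewrite lt_min d0 invr_gt0 ltr0n.
have d'2 : d' <= 2^-1 by rewrite ge_min lexx orbT.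
pose c := 1 - cos (2 * pi * d').
have pi0 : 0 < pi :> R := pi_gt0 R.
have c0 : 0 < c.
  rewrite /c subr_gt0 -[ltRHS]cos0 ltr_cos ?in_itv/= ?lexx ?pi_ge0//.
    by rewrite mulr_gt0// mulr_gt0.
  apply/andP; split; first by rewrite !mulr_ge0// ltW.
  by nra.
have osc1 (t : Rn) i : 0 <= 1 - cos (2 * pi * t ord0 i) by rewrite subr_ge0 cos_le1.
exists (2 * M / c) => [|z t tQ]; first by rewrite divr_ge0 ?mulr_ge0// ltW.
have [h|/existsNP[i /negP ti]] := pselect (forall i, `|t ord0 i| < d').
  apply: (le_trans (wd z t _)) => [i|]; first by rewrite (lt_le_trans (h i))// ge_min lexx.
  by rewrite lerDl mulr_ge0 ?divr_ge0 ?mulr_ge0 ?(ltW c0)// sumr_ge0.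
rewrite -leNgt in ti.
have t2 : `|t ord0 i| <= 2^-1.
  by have := tQ i; rewrite set_itvE /= ler_norml => /andP[-> /ltW ->].
have ct : c <= 1 - cos (2 * pi * t ord0 i).
  rewrite /c lerD2l lerN2.
  have -> : cos (2 * pi * t ord0 i) = cos (2 * pi * `|t ord0 i|).
    by case: (ler0P (t ord0 i)) => // _; rewrite mulrN cosN.
  have ler_cos (x y : R) : 0 <= x -> x <= y -> y <= pi -> cos y <= cos x.
    move=> x0; rewrite le_eqVlt => /predU1P[->//|xy] yp.
    by rewrite ltW// ltr_cos// in_itv/=; apply/andP; split; lra.
  apply: ler_cos; [by rewrite !mulr_ge0// ltW|by rewrite ler_pM2l// mulr_gt0|nra].
have osct : c <= osc t.
  by rewrite /osc (bigD1 i)//= (le_trans ct)// lerDl sumr_ge0.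
apply: (le_trans (le_nrmD _ _)); rewrite nrmN.
apply: (@le_trans _ _ (2 * M)); first by rewrite mulr_natl mulr2n lerD.
apply: (@le_trans _ _ (2 * M / c * osc t)); last by rewrite lerDr ltW.
rewrite -mulrA -[leLHS]mulr1 ler_wpM2l ?mulr_ge0//.
by rewrite mulrC ler_pdivlMr// mul1r.
Qed.

(** The integer points with coordinates in [-M, M]. *)
Definition zbox (M : nat) : seq Zn :=
  [seq (\row_i ((s i : nat)%:Z - M%:Z) : Zn) | s : {ffun 'I_n -> 'I_(M.*2.+1)}].

Lemma zbox_uniq M : uniq (zbox M).
Proof.
rewrite map_inj_uniq ?enum_uniq// => s s' /rowP h; apply/ffunP => i; apply: val_inj.
by have := h i; rewrite !mxE => /addIr[].
Qed.

Lemma mem_zbox M (g : Zn) : (forall i, `|g ord0 i| <= M%:Z) -> g \in zbox M.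
Proof.
move=> gM; apply/mapP; exists [ffun i => inord (absz (g ord0 i + M%:Z))].
  by rewrite mem_enum.
apply/rowP => i; rewrite !mxE ffunE inordK; have := gM i; rewrite ler_norml.
  by rewrite -[g 0 i]/(g ord0 i); lia.
by lia.
Qed.

Lemma ctsupp_translate (w : Rn -> R[i]) (v : Rn) : ctsupp w -> ctsupp (fun x => w (x + v)).
Proof.
move=> wc; apply: (@ctsupp_comp _ _ w (fun x => x + v)) => //.
  by apply: rV_continuousP => i; under eq_fun do rewrite mxE; apply: rV_continuousD;
    [exact: coord_continuous|exact: cst_continuous].
have [k _ vk] : (\bigcup_k @cube R n k) v by rewrite bigcup_cube.
move=> r; exists (r + k)%N => x xr i.
have := xr i; have := vk i; rewrite !set_itvE /= mxE natrD; lra.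
Qed.

Definition fcoef (w : Rn -> R[i]) (k : Zn) : R[i] := cintegral (fun x => w x * trig k x).
Definition acorr (w : Rn -> R[i]) (g : Zn) : R[i] :=
  cintegral (fun x => (w (x - intV R g))^* * w x).

Lemma ctsupp_trig w k : ctsupp w -> ctsupp (fun x => w x * trig k x).
Proof. by move=> wc; have [cR cI] := continuous_expi2pi_dotr (intV R k); exact: ctsuppM. Qed.

(** * Parseval's equality for sums of translates *)

Section smoothing.
Variables (w : Rn -> R[i]) (r : nat).
Hypotheses (wc : ctsupp w) (wr : forall x, w x != 0 -> cube r x).

(** The supports of w and of its translate by g are disjoint. *)
Lemma acorr_eq0 m g : (2 * r <= m)%N -> g \notin zbox m -> acorr w g = 0.
Proof.
move=> rm gr; rewrite /acorr -[RHS](cintegral0 R n); apply: eq_cintegral => x.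
have [->|/wr wx] := eqVneq (w x) 0; first by rewrite mulr0.
have [->|/wr wxg] := eqVneq (w (x - intV R g)) 0; first by rewrite conjC0 mul0r.
case/negP: gr; apply: mem_zbox => i.
rewrite -(ler_int R) intr_norm ler_norml.
have := wx i; have := wxg i; rewrite !set_itvE /= !mxE => h1 h2.
have : (2 * r)%:R <= m%:R :> R by rewrite ler_nat.
by rewrite -[m%:Z%:~R]/(m%:R) natrM; lra.
Qed.

Variables (N : nat) (N0 : (0 < N)%N).
Local Notation K := (fejer N).
Local Notation B := {ffun 'I_n -> 'I_N}.

(** Integration over all of R^n makes this the convolution of the periodization
    of w with the Fejer kernel: a Fejer mean of the Fourier series of the
    periodization, as [smoothE] shows. *)
Definition smooth (x : Rn) : R[i] := cintegral (fun t => w (x + t) * (K t)%:C%C).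

Lemma smoothE x : smooth x =
  (cardB N)^-1%:C%C * \sum_(p : B * B) (trig (boxV p.1 - boxV p.2) x)^* * fcoef w (boxV p.1 - boxV p.2).
Proof.
have mwK : cmeasurable (fun y => w y * (K (y - x))%:C%C).
  apply: cmeasurableM; first exact: ctsupp_cmeasurable.
  exact: (cmeasurable_comp (measurable_addrV (- x)) (cmeasurable_fejer N)).
rewrite -[LHS](_ : cintegral (fun y => w y * (K (y - x))%:C%C) = _); last first.
  rewrite -(cintegral_translate x mwK); apply: eq_cintegral => t.
  by rewrite addrK addrC.
pose F (p : B * B) y := (trig (boxV p.1 - boxV p.2) x)^* * (w y * trig (boxV p.1 - boxV p.2) y).
have iF p : cintegrable (F p) by apply/cintegrableZ/ctsupp_integrable/ctsupp_trig.
transitivity (cintegral (fun y => (cardB N)^-1%:C%C * \sum_p F p y)).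
  apply: eq_cintegral => y; rewrite fejerE mulrCA; congr (_ * _).
  rewrite pair_big /= mulr_sumr; apply: eq_bigr => p _.
  by rewrite /F trigDx trigNx; ring.
rewrite cintegralZ; last exact: cintegrable_sum.
rewrite cintegral_sum//; congr (_ * _); apply: eq_bigr => p _.
by rewrite cintegralZ//; apply/ctsupp_integrable/ctsupp_trig.
Qed.

(** The sum of the |fcoef w k|^2 weighted by [frac N k]; the double sum over pairs
    of the box avoids a summation over the differences k. *)
Definition fejer_sum : R :=
  (cardB N)^-1 * \sum_(p : B * B) nrm (fcoef w (boxV p.1 - boxV p.2)) ^+ 2.

Lemma cintegrable_smooth : cintegrable (fun x => (w x)^* * smooth x).
Proof.
rewrite (_ : (fun x => _) = fun x => (cardB N)^-1%:C%C * \sum_(p : B * B)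
  (fcoef w (boxV p.1 - boxV p.2) * (w x * trig (boxV p.1 - boxV p.2) x)^*)).
  apply/cintegrableZ/cintegrable_sum => p.
  by apply/cintegrableZ/ctsupp_integrable/ctsuppJ/ctsupp_trig.
apply/funext => x; rewrite smoothE mulrCA; congr (_ * _).
by rewrite mulr_sumr; apply: eq_bigr => p _; rewrite rmorphM /=; ring.
Qed.

Lemma integral_smooth : (fejer_sum)%:C%C = cintegral (fun x => (w x)^* * smooth x).
Proof.
pose F (p : B * B) x := fcoef w (boxV p.1 - boxV p.2) * (w x * trig (boxV p.1 - boxV p.2) x)^*.
have iF p : cintegrable (F p) by apply/cintegrableZ/ctsupp_integrable/ctsuppJ/ctsupp_trig.
transitivity (cintegral (fun y => (cardB N)^-1%:C%C * \sum_p F p y)); last first.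
  apply: eq_cintegral => x; rewrite smoothE mulrCA; congr (_ * _).
  by rewrite mulr_sumr; apply: eq_bigr => p _; rewrite /F rmorphM /=; ring.
rewrite cintegralZ; last exact: cintegrable_sum.
rewrite cintegral_sum// /fejer_sum rmorphM /= rmorph_sum; congr (_ * _).
apply: eq_bigr => p _ /=.
rewrite cintegralZ; last by apply/ctsupp_integrable/ctsuppJ/ctsupp_trig.
rewrite cintegralJ; last by apply/ctsupp_integrable/ctsupp_trig.
by rewrite mulrC -cJM.
Qed.

(** Splitting the integral into cells exhibits [smooth] as an approximation of the
    sum of the translates of w, finite on the support of w. *)
Lemma smooth_cells x : cube r x ->
  smooth x = \sum_(g <- zbox (2 * r + 1)) cellint (fun t => w (x + intV R g + t) * (K t)%:C%C).
Proof.
move=> xr.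
pose F g t := (\1_Q (t - intV R g))%:C%C * (w (x + t) * (K t)%:C%C) : R[i].
have wxc : ctsupp (fun t => w (x + t)).
  by under eq_fun do rewrite addrC; exact: ctsupp_translate.
have [s [M wM]] := ctsupp_indic wxc.
have mF g : cmeasurable (F g).
  apply: cmeasurableM.
    apply: (cmeasurable_comp (f := fun t => (\1_Q t)%:C%C) (measurable_addrV (- intV R g))).
    by apply: cmeasurable_indic; exact: measurable_cell.
  by apply: cmeasurableM; [exact: ctsupp_cmeasurable|exact: cmeasurable_fejer].
have iF g : cintegrable (F g).
  apply: (cintegrable_bounded (@measurable_cube R n s) (lebesgue_cube_lty _ _ _) (C := M * cardB N)) => // t.
  rewrite !nrmM !nrm_real.
  apply: (@le_trans _ _ (nrm (w (x + t)) * `|K t|)).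
    rewrite ler_piMl ?mulr_ge0 ?nrm_ge0// indicE.
    by case: (_ \in _); rewrite ?normr1 ?normr0.
  rewrite mulrAC ler_pM ?nrm_ge0 ?normr_ge0//.
  by rewrite ger0_norm ?fejer_ge0// fejer_le.
transitivity (cintegral (fun t => \sum_(g <- zbox (2 * r + 1)) F g t)).
  apply: eq_cintegral => t.
  have [wxt|wxt] := eqVneq (w (x + t)) 0.
    by rewrite wxt mul0r big1_seq// => g _; rewrite /F wxt mul0r mulr0.
  have gt : nearZ t \in zbox (2 * r + 1).
    apply: mem_zbox => i.
    have := wr wxt i; have := xr i; have := (cellP t (nearZ t)).2 erefl i.
    rewrite -(ler_int R) intr_norm ler_norml !set_itvE /= !mxE.
    by rewrite -[(2 * r + 1)%:Z%:~R]/((2 * r + 1)%:R) natrD natrM; lra.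
  rewrite (bigD1_seq (nearZ t))//= ?zbox_uniq// big1 ?addr0 => [|g gn].
    by rewrite /F indicE mem_set ?mul1r//; exact/cellP.
  rewrite /F indicE memNset ?mul0r// => /cellP gE.
  by rewrite gE eqxx in gn.
rewrite cintegral_sum//; apply: eq_bigr => g _.
rewrite -(cintegral_translate (intV R g) (mF g)); apply: eq_cintegral => t.
rewrite /F addrK; congr (_ * (w _ * _)); first by rewrite -addrA (addrC (intV R g)).
by congr (_%:C%C); rewrite /fejer; congr (_ * nrm _ ^+ 2); apply: eq_bigr => j _; rewrite trig_periodic.
Qed.

Lemma cellint_fejer_cst c : cellint (fun t => c * (K t)%:C%C) = c.
Proof.
transitivity (c * cellint (fun t => trig 0 t * (K t)%:C%C)); last first.
  by rewrite fejer_coef (frac0 N0) mulr1.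
rewrite -cintegralZ; last exact: cintegrable_trig_fejer.
by apply: eq_cintegral => t; rewrite trig0; ring.
Qed.

(** The kernel has mean 1 on the cell, so the error is the mean of the increments
    of w, controlled by [ctsupp_modulus] and [fejer_osc_le]. *)
Lemma smooth_approx e C x : (2 <= N)%N -> 0 <= C ->
  (forall z t : Rn, Q t -> nrm (w (z + t) - w z) <= e + C * osc t) ->
  cube r x ->
  nrm (smooth x - \sum_(g <- zbox (2 * r + 1)) w (x + intV R g)) <=
    (size (zbox (2 * r + 1)))%:R * (2 * (e + C * ((2 * n * n)%:R / N%:R))).
Proof.
move=> N2 C0 wC xr; rewrite smooth_cells// -sumrB.
apply: (le_trans (nrm_sum _ _ _)).
rewrite -sum1_size natr_sum mulr_suml; apply: ler_sum => g _; rewrite mul1r.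
have [M M0 wM] := ctsupp_bounded wc.
have mK : cmeasurable (fun t => (K t)%:C%C) by exact: cmeasurable_fejer.
have KB t : nrm (K t)%:C%C <= cardB N by rewrite nrm_real ger0_norm ?fejer_ge0// fejer_le.
have mw : cmeasurable (fun t => w (x + intV R g + t)).
  under eq_fun do rewrite addrC.
  by apply: (cmeasurable_comp (measurable_addrV _)); exact: ctsupp_cmeasurable.
have i1 : cintegrable (fun t => (\1_Q t)%:C%C * (w (x + intV R g + t) * (K t)%:C%C)).
  apply: (@cintegrable_cell _ (M * cardB N)); first exact: cmeasurableM.
  by move=> t _; rewrite nrmM ler_pM ?nrm_ge0.
have i2 : cintegrable (fun t => (\1_Q t)%:C%C * (w (x + intV R g) * (K t)%:C%C)).
  apply: (@cintegrable_cell _ (M * cardB N)); first by apply: cmeasurableM => //; exact: cmeasurable_cst.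
  by move=> t _; rewrite nrmM ler_pM ?nrm_ge0.
rewrite -(cellint_fejer_cst (w (x + intV R g))) -mulN1r /cellint -cintegralZ//.
rewrite -cintegralD//; last exact: cintegrableZ.
have [io _] := fejer_osc N0 e C.
apply: (le_trans (le_nrm_cintegral _ io _)).
- by apply: cintegrableD => //; exact: cintegrableZ.
- move=> t; rewrite mulN1r -mulrBr -mulrBl !nrmM !nrm_real (ger0_norm (fejer_ge0 _ _))//.
  rewrite indicE; case: (boolP (t \in Q)) => [/set_mem tQ|_]; last by rewrite normr0 !mul0r.
  by rewrite normr1 !mul1r ler_wpM2r ?fejer_ge0// wC.
- by rewrite ler_wpM2l// fejer_osc_le.
Qed.

Lemma integral_translates :
  cintegral (fun x => (w x)^* * \sum_(g <- zbox (2 * r + 1)) w (x + intV R g)) =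
  \sum_(g <- zbox (2 * r + 1)) acorr w g.
Proof.
have iw g : cintegrable (fun x => (w x)^* * w (x + intV R g)).
  apply/ctsupp_integrable/ctsuppMl; first exact: ctsuppJ.
  exact: ctsupp_translate.
rewrite (@eq_cintegral _ _ _ (fun x => \sum_(g <- zbox (2 * r + 1)) (w x)^* * w (x + intV R g))); last first.
  by move=> x; rewrite mulr_sumr.
rewrite cintegral_sum//; apply: eq_bigr => g _.
have mw : cmeasurable (fun x => (w x)^* * w (x + intV R g)).
  apply/ctsupp_cmeasurable/ctsuppMl; first exact: ctsuppJ.
  exact: ctsupp_translate.
rewrite -(cintegral_translate (- intV R g) mw); apply: eq_cintegral => x.
by rewrite addrNK.
Qed.

Lemma fejer_sum_approx e C M : (2 <= N)%N -> 0 <= e -> 0 <= C ->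
  (forall x, nrm (w x) <= M) ->
  (forall z t : Rn, Q t -> nrm (w (z + t) - w z) <= e + C * osc t) ->
  nrm ((fejer_sum)%:C%C - \sum_(g <- zbox (2 * r + 1)) acorr w g) <=
    2 * (M * (fine (mu (@cube R n r)) *
     ((size (zbox (2 * r + 1)))%:R * (2 * (e + C * ((2 * n * n)%:R / N%:R)))))).
Proof.
move=> N2 e0 C0 wM wC.
set S := (X in 2 * (M * (_ * X))).
have S0 : 0 <= S.
  by rewrite /S !mulr_ge0 ?addr_ge0 ?mulr_ge0 ?divr_ge0.
have iw : cintegrable (fun x => (w x)^* * \sum_(g <- zbox (2 * r + 1)) w (x + intV R g)).
  under eq_fun do rewrite mulr_sumr.
  apply: cintegrable_sum => g; apply/ctsupp_integrable/ctsuppMl; first exact: ctsuppJ.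
  exact: ctsupp_translate.
rewrite integral_smooth -integral_translates -mulN1r -cintegralZ// -cintegralD; first last.
- exact: cintegrableZ.
- exact: cintegrable_smooth.
have ih := integrable_indic_bounded (M * S) (@measurable_cube R n r) (lebesgue_cube_lty _ _ _).
apply: (le_trans (le_nrm_cintegral _ ih _)).
- by apply: cintegrableD; [exact: cintegrable_smooth|exact: cintegrableZ].
- move=> x; rewrite mulN1r -mulrBr nrmM nrmJ.
  have [->|/wr xr] := eqVneq (w x) 0.
    rewrite nrm0 mul0r; apply: mulr_ge0 => //; apply: mulr_ge0 => //.
    exact: le_trans (nrm_ge0 (w 0)) (wM 0).
  by rewrite indicE mem_set// mulr1 ler_pM ?nrm_ge0//; exact: smooth_approx.
have i1 : mu.-integrable setT (EFin \o (fun x => 1 * \1_(@cube R n r) x)).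
  exact: (integrable_indic_bounded 1 (@measurable_cube R n r) (lebesgue_cube_lty _ _ _)).
rewrite ler_wpM2l// (@eq_Rintegral _ _ _ _ _ (fun x => (M * S) * (1 * \1_(@cube R n r) x))) => [|x _]; last by rewrite mul1r.
rewrite RintegralZl// (@eq_Rintegral _ _ _ _ _ (fun x => \1_(@cube R n r) x)) => [|x _]; last by rewrite mul1r.
rewrite /Rintegral integral_indic ?setIT//; last exact: measurable_cube.
by rewrite -mulrA (mulrC S).
Qed.

(** For fixed l, the differences j - l are distinct. *)
Lemma fejer_sum_le : ((fejer_sum)%:E <= \esum_(k in [set: Zn]) (nrm (fcoef w k) ^+ 2)%:E)%E.
Proof.
set E := (\esum_(_ in _) _)%E.
have E0 : (0 <= E)%E by apply: esum_ge0 => k _; rewrite lee_fin sqr_ge0.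
have H (l : B) : (\sum_(j : B) (nrm (fcoef w (boxV j - boxV l)) ^+ 2)%:E <= E)%E.
  rewrite -big_enum /= -(big_map (fun j => boxV j - boxV l) xpredT (fun k => (nrm (fcoef w k) ^+ 2)%:E)).
  apply: esum_ge_seq => [k|]; first by rewrite lee_fin sqr_ge0.
  by rewrite map_inj_uniq ?enum_uniq// => j j' /addIr /boxV_inj.
case: E E0 H => [E|_ _|//]; last by rewrite leey.
rewrite lee_fin => E0 H; rewrite lee_fin /fejer_sum mulrC ler_pdivrMr ?cardB_gt0//.
rewrite -(pair_big xpredT xpredT (fun j l => nrm (fcoef w (boxV j - boxV l)) ^+ 2)) exchange_big /=.
rewrite mulrC -sum_cardB; apply: ler_sum => l _.
by have := H l; rewrite sumEFin lee_fin.
Qed.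

(** Each k of F occurs among the differences with weight [frac N k], close to 1. *)
Lemma fejer_sum_ge (F : seq Zn) (M : nat) : uniq F ->
  (forall k i, k \in F -> `|k ord0 i| <= M%:Z) -> (2 * M <= N)%N ->
  (1 - (2 * n * M)%:R / N%:R) * \sum_(k <- F) nrm (fcoef w k) ^+ 2 <= fejer_sum.
Proof.
move=> uF FM MN; rewrite mulr_sumr.
apply: (@le_trans _ _ (\sum_(k <- F) frac N (- k) * nrm (fcoef w k) ^+ 2)).
  rewrite !big_seq; apply: ler_sum => k kF; rewrite ler_wpM2r ?sqr_ge0//.
  by apply: frac_ge => // i; rewrite mxE normrN; exact: FM.
rewrite /fejer_sum /frac mulr_sumr.
under eq_bigr do rewrite pair_big /= -mulrA mulr_suml mulr_sumr.
rewrite exchange_big /=; apply: ler_sum => p _.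
rewrite -mulr_sumr ler_wpM2l ?invr_ge0 ?(ltW (cardB_gt0 N0))//.
set k0 := boxV p.1 - boxV p.2.
have E k : (boxV p.2 == boxV p.1 - k) = (k == k0).
  by rewrite /k0 eq_sym subr_eq addrC -subr_eq eq_sym.
under eq_bigr do rewrite E.
have [kF|kF] := boolP (k0 \in F).
  rewrite (bigD1_seq k0)//= eqxx mul1r big1 ?addr0// => k /negbTE ->.
  by rewrite mul0r.
rewrite big1_seq ?sqr_ge0// => k /andP[_ kF']; case: eqP => [kk|]; last by rewrite mul0r.
by rewrite kk (negbTE kF) in kF'.
Qed.

End smoothing.

(** As N grows, the Fejer sums converge to the sum of the
    autocorrelations by [fejer_sum_approx], and to the sum of the |fcoef w k|^2 by
    monotone comparison, [fejer_sum_le] and [fejer_sum_ge]. The equality holds for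
    this very w, not merely almost everywhere in a parameter. *)
Lemma parseval (w : Rn -> R[i]) (r : nat) : ctsupp w -> (forall x, w x != 0 -> cube r x) ->
  (\sum_(g <- zbox (2 * r + 1)) acorr w g = (fine (\esum_(k in [set: Zn]) (nrm (fcoef w k) ^+ 2)%:E))%:C%C) /\
  (\esum_(k in [set: Zn]) (nrm (fcoef w k) ^+ 2)%:E < +oo)%E.
Proof.
move=> wc wr; set E := (\esum_(_ in _) _)%E; set W := \sum_(_ <- _) _.
have E0 : (0 <= E)%E by apply: esum_ge0 => k _; rewrite lee_fin sqr_ge0.
have app eta : 0 < eta -> exists N0 : nat, forall N, (N0 < N)%N ->
    nrm ((fejer_sum w N)%:C%C - W) <= eta.
  move=> eta0.
  have [M M0 wM] := ctsupp_bounded wc.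
  pose L := 2 * (M * (fine (mu (@cube R n r)) * ((size (zbox (2 * r + 1)))%:R * 2))) + 1 : R.
  have L0 : 0 < L.
    rewrite /L ltr_wpDl// !mulr_ge0// fine_ge0//.
  (* L bounds the constant of fejer_sum_approx, so an error e + C (2 n^2) / N at
     most eta / L is enough: half of it comes from e, half from N > c. *)
  have e0 : 0 < eta / (2 * L) by rewrite divr_gt0// mulr_gt0.
  have [C C0 wC] := ctsupp_modulus wc e0.
  pose c := C * (2 * n * n)%:R * 2 * L / eta.
  have c0 : 0 <= c by rewrite /c !mulr_ge0// ?invr_ge0 ltW.
  exists (Num.truncn c).+1 => N cN.
  have N0 : (0 < N)%N by lia.
  have N2 : (2 <= N)%N by lia.
  have cN' : c < N%:R by rewrite (lt_trans (truncnS_gt _))// ltr_nat.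
  apply: (le_trans (fejer_sum_approx wc wr N0 N2 (ltW e0) C0 wM wC)).
  have NR : 0 < N%:R :> R by rewrite ltr0n.
  set x := eta / (2 * L) + _.
  have xL : x * L <= eta.
    rewrite /x mulrDl invfM mulrA divfK ?gt_eqF//.
    rewrite [leRHS](splitr eta) lerD2l.
    have : c * eta <= N%:R * eta by rewrite ler_wpM2r ?ltW.
    rewrite /c divfK ?gt_eqF// => h.
    rewrite mulrA mulrAC ler_pdivrMr//.
    by move: h; generalize ((2 * n * n)%:R : R) (N%:R : R) => a b; lra.
  apply: le_trans xL; have x0 : 0 <= x by rewrite addr_ge0 ?(ltW e0)// mulr_ge0// divr_ge0.
  rewrite /L; set v := fine _; set z := _%:R; nra.
have ReW N : complex.Re ((fejer_sum w N)%:C%C - W) = fejer_sum w N - complex.Re W.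
  by rewrite cReD cReN.
have ImW : complex.Im W = 0.
  apply/eqP; rewrite -normr_eq0 eq_le normr_ge0 andbT; apply/ler_addgt0Pr => e e0.
  have [N0 h] := app e e0; have := h N0.+1 (ltnSn _); rewrite add0r; apply: le_trans.
  apply: le_trans (le_Im_nrm _); by rewrite cImD cImN /= add0r normrN.
have WE : (complex.Re W)%:E = E.
  apply/eqP; rewrite eq_le; apply/andP; split.
    apply/lee_addgt0Pr => e e0; have [N0 h] := app e e0.
    have := h N0.+1 (ltnSn _) => /(le_trans (le_Re_nrm _)); rewrite ReW ler_norml => /andP[h1 _].
    apply: (@le_trans _ _ (fejer_sum w N0.+1 + e)%:E); first by rewrite lee_fin; lra.
    by rewrite EFinD leeD2r//; exact: fejer_sum_le.
  apply: esum_le_seq => F uF.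
  rewrite sumEFin lee_fin; set s := \sum_(_ <- _) _.
  have s0 : 0 <= s by apply: sumr_ge0 => k _; exact: sqr_ge0.
  pose M := \max_(k <- F) \max_i (absz (k ord0 i)).
  have FM k i : k \in F -> `|k ord0 i| <= M%:Z.
    move=> kF; rewrite -abszE lez_nat.
    apply: (@leq_trans (\max_i absz (k ord0 i))); first exact: (leq_bigmax (F := fun i => absz (k ord0 i))).
    exact: (leq_bigmax_seq (F := fun k : Zn => \max_i absz (k ord0 i))).
  apply/ler_addgt0Pr => e e0.
  have e2 : 0 < e / 2 by rewrite divr_gt0.
  have [N0 h] := app (e / 2) e2.
  pose c := (2 * n * M)%:R * s * 2 / e.
  pose N := (N0 + 2 * M + (Num.truncn c).+1).+1%N.
  have cN : c < N%:R.
    by rewrite (lt_le_trans (truncnS_gt _))// ler_nat /N ltnS (leq_trans (leqnSn _))// leq_addl.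
  have Ngt0 : (0 < N)%N by [].
  have MN : (2 * M <= N)%N by rewrite /N; lia.
  have := fejer_sum_ge w Ngt0 uF FM MN; rewrite -/s mulrBl mul1r => h1.
  have N0N : (N0 < N)%N by rewrite /N; lia.
  have := h N N0N => /(le_trans (le_Re_nrm _)); rewrite ReW ler_norml => /andP[_ h2].
  have NR : 0 < N%:R :> R by rewrite ltr0n.
  have h3 : (2 * n * M)%:R / N%:R * s <= e / 2.
    have : c * e <= N%:R * e by rewrite ler_wpM2r ?ltW.
    rewrite /c divfK ?gt_eqF// => h3.
    rewrite mulrAC ler_pdivrMr// mulrAC ler_pdivlMr//.
    by rewrite [leRHS]mulrC.
  by move: h1 h2 h3; lra.
by rewrite -WE /=; split; [exact: complexP|rewrite ltry].
Qed.

End trig.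

(** * Cosets of the lattice, fibres of the torus maps *)

Section lattice.

(** By the Smith normal form, D is a diagonal matrix up to unimodular factors, and
    for a diagonal matrix the remainders of the coordinates are representatives;
    the product of the diagonal entries is the determinant up to sign. *)
Lemma lattice_reps d (D : 'M[int]_d) : \det D != 0 ->
  exists reps : seq 'rV[int]_d, [/\ uniq reps, size reps = absz (\det D),
    forall z, exists2 r, r \in reps & exists k, z = r + k *m D &
    forall r r' k, r \in reps -> r' \in reps -> r = r' + k *m D -> r = r'].
Proof.
case: (int_Smith_normal_form D) => L Lu [U Uu [dd _ DE]] dD.
set Dl := \matrix_(i, j) _ in DE.
pose c (i : 'I_d) : int := dd`_i.
have DlE (x : 'rV[int]_d) i : (x *m Dl) ord0 i = x ord0 i * c i.
  rewrite mxE (bigD1 i)//= big1 ?addr0 => [|j ji]; first by rewrite mxE eqxx mulr1n.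
  by rewrite mxE (inj_eq val_inj) (negbTE ji) mulr0n mulr0.
have unit1 (x : int) : x \is a GRing.unit -> absz x = 1%N.
  by case/orP => /eqP ->.
have detDl : \det Dl = \prod_i c i.
  rewrite (_ : Dl = diag_mx (\row_i c i)); first by rewrite det_diag; apply: eq_bigr => i _; rewrite mxE.
  by apply/matrixP => i j; rewrite !mxE; case: (eqVneq i j) => [->|ij]; rewrite ?eqxx//= (inj_eq val_inj) (negbTE ij).
have detD : absz (\det D) = (\prod_i absz (c i))%N.
  rewrite DE !det_mulmx !abszM (unit1 (\det L))// (unit1 (\det U))// mul1n muln1 detDl.
  by rewrite (big_morph absz abszM (erefl _)).
have c0 i : c i != 0.
  apply: contra_neq dD => ci; apply/eqP; rewrite -absz_eq0 detD (bigD1 i)//= ci.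
  by rewrite absz0 mul0n.
pose m := \max_i absz (c i).
pose fam := family (fun i => [pred a : 'I_m | (a < absz (c i))%N]).
pose sV (s : {ffun 'I_d -> 'I_m}) : 'rV[int]_d := \row_i (s i : nat)%:Z.
have sV_inj : injective sV.
  by move=> s s' /rowP h; apply/ffunP => i; apply: val_inj; have := h i; rewrite !mxE => -[].
exists [seq sV s *m U | s <- enum fam]; split.
- rewrite map_inj_uniq ?enum_uniq// => s s' /(congr1 (mulmx^~ (invmx U))).
  by rewrite !mulmxK// => /sV_inj.
- rewrite size_map -cardE card_family detD foldrE big_map big_enum /=.
  apply: eq_bigr => i _; rewrite -sum1_card.
  have im : (absz (c i) <= m)%N by exact: (leq_bigmax (F := fun i => absz (c i))).
  rewrite (eq_bigl (fun a : 'I_m => true && (a < absz (c i))%N))//.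
  by rewrite (big_ord_narrow_cond im) sum1_card card_ord.
- move=> z; pose y := z *m invmx U.
  have mi i : (absz (c i) <= m)%N by exact: (leq_bigmax (F := fun i => absz (c i))).
  have yi i : (absz (y ord0 i %% c i)%Z < absz (c i))%N.
    have := ltz_mod (y ord0 i) (c0 i); have := modz_ge0 (y ord0 i) (c0 i); lia.
  have [s sE] : exists s : 'I_d -> 'I_m, forall i, s i = absz (y ord0 i %% c i)%Z :> nat.
    apply: (fin_all_exists (P := fun i (a : 'I_m) => a = absz (y ord0 i %% c i)%Z :> nat)) => i.
    by exists (Ordinal (leq_trans (yi i) (mi i))).
  exists (sV (finfun s) *m U).
    apply/mapP; exists (finfun s) => //; rewrite mem_enum; apply/familyP => i.
    by rewrite inE ffunE sE.
  exists ((\row_i (y ord0 i %/ c i)%Z) *m invmx L).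
  rewrite DE !mulmxA mulmxKV// -mulmxDl -[LHS](mulmxKV Uu) -/y; congr (_ *m U).
  clearbody y; apply/rowP => i; rewrite [RHS]mxE DlE !mxE ffunE sE.
  rewrite [X in X + _]gez0_abs ?modz_ge0//.
  by rewrite addrC -divz_eq.
- move=> _ _ k /mapP[s + ->] /mapP[s' + ->]; rewrite !mem_enum => /familyP sf /familyP sf'.
  rewrite DE !mulmxA -mulmxDl => /(congr1 (mulmx^~ (invmx U))); rewrite !mulmxK// => E.
  congr (sV _ *m U); apply/ffunP => i; apply: val_inj.
  have Ei : (s i : nat)%:Z = (s' i : nat)%:Z + (k *m L) ord0 i * c i.
    have := congr1 (fun x : 'rV_d => x ord0 i) E.
    by rewrite [RHS]mxE DlE [sV s _ _]mxE [sV s' _ _]mxE.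
  have si := sf i; have si' := sf' i; rewrite !inE in si si'.
  have := congr1 (fun x : int => (x %% c i)%Z) Ei; rewrite addrC modzMDl -!(modz_abs _ (c i)).
  by rewrite !modz_nat !modn_small// => -[].
Qed.

End lattice.

Section fibers.
Context (R : realType) (d : nat) (D : 'M[int]_d.+1).
Hypothesis dD : \det D != 0.
Local Notation Rd := 'rV[R]_d.+1.
Local Notation Zd := 'rV[int]_d.+1.
Local Notation M := (Defs.realmx R D).
Local Notation m := (absdet D).
Implicit Types (n : int) (x : Rd).

Lemma absdet_gt0 : (0 < m)%N.
Proof. by rewrite absz_gt0. Qed.

Lemma natm_gt0 : 0 < m%:R :> R.
Proof. by rewrite ltr0n absdet_gt0. Qed.

Lemma det_realmx : \det M = (\det D)%:~R.
Proof. exact: det_map_mx. Qed.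

Lemma realmx_unit : M \is a GRing.unit.
Proof. by change (M \in unitmx); rewrite unitmxE det_realmx unitfE intr_eq0. Qed.

Lemma trmx_exprz (A : 'M[R]_d.+1) n : (A ^ n)^T = (A^T) ^ n.
Proof.
have trX k : (A ^+ k)^T = (A^T) ^+ k.
  elim: k => [|k IH]; first by rewrite !expr0 trmx1.
  by rewrite exprS exprSr trmx_mul IH.
by case: n => k; rewrite ?NegzE -?exprnP ?trX// -!exprnN trmx_inv trX.
Qed.

Lemma adj_dilD n k x : adj_dil D (n + k) x = adj_dil D n (adj_dil D k x).
Proof.
rewrite /adj_dil -mulmxA; congr (_ *m _).
by rewrite addrC exprzDr// realmx_unit.
Qed.

Lemma adj_dil0 x : adj_dil D 0 x = x.
Proof. by rewrite /adj_dil expr0z mulmx1. Qed.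

Lemma adj_dilDx n x y : adj_dil D n (x + y) = adj_dil D n x + adj_dil D n y.
Proof. exact: mulmxDl. Qed.

Lemma adj_dil_inj n : injective (adj_dil D n : Rd -> Rd).
Proof.
by move=> x y /(congr1 (adj_dil D (- n))); rewrite -!adj_dilD addNr !adj_dil0.
Qed.

Lemma adj_dil1_int (k : Zd) : adj_dil D 1 (intV R k) = intV R (k *m D).
Proof. by rewrite /adj_dil expr1z /intV map_mxM. Qed.

Lemma iota_hat_eq x y : iota_hat x = iota_hat y <-> exists k : Zd, x = y + intV R k.
Proof.
split => [/iota_hatP/forallP h|[k ->]].
  exists (\row_i Num.floor ((x - y) ord0 i)); apply/rowP => i.
  have /intrP[z zE] := h i.
  rewrite !mxE; move: zE; rewrite !mxE => zE.
  by rewrite zE floorK ?intr_int// -zE; ring.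
apply/iota_hatP/forallP => i; rewrite !mxE.
by rewrite addrAC subrr add0r intr_int.
Qed.

Lemma repr_iota_hat x : exists k : Zd, repr (iota_hat x) = x + intV R k.
Proof. by apply/iota_hat_eq; exact: reprK. Qed.

Lemma iota_hatK (zeta : torus R d.+1) : iota_hat (repr zeta) = zeta.
Proof. exact: reprK. Qed.

(** The fibre of iota_hat_n is parametrized by Z^d. *)
Lemma fiber_bij n x : set_bij [set: Zd] [set xi | iota_hat_n D n xi = iota_hat x]
  (fun k => adj_dil D n (x + intV R k)).
Proof.
split.
- by move=> k _ /=; rewrite /iota_hat_n -adj_dilD addNr adj_dil0; apply/iota_hat_eq; exists k.
- by move=> k l _ _ /adj_dil_inj/addrI/intV_inj.
move=> xi /= /iota_hat_eq[k kE]; exists k => //.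
by rewrite -kE -adj_dilD subrr adj_dil0.
Qed.

Lemma esum_fiber n x (F : Rd -> \bar R) :
  (\esum_(xi in [set xi | iota_hat_n D n xi = iota_hat x]) F xi =
   \esum_(k in [set: Zd]) F (adj_dil D n (x + intV R k)))%E.
Proof. by rewrite (@reindex_esum R _ _ _ _ _ F (fiber_bij n x)). Qed.

(** [[p, p]]_n at iota_hat x, as an extended real. *)
Definition sqsum n (p : Rd -> R[i]) x : \bar R :=
  ((m%:R ^ n)%:E * \esum_(k in [set: Zd]) (nrm (p (adj_dil D n (x + intV R k))) ^+ 2)%:E)%E.

Lemma mexpz_gt0 n : 0 < m%:R ^ n :> R.
Proof. by rewrite exprz_gt0// natm_gt0. Qed.

Lemma sqsum_ge0 n p x : (0 <= sqsum n p x)%E.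
Proof.
rewrite mule_ge0 ?lee_fin ?(ltW (mexpz_gt0 n))//.
by apply: esum_ge0 => k _; rewrite lee_fin sqr_ge0.
Qed.

Lemma sqsum_periodic n p x (l : Zd) : sqsum n p (x + intV R l) = sqsum n p x.
Proof.
rewrite /sqsum; congr (_ * _)%E.
rewrite [RHS](@reindex_esum _ _ _ [set: Zd] [set: Zd] (fun k => l + k)).
  by apply: eq_esum => k _; rewrite -addrA -intVD.
split; [by []|by move=> ? ? _ _ /addrI|].
by move=> k _; exists (k - l) => //=; rewrite addrC subrK.
Qed.

Lemma natr_complex (k : nat) : (k%:R : R[i]) = (k%:R : R)%:C%C.
Proof. by rewrite rmorph_nat. Qed.

Lemma exprz_complex (k : nat) n : (k%:R : R[i]) ^ n = ((k%:R : R) ^ n)%:C%C.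
Proof. by rewrite natr_complex; case: n => a; rewrite ?NegzE -?exprnP -?exprnN ?fmorphV ?rmorphXn. Qed.

Lemma rsum_ge0 (T : choiceType) (A : set T) (a : T -> R) : (forall t, 0 <= a t) ->
  rsum A a = fine (\esum_(t in A) (a t)%:E).
Proof.
move=> a0; rewrite /rsum (eq_esum (b := fun t => (a t)%:E)) => [|t _]; last by rewrite max_l.
by rewrite [X in _ - fine X]esum1 ?subr0// => t _; rewrite max_r// oppr_le0.
Qed.

(** When the sum diverges both sides are 0, the real value given to +oo. *)
Lemma hat_bracket_sum_sq n p x :
  hat_bracket_sum D n p p (iota_hat x) = (fine (sqsum n p x))%:C%C.
Proof.
rewrite /hat_bracket_sum /csum.
have -> : rsum [set xi | iota_hat_n D n xi = iota_hat x] (fun xi => complex.Im ((p xi)^* * p xi)) = 0.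
  by rewrite /rsum !esum1 ?subrr// => t _; rewrite cImJM ?oppr0 maxxx.
rewrite rsum_ge0 => [|xi]; last by rewrite cReJM sqr_ge0.
rewrite (eq_esum (b := fun xi => (nrm (p xi) ^+ 2)%:E)) => [|k _]; last by rewrite cReJM.
rewrite esum_fiber exprz_complex -rmorphM /= /sqsum; congr (_%:C%C).
by case: (esum _ _) => [r| |] //=; rewrite ?mulr0// (gt0_muley, gt0_muleNy) ?lte_fin ?mexpz_gt0.
Qed.

Lemma Delta_hat_fiber (omega : torus R d.+1) x : Delta_hat D omega = iota_hat x <->
  exists k : Zd, omega = iota_hat (adj_dil D (- 1) (x + intV R k)).
Proof.
rewrite -[omega]iota_hatK Delta_hat_iota_hat; split.
  move=> /iota_hat_eq[k kE]; exists k; congr iota_hat.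
  by rewrite -kE -adj_dilD addNr adj_dil0.
move=> [k /iota_hat_eq[l ->]].
rewrite adj_dilDx -adj_dilD subrr adj_dil0 adj_dil1_int.
by apply/iota_hat_eq; exists (k + l *m D); rewrite intVD addrA.
Qed.

Section representatives.
Variable reps : seq Zd.
Hypotheses (ur : uniq reps) (sr : size reps = m).
Hypothesis r_ex : forall z, exists2 r, r \in reps & exists k, z = r + k *m D.
Hypothesis r_uniq : forall r r' k, r \in reps -> r' \in reps -> r = r' + k *m D -> r = r'.

(** The points above iota_hat x for Delta_hat, indexed by the representatives. *)
Definition lift_rep x (r : Zd) : torus R d.+1 := iota_hat (adj_dil D (- 1) (x + intV R r)).

Lemma mulD_inj : injective (fun k : Zd => k *m D).
Proof.
move=> k l kl; apply: (@intV_inj R); apply: (@adj_dil_inj 1).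
by rewrite !adj_dil1_int kl.
Qed.

(** z = r + k D in a unique way. *)
Lemma esum_reps (a : Zd -> \bar R) : (forall z, 0 <= a z)%E ->
  (\esum_(z in [set: Zd]) a z = \sum_(r <- reps) \esum_(k in [set: Zd]) a (r + k *m D)%R)%E.
Proof.
move=> a0.
have b : set_bij ([set` reps] `*`` (fun=> [set: Zd])) [set: Zd] (fun rk => rk.1 + rk.2 *m D).
  split=> //.
    move=> [r k] [r' k'] /= /set_mem [/= rr _] /set_mem [/= rr' _] E.
    have rE : r = r'.
      apply: (r_uniq (k := k' - k)) => //.
      by rewrite mulmxBl addrA -E addrK.
    by rewrite rE in E *; move/addrI/mulD_inj: E => ->.
  move=> z _; have [r rr [k ->]] := r_ex z; by exists (r, k).
rewrite (@reindex_esum R _ _ _ _ _ a b) -(@esum_esum _ _ _ _ _ (fun r k => a (r + k *m D))) => [|r k _ _]; last exact: a0.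
have fs : finite_set [set` reps] by exact: finite_seq.
rewrite (esum_fset fs); first by rewrite -fsbig_seq.
by move=> r _; apply: esum_ge0 => k _.
Qed.

(** Split Z^d into the cosets r + Z^d D: (x + r + k D) M^(n-1) is
    ((x + r) M^-1 + k) M^n, so each coset contributes the sum of level n at a
    point of the fibre of Delta_hat. *)
Lemma sqsum_pred n p x : (sqsum (n - 1) p x =
  (m%:R^-1)%:E * \sum_(r <- reps) sqsum n p (adj_dil D (- 1) (x + intV R r)))%E.
Proof.
rewrite /sqsum esum_reps; last by move=> z; rewrite lee_fin sqr_ge0.
rewrite -ge0_sume_distrr; last first.
  by move=> r _; apply: esum_ge0 => k _; rewrite lee_fin sqr_ge0.
rewrite muleA -EFinM; congr (_%:E * _)%E.
  by rewrite mulrC -[X in X ^ (_ - _)]/(m%:R) exprzDr ?unitfE ?gt_eqF ?natm_gt0// exprN1.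
apply: eq_bigr => r _; apply: eq_esum => k _; congr (nrm (p _) ^+ 2)%:E.
by rewrite intVD addrA -adj_dil1_int (adj_dilDx (n - 1)) (adj_dilDx n _ (intV R k)) -!adj_dilD subrK.
Qed.

Lemma lift_rep_inj x r r' : r \in reps -> r' \in reps -> lift_rep x r = lift_rep x r' -> r = r'.
Proof.
move=> rr rr' /iota_hat_eq[k /(congr1 (adj_dil D 1))].
rewrite (adj_dilDx 1 _ (intV R k)) -!adj_dilD subrr !adj_dil0 adj_dil1_int -addrA => /addrI.
by rewrite -intVD => /intV_inj; exact: r_uniq.
Qed.

Lemma mem_Delta_hat_fiber x omega :
  Delta_hat D omega = iota_hat x <-> exists2 r, r \in reps & omega = lift_rep x r.
Proof.
rewrite Delta_hat_fiber; split => [[z ->]|[r _ ->]]; last by exists r.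
have [r rr [k ->]] := r_ex z; exists r => //; apply/iota_hat_eq; exists k.
by rewrite intVD addrA -adj_dil1_int (adj_dilDx _ _ (adj_dil D 1 _)) -adj_dilD addNr adj_dil0.
Qed.

Lemma sum_Delta_hat_fiber (V : nmodType) (F : torus R d.+1 -> V) x :
  \sum_(omega \in [set omega | Delta_hat D omega = iota_hat x]) F omega =
  \sum_(r <- reps) F (lift_rep x r).
Proof.
have -> : [set omega | Delta_hat D omega = iota_hat x] = [set` map (lift_rep x) reps].
  apply/seteqP; split => omega /=.
    by move=> /mem_Delta_hat_fiber[r rr ->]; exact: map_f.
  by move=> /mapP[r rr ->]; apply/mem_Delta_hat_fiber; exists r.
rewrite -fsbig_seq ?big_map// map_inj_in_uniq// => r r' rr rr'; exact: lift_rep_inj.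
Qed.

End representatives.

Lemma dotrC (x y : Rd) : dotr x y = dotr y x.
Proof. by rewrite !dotrE; apply: eq_bigr => i _; rewrite mulrC. Qed.

Lemma mulmx_cube (B : 'M[R]_d.+1) : B \in unitmx ->
  forall r, exists s, forall y : Rd, cube r (y *m B) -> cube s y.
Proof.
move=> Bu r; pose b i := \sum_j r%:R * `|invmx B j i|.
exists (\max_i Num.truncn (b i)).+1 => y yr i.
have -> : y = (y *m B) *m invmx B by rewrite mulmxK.
rewrite set_itvE /= -ler_norml mxE (le_trans (ler_norm_sum _ _ _))//.
apply: (@le_trans _ _ (b i)).
  apply: ler_sum => j _; rewrite normrM ler_wpM2r//.
  by have := yr j; rewrite set_itvE /= -ler_norml.
rewrite (le_trans (ltW (truncnS_gt _)))// ler_nat ltnS.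
exact: (leq_bigmax (F := fun i => Num.truncn (b i))).
Qed.

Lemma normr_det_exprz (A : 'M[R]_d.+1) n : `|\det (A ^ n)| = `|\det A| ^ n.
Proof.
have dX k : \det (A ^+ k) = \det A ^+ k.
  elim: k => [|k IH]; first by rewrite !expr0 det1.
  by rewrite !exprS -IH -det_mulmx.
by case: n => k; rewrite ?NegzE -?exprnP -?exprnN ?det_inv dX ?normfV normrX.
Qed.

Lemma normr_det_realmx n : `|\det ((M^T) ^ n)| = m%:R ^ n.
Proof. by rewrite normr_det_exprz det_tr det_realmx -intr_norm -abszE. Qed.

Lemma max0BN (x : R) : Num.max x 0 - Num.max (- x) 0 = x.
Proof. by rewrite !maxEle oppr_le0; case: (leP x 0); case: (leP 0 x); lra. Qed.

Lemma csum_seq (T : choiceType) (s : seq T) (a : T -> R[i]) : uniq s ->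
  (forall t, t \notin s -> a t = 0) -> csum setT a = \sum_(t <- s) a t.
Proof.
move=> us az.
have H (b : T -> R) : (forall t, t \notin s -> b t = 0) -> rsum setT b = \sum_(t <- s) b t.
  move=> bz; rewrite /rsum !(esum_seq (s := s))//.
  - rewrite !sumEFin /= -sumrB; apply: eq_bigr => t _.
    exact: max0BN.
  - by move=> t; rewrite lee_fin le_max lexx orbT.
  - by move=> t /bz ->; rewrite oppr0 maxxx.
  - by move=> t; rewrite lee_fin le_max lexx orbT.
  - by move=> t /bz ->; rewrite maxxx.
by apply: complexP; rewrite /= ?cRe_sum ?cIm_sum H// => t /az ->.
Qed.

Lemma esumZl (T : choiceType) (c : R) (a : T -> \bar R) : 0 <= c -> (forall t, (0 <= a t)%E) ->
  \esum_(t in [set: T]) (c%:E * a t)%E = (c%:E * \esum_(t in [set: T]) a t)%E.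
Proof.
move=> c0 a0; have [->|cn] := eqVneq c 0.
  by rewrite mul0e; apply: esum1 => t _; rewrite mul0e.
have cp : 0 < c by rewrite lt_neqAle eq_sym cn.
apply/eqP; rewrite eq_le; apply/andP; split.
  apply: esum_le_seq => s us.
  rewrite -ge0_sume_distrr//; apply: lee_wpmul2l => //; exact: esum_ge_seq.
rewrite -lee_pdivlMl//; apply: esum_le_seq => s us.
rewrite lee_pdivlMl// ge0_sume_distrr//; apply: esum_ge_seq => // t; exact: mule_ge0.
Qed.

(** * The bracket of functions of C_c as a sum over fibres *)

Section twisted.
Variables (n : int) (u : Rd -> R[i]).
Hypothesis uc : ctsupp u.
Let B : 'M[R]_d.+1 := (M^T) ^ (- n).

Let Bu : B \in unitmx.
Proof.
rewrite unitmxE unitfE -normr_eq0 normr_det_realmx gt_eqF//.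
exact: mexpz_gt0.
Qed.

Let Bdet : \det B != 0.
Proof. by move: Bu; rewrite unitmxE unitfE. Qed.

Let BE : `|\det B| = (m%:R ^ n)^-1.
Proof. by rewrite normr_det_realmx invr_expz. Qed.

(** Its Fourier coefficients are the values of the Fourier transform of u on the
    fibre of x, its autocorrelations the terms of the Fourier series of the
    bracket of u at x, both up to |det B|. *)
Let w (x y : Rd) : R[i] := u (y *m B) * expi2pi (dotr y x).

Let wc x : ctsupp (w x).
Proof.
have [cR cI] := continuous_expi2pi_dotr x.
apply: ctsuppM => //; apply: (@ctsupp_comp _ _ u (fun y => y *m B)) => //.
  exact: continuous_mulmxrV.
exact: mulmx_cube.
Qed.

Let fcoef_w x k : (`|\det B|)%:C%C * fcoef (w x) k = fourier u (adj_dil D n (x + intV R k)).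
Proof.
rewrite /fourier -[RHS](cintegral_mulmx Bdet); last first.
  by apply: cmeasurableM; [exact: ctsupp_cmeasurable|exact: cmeasurable_expi2pi_dotr].
congr (_ * _); apply: eq_cintegral => y; rewrite /w /trig -mulrA -expi2piD -dotrDr.
congr (_ * expi2pi _); rewrite dotr_mulmx; congr dotr.
rewrite /adj_dil /B -trmx_exprz trmxK -mulmxA.
by rewrite -[_ *m M ^ (- n)]/(M ^ n * M ^ (- n)) -exprzDr ?realmx_unit// subrr expr0z mulmx1.
Qed.

Let acorr_w x g : (`|\det B|)%:C%C * acorr (w x) g = bracket D n u u g * trig g x.
Proof.
have ub : ctsupp (fun z => (u (z - dil D (- n) (map_mx intr g)))^* * u z).
  apply: ctsuppMl => //; apply: ctsuppJ.
  exact: (ctsupp_translate (- dil D (- n) (map_mx intr g)) uc).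
rewrite /bracket -(cintegral_mulmx Bdet); last exact: ctsupp_cmeasurable.
rewrite -mulrA; congr (_ * _); rewrite mulrC -cintegralZ; last first.
  apply: ctsupp_integrable.
  apply: (@ctsupp_comp _ _ _ (fun y => y *m B)) ub; first exact: continuous_mulmxrV.
  exact: mulmx_cube.
apply: eq_cintegral => y; rewrite /w /dil mulmxBl rmorphM /= expi2piJ.
rewrite /trig (dotrC x) -/(intV R g) dotrDl dotrNl opprD opprK expi2piD.
have E : expi2pi (- dotr y x) * expi2pi (dotr y x) = 1 by rewrite -expi2piD addNr expi2pi0.
transitivity ((expi2pi (- dotr y x) * expi2pi (dotr y x)) * (expi2pi (dotr (intV R g) x) *
   ((u (y *m B - intV R g *m B))^* * u (y *m B)))); first by ring.
by rewrite E mul1r.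
Qed.

Lemma bracket_parseval : exists s : seq Zd, [/\ uniq s,
  forall g, g \notin s -> bracket D n u u g = 0 &
  forall x, (sqsum n (fourier u) x < +oo)%E /\
   \sum_(g <- s) bracket D n u u g * trig g x = (fine (sqsum n (fourier u) x))%:C%C].
Proof.
have [_ _ [r ur]] := uc; have [s rs] := mulmx_cube Bu r.
have ws x y : w x y != 0 -> cube s y by rewrite mulf_eq0 negb_or => /andP[/ur/rs].
exists (zbox d.+1 (2 * s + 1)); split.
- exact: zbox_uniq.
- move=> g gs; have := acorr_w 0 g.
  by rewrite (acorr_eq0 (ws 0) _ gs) ?leq_addr// mulr0 /trig dotr0l expi2pi0 mulr1.
move=> x; have [Wx Woo] := parseval (wc x) (ws x).
have b0 : 0 < `|\det B| by rewrite normr_gt0.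
have sE : sqsum n (fourier u) x = (`|\det B|%:E * \esum_(k in [set: Zd]) (nrm (fcoef (w x) k) ^+ 2)%:E)%E.
  rewrite /sqsum (eq_esum (b := fun k => ((`|\det B| ^+ 2)%:E * (nrm (fcoef (w x) k) ^+ 2)%:E)%E)); last first.
    by move=> k _; rewrite -fcoef_w nrmM nrm_real normr_id exprMn EFinM.
  rewrite esumZl ?sqr_ge0//; last by move=> k; rewrite lee_fin sqr_ge0.
  rewrite muleA -EFinM BE expr2 mulrA mulfV ?mul1r//.
  by rewrite gt_eqF// mexpz_gt0.
split.
  by rewrite sE; apply: lte_mul_pinfty.
rewrite (eq_bigr _ (fun g _ => esym (acorr_w x g))) -mulr_sumr Wx -rmorphM /= sE.
by rewrite fineM// ge0_fin_numE//; apply: esum_ge0 => k _; rewrite lee_fin sqr_ge0.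
Qed.

End twisted.

End fibers.

(** * Norms of l^2 on the fibres *)

Section fibre_norm.
Context (R : realType) (d : nat) (D : 'M[int]_d.+1).
Hypothesis dD : \det D != 0.
Local Notation Rd := 'rV[R]_d.+1.
Local Notation Zd := 'rV[int]_d.+1.
Local Notation m := (absdet D).
Implicit Types (n : int) (x : Rd) (p q : Rd -> R[i]).

(** With the parameter e, which is optimized in [fnormD_le], this pointwise bound
    sums over a fibre without the Cauchy-Schwarz inequality. *)
Lemma sqr_nrmD_le (e : R) (a b : R[i]) : 0 < e ->
  nrm (a + b) ^+ 2 <= (1 + e) * nrm a ^+ 2 + (1 + e^-1) * nrm b ^+ 2.
Proof.
move=> e0; apply: (@le_trans _ _ ((nrm a + nrm b) ^+ 2)).
  by rewrite ler_sqr ?nnegrE ?addr_ge0 ?nrm_ge0// le_nrmD.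
rewrite -subr_ge0.
have -> : (1 + e) * nrm a ^+ 2 + (1 + e^-1) * nrm b ^+ 2 - (nrm a + nrm b) ^+ 2
   = e^-1 * (e * nrm a - nrm b) ^+ 2 by field; rewrite gt_eqF.
by rewrite mulr_ge0 ?sqr_ge0// invr_ge0 ltW.
Qed.

Lemma sqsumD_le n p q x (e : R) : 0 < e ->
  (sqsum D n (fun y => p y + q y)%R x <=
   (1 + e)%:E * sqsum D n p x + (1 + e^-1)%:E * sqsum D n q x)%E.
Proof.
move=> e0; have e10 : 0 <= 1 + e by rewrite addr_ge0// ltW.
have e20 : 0 <= 1 + e^-1 by rewrite addr_ge0// invr_ge0 ltW.
pose E p' : \bar R := (\esum_(k in [set: Zd]) (nrm (p' (adj_dil D n (x + intV R k)) : R[i]) ^+ 2)%:E)%E.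
have sE p' : sqsum D n p' x = ((m%:R ^ n)%:E * E p')%E by [].
have E0 p' : (0 <= E p')%E by apply: esum_ge0 => k _; rewrite lee_fin sqr_ge0.
rewrite !sE [leRHS](_ : _ = (m%:R ^ n)%:E * ((1 + e)%:E * E p + (1 + e^-1)%:E * E q))%E; last first.
  by rewrite ge0_muleDr ?mule_ge0// !(muleCA (m%:R ^ n)%:E).
apply: lee_wpmul2l; first by rewrite lee_fin ltW// mexpz_gt0.
rewrite /E -!esumZl//; [|by move=> k; rewrite lee_fin sqr_ge0..].
rewrite -esumD; [|by move=> k _; rewrite -EFinM lee_fin mulr_ge0 ?sqr_ge0..].
by apply: le_esum => k _; rewrite -!EFinM -EFinD lee_fin sqr_nrmD_le.
Qed.

Lemma sqsum_unit n p x (c : R[i]) : nrm c = 1 ->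
  sqsum D n (fun y => c * p y) x = sqsum D n p x.
Proof.
by move=> c1; congr (_ * _)%E; apply: eq_esum => k _; rewrite nrmM c1 mul1r.
Qed.

Definition fnorm n p x : R := Num.sqrt (fine (sqsum D n p x)).

Definition finite_at n p x := (sqsum D n p x < +oo)%E.

Lemma sqsum_fin n p x : finite_at n p x -> sqsum D n p x = (fine (sqsum D n p x))%:E.
Proof. by move=> h; rewrite fineK// ge0_fin_numE// sqsum_ge0. Qed.

Lemma fine_sqsum_ge0 n p x : 0 <= fine (sqsum D n p x).
Proof. by rewrite fine_ge0// sqsum_ge0. Qed.

Lemma sqr_fnorm n p x : fnorm n p x ^+ 2 = fine (sqsum D n p x).
Proof. by rewrite sqr_sqrtr// fine_sqsum_ge0. Qed.

Lemma fnorm_ge0 n p x : 0 <= fnorm n p x.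
Proof. exact: sqrtr_ge0. Qed.

Lemma finite_atD n p q x : finite_at n p x -> finite_at n q x ->
  finite_at n (fun y => p y + q y) x.
Proof.
move=> fp fq; apply: (le_lt_trans (sqsumD_le n p q x ltr01)).
by rewrite (sqsum_fin fp) (sqsum_fin fq) -!EFinM -EFinD ltry.
Qed.

Lemma fnormD_le n p q x : finite_at n p x -> finite_at n q x ->
  fnorm n (fun y => p y + q y) x <= fnorm n p x + fnorm n q x.
Proof.
move=> fp fq; apply/ler_addgt0Pr => e e0.
set a := fnorm n p x; set b := fnorm n q x.
have [a0 b0] : 0 <= a /\ 0 <= b by split; exact: fnorm_ge0.
(* The optimal parameter is b / a; a and b are perturbed to be positive. *)
pose a' := a + e / 2; pose b' := b + e / 2.
have a'0 : 0 < a' by rewrite ltr_wpDl// divr_gt0.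
have b'0 : 0 < b' by rewrite ltr_wpDl// divr_gt0.
have -> : a + b + e = a' + b' by rewrite /a' /b'; field.
have ab0 : 0 <= a' + b' by rewrite addr_ge0// ltW.
rewrite -(ger0_norm ab0) -sqrtr_sqr ler_wsqrtr//.
have := sqsumD_le n p q x (divr_gt0 b'0 a'0).
rewrite (sqsum_fin fp) (sqsum_fin fq) (sqsum_fin (finite_atD fp fq)) -!EFinM -EFinD lee_fin.
rewrite -!sqr_fnorm -/a -/b => /le_trans; apply.
have aa : a ^+ 2 <= a' ^+ 2 by rewrite ler_sqr ?nnegrE ?(ltW a'0)// lerDl divr_ge0// ltW.
have bb : b ^+ 2 <= b' ^+ 2 by rewrite ler_sqr ?nnegrE ?(ltW b'0)// lerDl divr_ge0// ltW.
have -> : (a' + b') ^+ 2 = (1 + b' / a') * a' ^+ 2 + (1 + (b' / a')^-1) * b' ^+ 2.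
  by field; rewrite !gt_eqF.
by rewrite lerD// ler_wpM2l// addr_ge0 ?invr_ge0 ?divr_ge0 ?(ltW a'0) ?(ltW b'0).
Qed.

Lemma sqsumN n p x : sqsum D n (fun y => - p y) x = sqsum D n p x.
Proof. by congr (_ * _)%E; apply: eq_esum => k _; rewrite nrmN. Qed.

Lemma finite_atB n p q x : finite_at n p x -> finite_at n q x ->
  finite_at n (fun y => p y - q y) x.
Proof. by move=> fp fq; apply: finite_atD => //; rewrite /finite_at sqsumN. Qed.

Lemma eq_fnorm n p q x : (forall y, p y = q y) -> fnorm n p x = fnorm n q x.
Proof. by move=> pq; congr (fnorm n _ x); apply/funext. Qed.

Lemma fnormB n p q x : finite_at n p x -> finite_at n q x ->
  `|fnorm n p x - fnorm n q x| <= fnorm n (fun y => p y - q y) x.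
Proof.
have H p' q' : finite_at n p' x -> finite_at n q' x ->
    fnorm n p' x - fnorm n q' x <= fnorm n (fun y => p' y - q' y) x.
  move=> fp fq; rewrite lerBlDr.
  rewrite (eq_fnorm n (q := fun y => (p' y - q' y) + q' y)); last by move=> y; rewrite subrK.
  by apply: fnormD_le => //; exact: finite_atB.
move=> fp fq; rewrite ler_norml H// andbT lerNl opprB (le_trans (H _ _ fq fp))//.
by rewrite /fnorm -sqsumN -/(fnorm n _ x) (eq_fnorm n (q := fun y => p y - q y))// => y; rewrite opprB.
Qed.

Lemma fnorm_periodic n p x (k : Zd) : fnorm n p (x + intV R k) = fnorm n p x.
Proof. by rewrite /fnorm sqsum_periodic. Qed.

End fibre_norm.

(** * Fourier transforms of functions of C_c *)

Section fourier_ctsupp.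
Context (R : realType) (d : nat).
Local Notation Rd := 'rV[R]_d.+1.
Implicit Types (u v : Rd -> R[i]).

Lemma fourier_integrable u xi : ctsupp u -> cintegrable (fun x => u x * expi2pi (dotr x xi)).
Proof.
move=> uc; have [cR cI] := continuous_expi2pi_dotr xi.
by apply: ctsupp_integrable; exact: ctsuppM.
Qed.

Lemma fourierD u v xi : ctsupp u -> ctsupp v ->
  fourier (fun x => u x + v x) xi = fourier u xi + fourier v xi.
Proof.
move=> uc vc; rewrite /fourier -cintegralD; [|exact: fourier_integrable..].
by apply: eq_cintegral => x; rewrite mulrDl.
Qed.

Lemma fourierZ c u xi : ctsupp u -> fourier (fun x => c * u x) xi = c * fourier u xi.
Proof.
move=> uc; rewrite /fourier -cintegralZ; last exact: fourier_integrable.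
by apply: eq_cintegral => x; rewrite mulrA.
Qed.

Lemma fourierB u v xi : ctsupp u -> ctsupp v ->
  fourier (fun x => u x - v x) xi = fourier u xi - fourier v xi.
Proof.
move=> uc vc; rewrite -[- fourier v xi]mulN1r -fourierZ// -fourierD//; last exact: ctsuppZ.
by congr fourier; apply/funext => x; rewrite mulN1r.
Qed.

Lemma cmeasurable_fourier u : ctsupp u -> cmeasurable (fourier u).
Proof.
move=> uc; have [mR mI] := ctsupp_cmeasurable uc.
have mdot : measurable_fun setT (fun p : Rd * Rd => 2 * pi * dotr p.2 p.1).
  apply: measurable_funM => //; under eq_fun do rewrite dotrE; apply: measurable_sum => i.
  apply: measurable_funM; apply: (measurableT_comp (measurable_rV_coord i)).
    exact: measurable_snd.
  exact: measurable_fst.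
have mcos := measurableT_comp (continuous_measurable_fun (@continuous_cos R)) mdot.
have msin := measurableT_comp (continuous_measurable_fun (@continuous_sin R)) mdot.
have m1 := measurableT_comp mR (@measurable_snd _ _ Rd Rd).
have m2 := measurableT_comp mI (@measurable_snd _ _ Rd Rd).
split; apply: measurable_integral_param.
  by under eq_fun do rewrite cReM; apply: measurable_funB; apply: measurable_funM.
by under eq_fun do rewrite cImM; apply: measurable_funD; apply: measurable_funM.
Qed.

End fourier_ctsupp.

(** * Comparison of the norms of the modules *)

Section module_norm.
Context (R : realType) (d : nat) (D : 'M[int]_d.+1).
Hypothesis dD : \det D != 0.
Local Notation Rd := 'rV[R]_d.+1.
Local Notation Zd := 'rV[int]_d.+1.
Local Notation m := (absdet D).
Implicit Types (n : int) (x : Rd) (u : Rd -> R[i]).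

Lemma fourier_Zn_bracket n u (zeta : torus R d.+1) : ctsupp u ->
  fourier_Zn (bracket D n u u) zeta = (fine (sqsum D n (fourier u) (repr zeta)))%:C%C.
Proof.
move=> uc; have [s [us sz sE]] := bracket_parseval dD n uc.
rewrite /fourier_Zn (csum_seq us) => [|g /sz ->]; last by rewrite mul0r.
by rewrite -(sE (repr zeta)).2; apply: eq_bigr => g _; rewrite dotrC.
Qed.

Lemma finite_at_fourier n u x : ctsupp u -> finite_at D n (fourier u) x.
Proof. by move=> uc; have [s [_ _ /(_ x)[]]] := bracket_parseval dD n uc. Qed.

Lemma continuous_fnorm n u : ctsupp u -> continuous (fnorm D n (fourier u)).
Proof.
move=> uc; have [s [us sz sE]] := bracket_parseval dD n uc.
have -> : fnorm D n (fourier u) =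
    fun x => Num.sqrt (\sum_(g <- s) complex.Re (bracket D n u u g * trig g x)).
  by apply/funext => x; rewrite -cRe_sum (sE x).2.
apply: rV_continuous_comp; first exact: sqrt_continuous.
apply: rV_continuous_sum => g; under eq_fun do rewrite cReM.
have [cR cI] := continuous_expi2pi_dotr (intV R g).
by apply: rV_continuousB; apply: rV_continuousM => //; exact: cst_continuous.
Qed.

Lemma fnorm_bounded n u : ctsupp u -> exists C, forall x, fnorm D n (fourier u) x <= C.
Proof.
move=> uc; have [s [us sz sE]] := bracket_parseval dD n uc.
exists (Num.sqrt (\sum_(g <- s) nrm (bracket D n u u g))) => x.
apply: ler_wsqrtr; apply: (@le_trans _ _ (nrm (fine (sqsum D n (fourier u) x))%:C%C)).
  by rewrite nrm_real ler_norm.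
rewrite -(sE x).2; apply: (le_trans (nrm_sum _ _ _)).
by apply: ler_sum => g _; rewrite nrmM nrm_trig mulr1.
Qed.

Lemma X_norm_CcE n u : ctsupp u -> X_norm_Cc D n u =
  sup (range (fun zeta : torus R d.+1 => fnorm D n (fourier u) (repr zeta))).
Proof.
move=> uc; rewrite /X_norm_Cc.
suff -> : (fun zeta => Num.sqrt (complex.Re (fourier_Zn (bracket D n u u) zeta))) =
    (fun zeta : torus R d.+1 => fnorm D n (fourier u) (repr zeta)) by [].
by apply/funext => zeta; rewrite fourier_Zn_bracket.
Qed.

Lemma fnorm_repr n p x : fnorm D n p (repr (iota_hat x)) = fnorm D n p x.
Proof. by have [k ->] := repr_iota_hat x; rewrite fnorm_periodic. Qed.

Lemma fnorm_le_X_norm n u x : ctsupp u -> fnorm D n (fourier u) x <= X_norm_Cc D n u.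
Proof.
move=> uc; rewrite X_norm_CcE// -fnorm_repr; apply: sup_ubound; last by exists (iota_hat x).
by have [C uC] := fnorm_bounded n uc; exists C => _ [zeta _ <-].
Qed.

Section mean_over_fibres.
Variable reps : seq Zd.
Hypotheses (sr : size reps = m).
Hypothesis r_ex : forall z, exists2 r, r \in reps & exists k, z = r + k *m D.
Variables (F G : torus R d.+1 -> R) (C : R).
Hypothesis F0 : forall zeta, 0 <= F zeta.
Hypothesis FC : forall zeta, F zeta <= C.
Hypothesis FG : forall x, G (iota_hat x) = m%:R^-1 * \sum_(r <- reps) F (lift_rep D x r).

(** The mean of F over a fibre is at most its maximum, and F omega is at most m
    times the mean over the fibre that contains omega. *)
Lemma sup_sqrt_mean :
  (Num.sqrt m%:R)^-1 * sup (range (Num.sqrt \o F)) <= sup (range (Num.sqrt \o G))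
    <= sup (range (Num.sqrt \o F)).
Proof.
have m0 := natm_gt0 R dD.
have hF zeta : Num.sqrt (F zeta) <= sup (range (Num.sqrt \o F)).
  by apply: sup_ubound; [exists (Num.sqrt C) => _ [z _ <-]; exact: ler_wsqrtr|exists zeta].
have sF0 : 0 <= sup (range (Num.sqrt \o F)) by apply: le_trans (hF (iota_hat 0)); exact: sqrtr_ge0.
have GF zeta : Num.sqrt (G zeta) <= sup (range (Num.sqrt \o F)).
  rewrite -[zeta]iota_hatK FG -[leRHS]ger0_norm// -sqrtr_sqr; apply: ler_wsqrtr.
  rewrite ler_pdivrMl//.
  have -> : m%:R * sup (range (Num.sqrt \o F)) ^+ 2 = \sum_(r <- reps) sup (range (Num.sqrt \o F)) ^+ 2.
    by rewrite big_const_seq count_predT sr iter_addr_0 mulr_natl.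
  apply: ler_sum => r _; rewrite -[leLHS]sqr_sqrtr// ler_sqr ?nnegrE ?sqrtr_ge0//.
apply/andP; split; last first.
  apply: ge_sup => [|_ [z _ <-]]; last exact: GF.
  by exists (Num.sqrt (G (iota_hat 0))); exists (iota_hat 0).
rewrite ler_pdivrMl ?sqrtr_gt0//; apply: ge_sup.
  by exists (Num.sqrt (F (iota_hat 0))); exists (iota_hat 0).
move=> _ [omega _ <-] /=.
have [r rr oE] := (mem_Delta_hat_fiber dD r_ex _ _).1 (Delta_hat_iota_hat D (repr omega)).
rewrite iota_hatK in oE.
apply: (@le_trans _ _ (Num.sqrt m%:R * Num.sqrt (G (iota_hat (adj_dil D 1 (repr omega)))))).
  rewrite -sqrtrM ?ler0n// ler_wsqrtr// FG mulrA mulfV ?mul1r; last by rewrite gt_eqF.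
  by rewrite (big_rem r)//= -oE lerDl sumr_ge0.
rewrite ler_wpM2l ?sqrtr_ge0//; apply: sup_ubound; last by exists (iota_hat (adj_dil D 1 (repr omega))).
by exists (sup (range (Num.sqrt \o F))) => _ [z _ <-].
Qed.

End mean_over_fibres.

Lemma fine_sqsum_pred (reps : seq Zd) : uniq reps ->
  (forall z, exists2 r, r \in reps & exists k, z = r + k *m D) ->
  (forall r r' k, r \in reps -> r' \in reps -> r = r' + k *m D -> r = r') ->
  forall n p x, (forall y, finite_at D n p y) -> fine (sqsum D (n - 1) p x) =
  m%:R^-1 * \sum_(r <- reps) fine (sqsum D n p (adj_dil D (- 1) (x + intV R r))).
Proof.
move=> ur r_ex r_uniq n p x pf; rewrite (sqsum_pred dD ur r_ex r_uniq).
move: (adj_dil D (- 1)) => h; move: (m%:R^-1) => c.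
rewrite (eq_bigr (fun r => (fine (sqsum D n p (h (x + intV R r))))%:E)); last first.
  by move=> r _; exact: sqsum_fin.
by rewrite sumEFin.
Qed.

Lemma X_norm_Cc_pred n u : ctsupp u ->
  (Num.sqrt m%:R)^-1 * X_norm_Cc D n u <= X_norm_Cc D (n - 1) u <= X_norm_Cc D n u.
Proof.
move=> uc; have [reps [ur sr r_ex r_uniq]] := lattice_reps dD.
have [C uC] := fnorm_bounded n uc.
pose F n (zeta : torus R d.+1) := fine (sqsum D n (fourier u) (repr zeta)).
have E k : X_norm_Cc D k u = sup (range (Num.sqrt \o F k)) by rewrite X_norm_CcE.
rewrite !E; apply: (@sup_sqrt_mean reps sr r_ex (F n) (F (n - 1)) (C ^+ 2)).
- by move=> zeta; exact: fine_sqsum_ge0.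
- move=> zeta; rewrite /F -sqr_fnorm// ler_sqr ?nnegrE ?fnorm_ge0//.
  exact: le_trans (fnorm_ge0 _ _ _ _) (uC (repr zeta)).
move=> x; have FE k y : F k (iota_hat y) = fine (sqsum D k (fourier u) y).
  rewrite /F; have [l ->] := repr_iota_hat y.
  by rewrite sqsum_periodic.
rewrite FE (fine_sqsum_pred ur r_ex r_uniq); last by move=> y; exact: finite_at_fourier.
clearbody F.
have FL r : fine (sqsum D n (fourier u) (adj_dil D (- 1) (x + intV R r))) = F n (lift_rep D x r).
  exact: (esym (FE n _)).
by rewrite (eq_bigr _ (fun r _ => FL r)).
Qed.

Lemma X_predE n : X (R := R) D n = X D (n - 1).
Proof.
have m0 : 0 < Num.sqrt m%:R :> R by rewrite sqrtr_gt0 natm_gt0.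
apply/seteqP; split => f [fL [u [uc uCauchy uf]]]; (split; first exact: fL);
  exists u; (split; [exact: uc| |exact: uf]) => e e0.
- have [N hN] := uCauchy e e0; exists N => j k Nj Nk; apply: le_lt_trans (hN j k Nj Nk).
  have /andP[_ h] := X_norm_Cc_pred n (ctsuppB (Cc_ctsupp (uc j)) (Cc_ctsupp (uc k))); exact: h.
have m0' : 0 < (Num.sqrt m%:R)^-1 :> R by rewrite invr_gt0.
have [N hN] := uCauchy ((Num.sqrt m%:R)^-1 * e) (mulr_gt0 m0' e0).
exists N => j k Nj Nk; rewrite -(ltr_pM2l m0'); apply: le_lt_trans (hN j k Nj Nk).
have /andP[h _] := X_norm_Cc_pred n (ctsuppB (Cc_ctsupp (uc j)) (Cc_ctsupp (uc k))); exact: h.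
Qed.

Lemma X_eq n k : X (R := R) D n = X D k.
Proof.
suff H j : X (R := R) D j = X D 0 by rewrite H [RHS]H.
elim/int_rec: j => [//|j IH|j IH]; first by rewrite X_predE -IH; congr X; lia.
by rewrite -IH [RHS]X_predE; congr X; lia.
Qed.

Lemma X_hat_eq n k : X_hat (R := R) D n = X_hat D k.
Proof. by rewrite /X_hat (X_eq n k). Qed.

End module_norm.

(** Otherwise 0 would be an eigenvalue. *)
Lemma dilation_det (R : realType) d (D : 'M[int]_d.+1) : dilation_matrix R D -> \det D != 0.
Proof.
move=> hD; apply/eqP => D0.
have : eigenvalue (map_mx intr D : 'M[R[i]]_d.+1) 0.
  rewrite eigenvalue_root_char /root horner_coef0 char_poly_det.
  by rewrite det_map_mx D0 rmorph0 mulr0.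
by move=> /hD; rewrite normr0 ltr10.
Qed.

(** * Plancherel's equality *)

Section energy.
Context (R : realType) (d : nat).
Local Notation Rd := 'rV[R]_d.+1.
Local Notation mu := (lebesgue_rV R d.+1).
Implicit Types (f g : Rd -> R[i]).

Definition energy f : \bar R := (\int[mu]_x (nrm (f x) ^+ 2)%:E)%E.

Lemma measurable_sqr_nrm f : cmeasurable f -> measurable_fun setT (fun x => (nrm (f x) ^+ 2)%:E).
Proof. by move=> mf; apply/measurable_EFinP; apply: measurable_funX; exact: measurable_nrm. Qed.

Lemma energyD_le f g : cmeasurable f -> cmeasurable g ->
  (energy (fun x => f x + g x)%R <= 2%:E * energy f + 2%:E * energy g)%E.
Proof.
move=> mf mg; have [m1 m2] := (measurable_sqr_nrm mf, measurable_sqr_nrm mg).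
rewrite -!ge0_integralZl_EFin//; [|by move=> x _; rewrite lee_fin sqr_ge0..].
rewrite -ge0_integralD//; [|by move=> x _; rewrite -EFinM lee_fin mulr_ge0 ?sqr_ge0|
  exact: emeasurable_funM|by move=> x _; rewrite -EFinM lee_fin mulr_ge0 ?sqr_ge0|exact: emeasurable_funM].
apply: ge0_le_integral => //.
- by move=> x _; rewrite lee_fin sqr_ge0.
- by apply: measurable_sqr_nrm; exact: cmeasurableD.
- by apply: emeasurable_funD; exact: emeasurable_funM.
move=> x _; rewrite -!EFinM -EFinD lee_fin (le_trans (sqr_nrmD_le _ _ ltr01))//.
by rewrite invr1.
Qed.

Lemma energyN f : energy (fun x => - f x) = energy f.
Proof. by apply: eq_integral => x _; rewrite nrmN. Qed.

Lemma energy_unit (c : R[i]) f : nrm c = 1 -> energy (fun x => c * f x) = energy f.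
Proof. by move=> c1; apply: eq_integral => x _; rewrite nrmM c1 mul1r. Qed.

(** Convergence to 0 of a nonnegative sequence. *)
Definition vanishes (s : nat -> \bar R) :=
  forall e : R, 0 < e -> exists N, forall k, (N <= k)%N -> (s k < e%:E)%E.

Lemma vanishes_le2 (s t w : nat -> \bar R) : vanishes s -> vanishes t ->
  (forall k, w k <= 2%:E * s k + 2%:E * t k)%E -> vanishes w.
Proof.
move=> vs vt wst e e0; have e4 : 0 < e / 4 by rewrite divr_gt0.
have [N hN] := vs _ e4; have [K hK] := vt _ e4.
exists (maxn N K) => k; rewrite geq_max => /andP[/hN h1 /hK h2].
apply: (le_lt_trans (wst k)).
rewrite [e%:E](_ : _ = 2%:E * (e / 4)%:E + 2%:E * (e / 4)%:E)%E; last first.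
  by rewrite -!EFinM -EFinD; congr EFin; field.
by rewrite lteD// lte_pmul2l.
Qed.

Lemma vanishes_energyD (f g : nat -> Rd -> R[i]) :
  (forall k, cmeasurable (f k)) -> (forall k, cmeasurable (g k)) ->
  vanishes (fun k => energy (f k)) -> vanishes (fun k => energy (g k)) ->
  vanishes (fun k => energy (fun x => f k x + g k x)).
Proof. by move=> mf mg vf vg; apply: (vanishes_le2 vf vg) => k; exact: energyD_le. Qed.

Lemma cvg_L2_vanishes (u : nat -> Rd -> R[i]) f : cvg_L2 u f ->
  vanishes (fun k => energy (fun x => u k x - f x)).
Proof.
move=> uf e e0; have se0 : 0 < Num.sqrt e by rewrite sqrtr_gt0.
have : \forall k \near \oo, (L2norm (fun x => u k x - f x)%R < (Num.sqrt e)%:E)%E.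
  have := uf [set y | (y < (Num.sqrt e)%:E)%E]; apply.
  by apply: open_ereal_lt'; rewrite lte_fin.
move=> [N _ hN]; exists N => k Nk; have := hN k Nk => /=.
have -> : energy (fun x => u k x - f x) = (L2norm (fun x => u k x - f x)%R `^ 2)%E.
  rewrite /L2norm poweR_Lnorm//; apply: eq_integral => x _ /=.
  by rewrite ger0_norm ?nrm_ge0// powR_mulrn ?nrm_ge0.
have : (0 <= L2norm (fun x => u k x - f x)%R)%E by exact: Lnorm_ge0.
case: (L2norm _) => [r| |]//; rewrite lee_fin lte_fin => r0 re /=.
rewrite lte_fin powR_mulrn// -(sqr_sqrtr (ltW e0)).
by rewrite ltr_sqr ?nnegrE ?sqrtr_ge0.
Qed.

Lemma vanishes_limit0 (s : nat -> \bar R) (c : \bar R) : vanishes s ->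
  (exists N, forall k, (N <= k)%N -> c <= s k)%E -> (c <= 0)%E.
Proof.
move=> vs [N cs]; apply/lee_addgt0Pr => e e0; rewrite add0e.
have [K hK] := vs e e0; apply: le_trans (cs (maxn N K) (leq_maxl _ _)) _.
by apply: ltW; apply: hK; exact: leq_maxr.
Qed.

End energy.

(** A function on the torus with zero integral vanishes almost everywhere. *)
Lemma ae_eq0_periodic (R : realType) (n : nat) (h : 'rV[R]_n -> \bar R) :
  (forall x, 0 <= h x)%E -> measurable_fun setT h ->
  (forall x k, h (x + intV R k) = h x) ->
  (\int[lebesgue_rV R n]_(x in cell R n) h x)%E = 0%E ->
  {ae lebesgue_rV R n, forall x, h x = 0%E}.
Proof.
move=> h0 mh hper h_int; have mQ := @measurable_cell R n.
have mN : measurable (h @^-1` (~` [set 0%E])).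
  by rewrite -[X in measurable X]setTI; apply: mh => //; exact: measurableC.
exists (h @^-1` (~` [set 0%E])); split => //.
apply: cell_null_periodic => //; first by move=> x k /=; rewrite hper.
have : (\int[lebesgue_rV R n]_(x in cell R n) `|h x|)%E = 0%E.
  by rewrite -h_int; apply: eq_integral => x _; rewrite gee0_abs.
move=> /(ae_eq_integral_abs _ mQ (measurable_funTS mh)) [A [mA A0 hA]].
apply: (subset_measure0 _ mA _ A0); first exact: measurableI.
by move=> x [/= hx Qx]; apply: hA => /= /(_ Qx).
Qed.

Section plancherel.
Context (R : realType) (d : nat) (D : 'M[int]_d.+1).
Hypothesis dD : \det D != 0.
Local Notation Rd := 'rV[R]_d.+1.
Local Notation Zd := 'rV[int]_d.+1.
Local Notation mu := (lebesgue_rV R d.+1).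
Local Notation m := (absdet D).
Local Notation Q := (cell R d.+1).
Implicit Types (n : int) (f g : Rd -> R[i]).

Lemma measurable_sqsum n f : cmeasurable f -> measurable_fun setT (fun x => sqsum D n f x).
Proof.
move=> mf; apply: emeasurable_funM => //.
under eq_fun do under eq_esum do rewrite adj_dilDx.
have mM := measurable_mulmxrV (Defs.realmx R D ^ n).
have h := @measurable_periodize R d.+1 (fun y => (nrm (f (adj_dil D n y)) ^+ 2)%:E) setT.
rewrite (_ : (fun x => _) = (fun x => \esum_(k in [set: Zd]) (nrm (f (adj_dil D n (x + intV R k))) ^+ 2)%:E))%E.
  apply: h => //; last by move=> x; rewrite lee_fin sqr_ge0.
  by apply: measurable_sqr_nrm; exact: cmeasurable_comp.
by apply/funext => x; apply: eq_esum => k _; rewrite adj_dilDx.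
Qed.

(** The substitution xi M^n multiplies the integral by m^-n; periodize. *)
Lemma energy_sqsum n f : cmeasurable f ->
  energy f = (\int[mu]_(x in Q) sqsum D n f x)%E.
Proof.
move=> mf; have mM := measurable_mulmxrV (Defs.realmx R D ^ n).
have detM : `|\det (Defs.realmx R D ^ n)| = m%:R ^ n.
  by rewrite normr_det_exprz det_realmx -intr_norm -abszE.
have dM : \det (Defs.realmx R D ^ n) != 0.
  by rewrite -normr_eq0 detM gt_eqF// mexpz_gt0.
rewrite /energy -(scales_integral (scales_unit dM)); last 2 first.
- exact: measurable_sqr_nrm.
- by move=> x; rewrite lee_fin sqr_ge0.
rewrite (@integral_periodize R d.+1 (fun x => (nrm (f (x *m Defs.realmx R D ^ n)) ^+ 2)%:E)); last 2 first.
- by apply: measurable_sqr_nrm; exact: cmeasurable_comp.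
- by move=> x; rewrite lee_fin sqr_ge0.
rewrite -ge0_integralZl_EFin//.
- by rewrite detM.
- exact: measurable_cell.
- by move=> x _; apply: esum_ge0 => k _; rewrite lee_fin sqr_ge0.
apply: (@measurable_periodize R d.+1 (fun y => (nrm (f (y *m Defs.realmx R D ^ n)) ^+ 2)%:E)); last exact: measurable_cell.
  by apply: measurable_sqr_nrm; exact: cmeasurable_comp.
by move=> x; rewrite lee_fin sqr_ge0.
Qed.

(** By [energy_sqsum] at level 0, the energy of the Fourier transform is the
    integral over the cell of the trigonometric polynomial of [bracket_parseval],
    that is its constant coefficient [f, f]_0(0), the energy of f. *)
Lemma plancherel f : ctsupp f -> energy (fourier f) = energy f.
Proof.
move=> fc; have mf := ctsupp_cmeasurable fc; have mF := cmeasurable_fourier fc.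
have [s [us sz sE]] := bracket_parseval dD 0 fc.
pose S x := \sum_(g <- s) bracket D 0 f f g * trig g x.
have SE x : sqsum D 0 (fourier f) x = (complex.Re (S x))%:E.
  by rewrite /S (sE x).2 /= -sqsum_fin//; have [] := sE x.
have mS : cmeasurable S.
  by apply: cmeasurable_sum => g; apply: cmeasurableM; [exact: cmeasurable_cst|exact: cmeasurable_trig].
have itrig (g : Zd) : cintegrable (fun x : Rd => (\1_Q x)%:C%C * trig g x : R[i]).
  by apply: (@cintegrable_cell _ _ _ 1) => [|x _]; [exact: cmeasurable_trig|rewrite nrm_trig].
have SI : cellint S = bracket D 0 f f 0.
  rewrite /cellint (eq_cintegral (g := fun x => \sum_(g <- s) bracket D 0 f f g * ((\1_Q x)%:C%C * trig g x))).
    rewrite cintegral_sum; last by move=> g; exact: cintegrableZ.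
    rewrite (eq_bigr (fun k => bracket D 0 f f k * (k == 0)%:R)); last first.
      by move=> g _; rewrite cintegralZ// -/(cellint _) cell_orth.
    have [s0|s0] := boolP (0 \in s).
      rewrite (bigD1_seq 0)//= eqxx mulr1 big1 ?addr0// => g /negbTE ->.
      by rewrite mulr0.
    rewrite (sz _ s0) big_seq big1// => g gs.
    by case: eqVneq => [g0|_]; rewrite ?mulr0//; rewrite g0 (negbTE s0) in gs.
  by move=> x; rewrite /S mulr_sumr; apply: eq_bigr => g _; rewrite mulrCA.
have EF : energy (fourier f) = (complex.Re (cellint S))%:E.
  rewrite (energy_sqsum 0 mF) cellint_Re.
  rewrite /Rintegral (eq_integral (fun x => sqsum D 0 (fourier f) x)); last by move=> x _; rewrite SE.
  rewrite fineK// ge0_fin_numE; last by apply: integral_ge0 => x _; exact: sqsum_ge0.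
  pose C := \sum_(g <- s) nrm (bracket D 0 f f g).
  apply: (@le_lt_trans _ _ (\int[mu]_(x in Q) (cst C%:E) x)%E); last first.
    by rewrite integral_cst ?lebesgue_cell ?mule1 ?ltry//; exact: measurable_cell.
  apply: ge0_le_integral => //.
  - exact: measurable_cell.
  - by move=> x _; exact: sqsum_ge0.
  - by apply: measurable_funTS; exact: measurable_sqsum.
  move=> x _; rewrite SE lee_fin; apply: le_trans (ler_norm _) _; apply: le_trans (le_Re_nrm _) _.
  apply: le_trans (nrm_sum _ _ _) _; apply: ler_sum => g _.
  by rewrite nrmM nrm_trig mulr1.
rewrite EF SI /bracket /=.
have fi : (mu.-integrable setT (EFin \o (fun x => complex.Re ((f x)^* * f x)))).
  by have [] := ctsupp_integrable (ctsuppMl (ctsuppJ fc) fc).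
rewrite /energy (eq_integral (EFin \o (fun x => complex.Re ((f x)^* * f x)))); last first.
  by move=> x _; rewrite /= cReJM.
rewrite -[RHS]fineK ?integrable_fin_num//; congr EFin; apply: eq_Rintegral => x _.
by rewrite /dil map_mx0 mul0mx subr0.
Qed.

End plancherel.

Lemma eq_limn (R : realType) (a b : nat -> R) : (forall j, a j = b j) ->
  lim (a j @[j --> \oo]) = lim (b j @[j --> \oo]).
Proof. by move=> /funext ->. Qed.

Lemma eq_einfs (R : realType) (a b : nat -> \bar R) N : (forall j, a j = b j) ->
  einfs a N = einfs b N.
Proof. by move=> /funext ->. Qed.

Lemma dist3_le (R : realType) (a b c e x : R) : `|a - b| <= e / 3 -> `|c - x| <= e / 3 ->
  `|a - c| <= e / 3 -> `|b - x| <= e.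
Proof. by rewrite !ler_norml; lra. Qed.

(** * Limits of fibre norms *)

Section limits.
Context (R : realType) (d : nat) (D : 'M[int]_d.+1).
Hypothesis dD : \det D != 0.
Local Notation Rd := 'rV[R]_d.+1.
Local Notation Zd := 'rV[int]_d.+1.
Local Notation mu := (lebesgue_rV R d.+1).
Local Notation m := (absdet D).
Implicit Types (n : int) (x : Rd) (p q : Rd -> R[i]) (u v : nat -> Rd -> R[i]).

(** The part of membership of p in X_hat_n that is used, on the Fourier side: the
    Cauchy condition of the completion is expressed with the fibre norms, whose
    supremum is the norm of X_n. *)
Definition approximates n p u := [/\ cmeasurable p, forall j, ctsupp (u j),
  forall e : R, 0 < e -> exists N, forall j k, (N <= j)%N -> (N <= k)%N ->
    forall x, fnorm D n (fun y => fourier (u j) y - fourier (u k) y) x < e &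
  vanishes (fun j => energy (fun y => fourier (u j) y - p y))].

(** The sequence u that defines X_n and the sequence v that defines the Fourier
    transform of f need not agree; both tend to f, so by Plancherel their Fourier
    transforms have the same L^2 limit. *)
Lemma X_hat_approximates n p : X_hat D n p -> exists u, approximates n p u.
Proof.
move=> [f [[mf1 mf2 _] [u [uc uCauchy uf]]] [_ [mp1 mp2 _] [v [vc vf vp]]]].
have mf : cmeasurable f by [].
have mp : cmeasurable p by [].
have cu j : ctsupp (u j) := Cc_ctsupp (uc j).
have cv j : ctsupp (v j) := Cc_ctsupp (vc j).
have mF w : ctsupp w -> cmeasurable (fourier w) := @cmeasurable_fourier _ _ w.
have mu' j := ctsupp_cmeasurable (cu j); have mv' j := ctsupp_cmeasurable (cv j).
exists u; split => //.
  move=> e e0; have [N hN] := uCauchy e e0; exists N => j k Nj Nk x.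
  apply: le_lt_trans (hN j k Nj Nk).
  rewrite (eq_fnorm D n (q := fourier (fun x => u j x - u k x))); last by move=> y; rewrite fourierB.
  by apply: fnorm_le_X_norm => //; exact: ctsuppB.
have uv : vanishes (fun j => energy (fun y => u j y - v j y)).
  rewrite (_ : (fun j => _) = fun j => energy (fun y => (u j y - f y) + - (v j y - f y))); last first.
    by apply/funext => j; congr energy; apply/funext => y; rewrite opprB subrKA.
  apply: vanishes_energyD.
  - by move=> j; apply: cmeasurableD => //; exact: cmeasurableN.
  - by move=> j; apply/cmeasurableN/cmeasurableD => //; exact: cmeasurableN.
  - exact: cvg_L2_vanishes.
  rewrite (_ : (fun k => _) = fun k => energy (fun x => v k x - f x)); first exact: cvg_L2_vanishes.
  by apply/funext => k; rewrite energyN.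
rewrite (_ : (fun j => _) = fun j =>
   energy (fun y => (fourier (u j) y - fourier (v j) y) + (fourier (v j) y - p y))); last first.
  by apply/funext => j; congr energy; apply/funext => y; rewrite subrKA.
apply: vanishes_energyD.
- by move=> j; apply: cmeasurableD; [exact: mF|apply: cmeasurableN; exact: mF].
- by move=> j; apply: cmeasurableD; [exact: mF|exact: cmeasurableN].
- rewrite (_ : (fun j => _) = fun j => energy (fun y => u j y - v j y)) => [//|].
  apply/funext => j; rewrite -[RHS](plancherel dD); last exact: ctsuppB.
  by congr energy; apply/funext => y; rewrite fourierB.
exact: cvg_L2_vanishes.
Qed.

Lemma finite_fourierB u v x n j k : (forall j, ctsupp (u j)) -> (forall j, ctsupp (v j)) ->
  finite_at D n (fun y => fourier (u j) y - fourier (v k) y) x.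
Proof. by move=> uc vc; apply: finite_atB => //; exact: finite_at_fourier. Qed.

Lemma approximatesD n p q u v : approximates n p u -> approximates n q v ->
  approximates n (fun y => p y + q y) (fun j y => u j y + v j y).
Proof.
move=> [mp uc uC up] [mq vc vC vq]; split.
- exact: cmeasurableD.
- by move=> j; exact: ctsuppD.
- move=> e e0; have e2 : 0 < e / 2 by rewrite divr_gt0.
  have [N hN] := uC _ e2; have [K hK] := vC _ e2; exists (maxn N K) => j k.
  rewrite !geq_max => /andP[Nj Kj] /andP[Nk Kk] x.
  rewrite (eq_fnorm D n (q := fun y => (fourier (u j) y - fourier (u k) y) + (fourier (v j) y - fourier (v k) y))); last first.
    by move=> y; rewrite !fourierD//; ring.
  apply: le_lt_trans (fnormD_le dD _ _) _; [exact: finite_fourierB..|].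
  by rewrite [e]splitr; apply: ltrD; [exact: hN|exact: hK].
rewrite (_ : (fun j => _) = fun j =>
   energy (fun y => (fourier (u j) y - p y) + (fourier (v j) y - q y))); last first.
  apply/funext => j; congr energy; apply/funext => y; rewrite fourierD//; ring.
have mF w : ctsupp w -> cmeasurable (fourier w) := @cmeasurable_fourier _ _ w.
apply: vanishes_energyD => // j; apply: cmeasurableD; by [exact: mF|exact: cmeasurableN].
Qed.

Lemma approximatesZ n p u (c : R[i]) : nrm c = 1 -> approximates n p u ->
  approximates n (fun y => c * p y) (fun j y => c * u j y).
Proof.
move=> c1 [mp uc uC up]; split.
- by apply: cmeasurableM => //; exact: cmeasurable_cst.
- by move=> j; exact: ctsuppZ.
- move=> e e0; have [N hN] := uC e e0; exists N => j k Nj Nk x.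
  rewrite (eq_fnorm D n (q := fun y => c * (fourier (u j) y - fourier (u k) y))); last first.
    by move=> y; rewrite !fourierZ// mulrBr.
  by rewrite /fnorm sqsum_unit// -/(fnorm D n _ x) hN.
rewrite (_ : (fun j => _) = fun j => energy (fun y => fourier (u j) y - p y)) => [//|].
apply/funext => j; rewrite -[RHS](energy_unit _ c1); congr energy; apply/funext => y.
by rewrite fourierZ// mulrBr.
Qed.

Definition fnorm_lim n u (x : Rd) : R := lim (fnorm D n (fourier (u j)) x @[j --> \oo]).

Section approximation.
Variables (n : int) (p : Rd -> R[i]) (u : nat -> Rd -> R[i]).
Hypothesis pu : approximates n p u.

Lemma fnorm_cauchy (e : R) : 0 < e -> exists N, forall j k, (N <= j)%N -> (N <= k)%N ->
  forall x, `|fnorm D n (fourier (u j)) x - fnorm D n (fourier (u k)) x| <= e.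
Proof.
have [_ uc uC _] := pu; move=> e0; have [N hN] := uC e e0; exists N => j k Nj Nk x.
apply: le_trans (ltW (hN j k Nj Nk x)).
by apply: fnormB => //; exact: finite_at_fourier.
Qed.

Lemma fnorm_cvg x : fnorm D n (fourier (u j)) x @[j --> \oo] --> fnorm_lim n u x.
Proof.
apply/cauchy_cvgP/cauchyP => e e0.
have [N hN] := fnorm_cauchy (divr_gt0 e0 (ltr0Sn R 1)).
exists (fnorm D n (fourier (u N)) x); exists N => // k /= Nk.
apply: le_lt_trans (hN N k (leqnn N) Nk x) _.
by rewrite ltr_pdivrMr// mulr_natr mulr2n ltrDl.
Qed.

Lemma fnorm_lim_le (e : R) : 0 < e -> exists N, forall j, (N <= j)%N -> forall x,
  `|fnorm D n (fourier (u j)) x - fnorm_lim n u x| <= e.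
Proof.
move=> e0; have [N hN] := fnorm_cauchy e0; exists N => j Nj x.
have h : (fun k => `|fnorm D n (fourier (u j)) x - fnorm D n (fourier (u k)) x|) @ \oo -->
    `|fnorm D n (fourier (u j)) x - fnorm_lim n u x|.
  by apply: cvg_norm; apply: cvgB; [exact: cvg_cst|exact: fnorm_cvg].
rewrite -(cvg_lim (@Rhausdorff R) h); apply: limr_le; first by apply/cvg_ex; eexists; exact: h.
by exists N => // k /= Nk; exact: hN.
Qed.

Lemma fnorm_lim_ge0 x : 0 <= fnorm_lim n u x.
Proof.
have h := fnorm_cvg (x := x); rewrite /fnorm_lim; apply: limr_ge.
  by apply/cvg_ex; eexists; exact: h.
by apply: nearW => j; exact: fnorm_ge0.
Qed.

Lemma fnorm_lim_periodic x (k : Zd) : fnorm_lim n u (x + intV R k) = fnorm_lim n u x.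
Proof.
by apply: eq_limn => j; exact: fnorm_periodic.
Qed.

Lemma fnorm_lim_repr x : fnorm_lim n u (repr (iota_hat x)) = fnorm_lim n u x.
Proof. by have [k ->] := repr_iota_hat x; rewrite fnorm_lim_periodic. Qed.

Lemma fnorm_lim_bounded : exists C, forall x, fnorm_lim n u x <= C.
Proof.
have [_ uc _ _] := pu; have [N hN] := fnorm_lim_le ltr01.
have [C hC] := fnorm_bounded dD n (uc N); exists (C + 1) => x.
have := hN N (leqnn N) x; have := hC x; rewrite ler_norml; lra.
Qed.

Lemma continuous_fnorm_lim : continuous (fnorm_lim n u).
Proof.
have [_ uc _ _] := pu; move=> x; have FFx := nbhs_filter (x : Rd); apply/cvgrPdist_le => e e0.
have e3 : 0 < e / 3 by rewrite divr_gt0.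
have [N /(_ N (leqnn N)) hN] := fnorm_lim_le e3.
have /cvgrPdist_le /(_ _ e3) := @continuous_fnorm R d D dD n _ (uc N) x.
by move=> hx; apply: filterS hx => t ht; exact: (dist3_le (hN x) (hN t) ht).
Qed.

(** The integral over the cell of f_j = S_n (u_j^ - p) tends to 0. So each tail
    infimum of the f_j vanishes almost everywhere; at such a point u_j^ is close to
    p in l^2 of the fibre for arbitrarily large j. *)
Lemma fnorm_lim_ae : {ae mu, forall x, finite_at D n p x /\ fnorm D n p x = fnorm_lim n u x}.
Proof.
have [mp uc uC up] := pu.
pose f j x := sqsum D n (fun y => fourier (u j) y - p y) x.
have mq j : cmeasurable (fun y => fourier (u j) y - p y).
  by apply: cmeasurableD; [exact: cmeasurable_fourier|exact: cmeasurableN].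
have f0 j x : (0 <= f j x)%E by exact: sqsum_ge0.
pose h N x := einfs (f^~ x) N.
have h0 N x : (0 <= h N x)%E by apply: le_ereal_inf_tmp => _ [j _ <-].
have mh N : measurable_fun setT (h N).
  by apply: measurable_fun_einfs => j; exact: measurable_sqsum.
have hE N : {ae mu, forall x, h N x = 0%E}.
  have h_int : (\int[mu]_(x in cell R d.+1) h N x)%E = 0%E.
    apply/eqP; rewrite eq_le integral_ge0// andbT.
    apply: (vanishes_limit0 up); exists N => k Nk.
    rewrite (energy_sqsum dD n (mq k)); apply: ge0_le_integral => //.
    - exact: measurable_cell.
    - exact: measurable_funTS.
    - by apply: measurable_funTS; exact: measurable_sqsum.
    by move=> x _; apply: ereal_inf_lbound; exists k.
  apply: ae_eq0_periodic (h0 N) (mh N) _ h_int => x k.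
  by apply: eq_einfs => j; exact: sqsum_periodic.
apply: filterS (ae_foralln hE) => x hx.
have close (e : R) N : 0 < e -> exists2 j, (N <= j)%N & (f j x < e%:E)%E.
  move=> e0; have /ereal_inf_lt[_ [j Nj <-] fe] : (h N x < e%:E)%E by rewrite hx lte_fin.
  by exists j.
have fin j : finite_at D n (fourier (u j)) x by exact: finite_at_fourier.
have pf : finite_at D n p x.
  have [j _ fj] := close 1 0%N ltr01.
  rewrite /finite_at (_ : p = fun y => fourier (u j) y - (fourier (u j) y - p y)).
    by apply: finite_atB => //; apply: lt_trans fj _; rewrite ltry.
  by apply/funext => y; rewrite opprB addrC subrK.
split => //; apply/eqP; rewrite -subr_eq0 -normr_le0; apply/ler_addgt0Pr => e e0; rewrite add0r.
have e2 : 0 < e / 2 by rewrite divr_gt0.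
have [N hN] := fnorm_lim_le e2; have [j Nj fj] := close ((e / 2) ^+ 2) N (exprn_gt0 2 e2).
have := hN j Nj x; have := fnormB dD (fin j) pf.
have : fnorm D n (fun y => fourier (u j) y - p y) x <= e / 2.
  rewrite -[leRHS]ger0_norm ?(ltW e2)// -sqrtr_sqr; apply: ler_wsqrtr; rewrite -lee_fin.
  by rewrite -sqsum_fin ?ltW//; apply: lt_trans fj _; rewrite ltry.
rewrite !ler_norml; lra.
Qed.

End approximation.
End limits.

(** * Level n and level n - 1 *)

Section change_of_level.
Context (R : realType) (d : nat) (D : 'M[int]_d.+1).
Hypothesis dD : \det D != 0.
Local Notation Rd := 'rV[R]_d.+1.
Local Notation Zd := 'rV[int]_d.+1.
Local Notation m := (absdet D).
Variable reps : seq Zd.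
Hypotheses (ur : uniq reps) (sr : size reps = m).
Hypothesis r_ex : forall z, exists2 r, r \in reps & exists k, z = r + k *m D.
Hypothesis r_uniq : forall r r' k, r \in reps -> r' \in reps -> r = r' + k *m D -> r = r'.
Implicit Types (n : int) (x : Rd) (p q : Rd -> R[i]) (u v : nat -> Rd -> R[i]).

Lemma sqr_fnorm_pred n p x : (forall y, finite_at D n p y) ->
  fnorm D (n - 1) p x ^+ 2 =
  m%:R^-1 * \sum_(r <- reps) fnorm D n p (adj_dil D (- 1) (x + intV R r)) ^+ 2.
Proof.
move=> pf; rewrite (sqr_fnorm dD) (fine_sqsum_pred dD ur r_ex r_uniq _ pf).
by congr (_ * _); apply: eq_bigr => r _; rewrite (sqr_fnorm dD).
Qed.

Lemma approximates_pred n p u : approximates D n p u -> approximates D (n - 1) p u.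
Proof.
have m0 := natm_gt0 R dD.
move=> [mp uc uC up]; split => // e e0; have e2 : 0 < e / 2 by rewrite divr_gt0.
have [N hN] := uC _ e2; exists N => j k Nj Nk x.
apply: (@le_lt_trans _ _ (e / 2)); last by rewrite ltr_pdivrMr// mulr_natr mulr2n ltrDl.
rewrite -ler_sqr ?nnegrE ?fnorm_ge0 ?(ltW e2)// sqr_fnorm_pred; last first.
  by move=> y; exact: finite_fourierB.
rewrite ler_pdivrMl//.
have -> : m%:R * (e / 2) ^+ 2 = \sum_(r <- reps) (e / 2) ^+ 2.
  by rewrite big_const_seq count_predT sr iter_addr_0 mulr_natl.
apply: ler_sum => r _; rewrite ler_sqr ?nnegrE ?fnorm_ge0 ?(ltW e2)//; apply: ltW.
exact: hN.
Qed.

End change_of_level.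

(** * Polarization *)

Section polarization.
Context (R : realType).

Lemma esum_lty_le (T : choiceType) (A : set T) (a b : T -> R) :
  (forall t, 0 <= a t) -> (forall t, a t <= b t) -> (\esum_(t in A) (b t)%:E < +oo)%E ->
  (\esum_(t in A) (a t)%:E < +oo)%E.
Proof. by move=> a0 ab; apply: le_lt_trans; apply: le_esum => t _; rewrite lee_fin. Qed.

(** [rsum] is defined by positive and negative parts; any splitting into
    nonnegative summable families gives the same value. *)
Lemma rsumB (T : choiceType) (A : set T) (f g : T -> R) :
  (forall t, 0 <= f t) -> (forall t, 0 <= g t) ->
  (\esum_(t in A) (f t)%:E < +oo)%E -> (\esum_(t in A) (g t)%:E < +oo)%E ->
  rsum A (fun t => f t - g t) = fine (\esum_(t in A) (f t)%:E) - fine (\esum_(t in A) (g t)%:E).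
Proof.
move=> f0 g0 foo goo; rewrite /rsum.
pose a t := Num.max (f t - g t) 0; pose b t := Num.max (- (f t - g t)) 0.
have a0 t : 0 <= a t by rewrite /a le_max lexx orbT.
have b0 t : 0 <= b t by rewrite /b le_max lexx orbT.
have af t : a t <= f t by rewrite /a ge_max f0 andbT lerBlDr lerDl.
have bg t : b t <= g t by rewrite /b ge_max g0 andbT opprB lerBlDr lerDl.
have aoo := esum_lty_le a0 af foo; have boo := esum_lty_le b0 bg goo.
have E : (\esum_(t in A) (a t)%:E + \esum_(t in A) (g t)%:E =
          \esum_(t in A) (f t)%:E + \esum_(t in A) (b t)%:E)%E.
  rewrite -!esumD; try by move=> t _; rewrite lee_fin.
  apply: eq_esum => t _; rewrite -!EFinD; congr EFin.
  by have := max0BN (f t - g t); rewrite -/(a t) -/(b t); lra.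
rewrite -[\esum_(t in A) (Num.max (f t - g t) 0)%:E]/(\esum_(t in A) (a t)%:E).
rewrite -[\esum_(t in A) (Num.max (- (f t - g t)) 0)%:E]/(\esum_(t in A) (b t)%:E).
have fin (h : T -> R) : (forall t, 0 <= h t) -> (\esum_(t in A) (h t)%:E < +oo)%E ->
    (\esum_(t in A) (h t)%:E)%E \is a fin_num.
  by move=> h0 hoo; rewrite ge0_fin_numE//; apply: esum_ge0 => t _; rewrite lee_fin.
move: E; rewrite -(fineK (fin _ a0 aoo)) -(fineK (fin _ b0 boo)) -(fineK (fin _ f0 foo)) -(fineK (fin _ g0 goo)).
by rewrite -!EFinD => -[] /=; lra.
Qed.

Lemma Re_conjM (a b : R[i]) :
  complex.Re (a^* * b) = (nrm (a + b) ^+ 2) / 2 - (nrm a ^+ 2 + nrm b ^+ 2) / 2.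
Proof. by rewrite !sqr_nrm !cReM !cReD !cImD cReJ cImJ; field. Qed.

Lemma Im_conjM (a b : R[i]) :
  complex.Im (a^* * b) = (nrm ('i%C * a + b) ^+ 2) / 2 - (nrm a ^+ 2 + nrm b ^+ 2) / 2.
Proof. by rewrite !sqr_nrm !cImM !cReD !cImD cReM cImM cReJ cImJ /=; field. Qed.

Lemma nrm_i : nrm ('i%C : R[i]) = 1.
Proof. by rewrite nrmE /= expr0n expr1n add0r sqrtr1. Qed.

Context (d : nat) (D : 'M[int]_d.+1).
Hypothesis dD : \det D != 0.
Local Notation Rd := 'rV[R]_d.+1.
Local Notation Zd := 'rV[int]_d.+1.
Local Notation m := (absdet D).
Implicit Types (n : int) (x : Rd) (p q : Rd -> R[i]) (u v : nat -> Rd -> R[i]).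

(** The sum over the fibre without the factor m^n. *)
Let S n p x : \bar R := (\esum_(xi in [set xi | iota_hat_n D n xi = iota_hat x]) (nrm (p xi) ^+ 2)%:E)%E.

Let SE n p x : finite_at D n p x -> (S n p x < +oo)%E /\ fine (sqsum D n p x) = m%:R ^ n * fine (S n p x).
Proof.
have m0 := mexpz_gt0 R dD n.
rewrite /finite_at /sqsum -(esum_fiber dD n x (fun y => (nrm (p y) ^+ 2)%:E)) -/(S n p x).
have : (0 <= S n p x)%E by apply: esum_ge0 => y _; rewrite lee_fin sqr_ge0.
case: (S n p x) => [r| |]//= _; first by split => //; rewrite ltry.
by rewrite gt0_muley ?lte_fin.
Qed.

Definition polar_diff n p q x : R :=
  (fine (sqsum D n (fun y => p y + q y) x) - fine (sqsum D n p x) - fine (sqsum D n q x)) / 2.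

Lemma esum_half (A : set Rd) (f : Rd -> R) : (forall y, 0 <= f y) ->
  \esum_(y in A) (f y / 2)%:E = (2^-1%:E * \esum_(y in A) (f y)%:E)%E.
Proof.
move=> f0; rewrite esum_mkcond [in RHS]esum_mkcond -esumZl ?invr_ge0//; last first.
  by move=> y; case: ifP; rewrite ?lee_fin.
by apply: eq_esum => y _; case: ifP => _; rewrite ?mule0// -EFinM mulrC.
Qed.

Lemma rsum_polar n p q x (a : Rd -> R) : finite_at D n p x -> finite_at D n q x ->
  (forall y, a y = (nrm (p y + q y) ^+ 2) / 2 - (nrm (p y) ^+ 2 + nrm (q y) ^+ 2) / 2) ->
  m%:R ^ n * rsum [set xi | iota_hat_n D n xi = iota_hat x] a = polar_diff n p q x.
Proof.
move=> pf qf aE; have [poo pE] := SE pf; have [qoo qE] := SE qf.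
have [soo sE] := SE (finite_atD dD pf qf).
have S0 r : (0 <= S n r x)%E by apply: esum_ge0 => y _; rewrite lee_fin sqr_ge0.
have fE r : (S n r x < +oo)%E -> S n r x = (fine (S n r x))%:E.
  by move=> roo; rewrite fineK// ge0_fin_numE.
have -> : a = fun y => (nrm (p y + q y) ^+ 2) / 2 - (nrm (p y) ^+ 2 + nrm (q y) ^+ 2) / 2.
  by apply/funext.
have E1 : \esum_(y in [set xi | iota_hat_n D n xi = iota_hat x]) (nrm (p y + q y) ^+ 2 / 2)%:E =
    (2^-1 * fine (S n (fun y => p y + q y) x))%:E.
  by rewrite esum_half ?EFinM -?fE// => y; exact: sqr_ge0.
have E2 : \esum_(y in [set xi | iota_hat_n D n xi = iota_hat x]) ((nrm (p y) ^+ 2 + nrm (q y) ^+ 2) / 2)%:E =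
    (2^-1 * (fine (S n p x) + fine (S n q x)))%:E.
  rewrite esum_half ?EFinM ?EFinD -?fE//; last by move=> y; rewrite addr_ge0 ?sqr_ge0.
  by congr (_ * _)%E; rewrite -esumD// => y _; rewrite lee_fin sqr_ge0.
rewrite rsumB; first last.
- by rewrite E2 ltry.
- by rewrite E1 ltry.
- by move=> y; rewrite divr_ge0 ?addr_ge0 ?sqr_ge0.
- by move=> y; rewrite divr_ge0 ?sqr_ge0.
by rewrite E1 E2 /= /polar_diff pE qE sE; field.
Qed.

Lemma hat_bracket_sum_polar n p q x : finite_at D n p x -> finite_at D n q x ->
  hat_bracket_sum D n p q (iota_hat x) =
  (polar_diff n p q x +i* polar_diff n (fun y => 'i%C * p y) q x)%C.
Proof.
move=> pf qf; have pf' : finite_at D n (fun y => 'i%C * p y) x.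
  by rewrite /finite_at sqsum_unit// nrm_i.
rewrite /hat_bracket_sum exprz_complex; apply: complexP.
  rewrite cReM /= mul0r subr0; apply: rsum_polar => // y; exact: Re_conjM.
rewrite cImM /= mul0r addr0; apply: rsum_polar => // y.
by rewrite Im_conjM nrmM nrm_i mul1r.
Qed.

End polarization.

(** * The continuous representative of the bracket *)

Section continuous_bracket.
Context (R : realType) (d : nat).
Local Notation Rd := 'rV[R]_d.+1.
Local Notation mu := (lebesgue_rV R d.+1).

Lemma continuous_torusP (Z : topologicalType) (b : torus R d.+1 -> Z) :
  continuous b <-> continuous (fun x : Rd => b (iota_hat x)).
Proof. exact: quotient_continuous. Qed.

Lemma continuous_complex (f : Rd -> R[i]) : continuous (fun x => complex.Re (f x)) ->
  continuous (fun x => complex.Im (f x)) -> continuous (f : Rd -> R[i]^o).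
Proof.
move=> cR cI x; have FFx := nbhs_filter (x : Rd); apply/cvgrPdist_lt => e e0.
have [r r0 er] : exists2 r : R, 0 < r & e = r%:C%C.
  case: e e0 => er ei; rewrite ltcE /= => /andP[/eqP ei0 er0]; exists er => //.
  by rewrite ei0.
have r2 : 0 < r / 2 by rewrite divr_gt0.
have /cvgrPdist_lt /(_ _ r2) hR := cR x; have /cvgrPdist_lt /(_ _ r2) hI := cI x.
apply: filterS2 hR hI => y hR hI.
rewrite er -nrmC ltcR; apply: le_lt_trans (le_nrm_ReIm _) _.
by rewrite [r]splitr cReD cReN cImD cImN ltrD.
Qed.

(** Nonempty open sets have positive measure. *)
Lemma continuous_ae_eq (f g : Rd -> R) : continuous f -> continuous g ->
  {ae mu, forall x, f x = g x} -> forall x, f x = g x.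
Proof.
move=> cf cg [N [mN N0 hN]] x; apply/eqP; apply: contraT => fg.
pose U := [set y : Rd | f y - g y != 0].
have oU : open U.
  rewrite (_ : U = (fun y => f y - g y) @^-1` [set z | z != 0]).
    by apply: open_comp; [move=> y _; exact: rV_continuousB|exact: open_neq].
  by [].
have : (0 < mu U)%E by apply: (open_lebesgue_gt0 oU (x := x)); rewrite /U /= subr_eq0.
rewrite (subset_measure0 _ mN _ N0) ?ltxx//; first exact: open_measurable_rV.
by move=> y /= Uy; apply: hN => /= /eqP; rewrite -subr_eq0 (negbTE Uy).
Qed.

Lemma continuous_torus_ae_eq (b c : torus R d.+1 -> R[i]) :
  continuous (b : _ -> R[i]^o) -> continuous (c : _ -> R[i]^o) ->
  ae_torus (fun zeta => b zeta = c zeta) -> b = c.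
Proof.
move=> /continuous_torusP/continuous_Re[b1 b2] /continuous_torusP/continuous_Re[c1 c2] bc.
have bc' : {ae mu, forall x, b (iota_hat x) = c (iota_hat x)} by exact: bc.
apply/funext => zeta; rewrite -[zeta]iota_hatK; move: (repr zeta) => y; apply: complexP.
  by move: y; apply: (continuous_ae_eq b1 c1); apply: filterS bc' => x ->.
by move: y; apply: (continuous_ae_eq b2 c2); apply: filterS bc' => x ->.
Qed.

Lemma hat_bracketE (D : 'M[int]_d.+1) n p q (b : torus R d.+1 -> R[i]) :
  continuous (b : _ -> R[i]^o) ->
  ae_torus (fun zeta => b zeta = hat_bracket_sum D n p q zeta) ->
  hat_bracket D n p q = b.
Proof.
move=> cb bE; rewrite /hat_bracket; case: xgetP => [b' _ [cb' b'E]|/(_ b)]; last by case.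
apply: continuous_torus_ae_eq => //; apply: filterS2 b'E bE => x h1 h2.
by rewrite h1 h2.
Qed.

End continuous_bracket.

Section hat_bracket_limit.
Context (R : realType) (d : nat) (D : 'M[int]_d.+1).
Hypothesis dD : \det D != 0.
Local Notation Rd := 'rV[R]_d.+1.
Local Notation Zd := 'rV[int]_d.+1.
Local Notation m := (absdet D).
Implicit Types (n : int) (x : Rd) (p q : Rd -> R[i]) (u v : nat -> Rd -> R[i]).

(** The continuous function [[p, p]]_n, when u approximates p. *)
Definition sqr_lim n u (zeta : torus R d.+1) : R := fnorm_lim D n u (repr zeta) ^+ 2.

Lemma sqr_lim_iota n u x : sqr_lim n u (iota_hat x) = fnorm_lim D n u x ^+ 2.
Proof. by rewrite /sqr_lim fnorm_lim_repr. Qed.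

Lemma continuous_sqr_lim n p u : approximates D n p u ->
  continuous (fun x => sqr_lim n u (iota_hat x)).
Proof.
move=> pu; rewrite (_ : (fun x => _) = fun x => fnorm_lim D n u x * fnorm_lim D n u x).
  by apply: rV_continuousM; exact: (continuous_fnorm_lim dD pu).
by apply/funext => x; rewrite sqr_lim_iota expr2.
Qed.

Lemma hat_bracket_diag n p u : approximates D n p u ->
  hat_bracket D n p p = fun zeta => (sqr_lim n u zeta)%:C%C.
Proof.
move=> pu; apply: hat_bracketE.
  apply/continuous_torusP/continuous_complex => /=; last exact: cst_continuous.
  exact: (continuous_sqr_lim pu).
apply: filterS (fnorm_lim_ae dD pu) => x [pf pE].
by rewrite hat_bracket_sum_sq// -(sqr_fnorm dD) pE sqr_lim_iota.
Qed.

(** The real part of [[p, q]]_n when u and v approximate p and q, and its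
    imaginary part when u approximates i p. *)
Definition polar_lim n u v (zeta : torus R d.+1) : R :=
  (sqr_lim n (fun j y => u j y + v j y) zeta - sqr_lim n u zeta - sqr_lim n v zeta) / 2.

Lemma hat_bracket_polar n p q u v : approximates D n p u -> approximates D n q v ->
  hat_bracket D n p q = fun zeta =>
    (polar_lim n u v zeta +i* polar_lim n (fun j y => 'i%C * u j y) v zeta)%C.
Proof.
move=> pu qv; have pu' := approximatesZ (nrm_i R) pu.
have suv := approximatesD dD pu qv; have suv' := approximatesD dD pu' qv.
apply: hat_bracketE.
  by apply/continuous_torusP/continuous_complex => /=; (apply: rV_continuousM; last exact: cst_continuous);
    (apply: rV_continuousB; [apply: rV_continuousB|]); apply: continuous_sqr_lim; eassumption.
apply: filterS (filterI (fnorm_lim_ae dD pu) (filterI (fnorm_lim_ae dD qv)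
  (filterI (fnorm_lim_ae dD pu') (filterI (fnorm_lim_ae dD suv) (fnorm_lim_ae dD suv'))))).
move=> x [[pf pE] [[qf qE] [[_ pE'] [[_ sE] [_ sE']]]]].
rewrite (hat_bracket_sum_polar dD pf qf) /polar_diff /polar_lim !sqr_lim_iota.
by rewrite -!(sqr_fnorm dD) pE qE pE' sE sE'.
Qed.

Variable reps : seq Zd.
Hypotheses (ur : uniq reps) (sr : size reps = m).
Hypothesis r_ex : forall z, exists2 r, r \in reps & exists k, z = r + k *m D.
Hypothesis r_uniq : forall r r' k, r \in reps -> r' \in reps -> r = r' + k *m D -> r = r'.

(** One sequence approximates p at both levels, and the identity holds everywhere
    for its terms. *)
Lemma sqr_lim_pred n p u x : approximates D n p u ->
  sqr_lim (n - 1) u (iota_hat x) = m%:R^-1 * \sum_(r <- reps) sqr_lim n u (lift_rep D x r).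
Proof.
move=> pu; have pu1 := approximates_pred dD ur sr r_ex r_uniq pu; have [_ uc _ _] := pu.
have h1 : fnorm D (n - 1) (fourier (u j)) x ^+ 2 @[j --> \oo] --> sqr_lim (n - 1) u (iota_hat x).
  by rewrite sqr_lim_iota !expr2; apply: cvgM; exact: (fnorm_cvg dD pu1).
have h2 : (m%:R^-1 * \sum_(r <- reps) fnorm D n (fourier (u j)) (adj_dil D (- 1) (x + intV R r)) ^+ 2)
    @[j --> \oo] --> m%:R^-1 * \sum_(r <- reps) sqr_lim n u (lift_rep D x r).
  apply: cvgM; first exact: cvg_cst.
  apply: cvg_big => [|r _]; first by move=> z; exact: add_continuous.
  rewrite /lift_rep sqr_lim_iota !expr2; apply: cvgM; exact: (fnorm_cvg dD pu).
rewrite -(cvg_lim (@Rhausdorff R) h1) -(cvg_lim (@Rhausdorff R) h2); apply: eq_limn => j.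
by rewrite (sqr_fnorm_pred dD ur r_ex r_uniq)// => y; exact: finite_at_fourier.
Qed.

Lemma polar_lim_pred n p q u v x : approximates D n p u -> approximates D n q v ->
  polar_lim (n - 1) u v (iota_hat x) = m%:R^-1 * \sum_(r <- reps) polar_lim n u v (lift_rep D x r).
Proof.
move=> pu qv; rewrite /polar_lim (sqr_lim_pred x (approximatesD dD pu qv)).
rewrite (sqr_lim_pred x pu) (sqr_lim_pred x qv) -!mulrBr -mulrA -!sumrB mulr_suml.
by [].
Qed.

Lemma hat_bracket_pred n p q x u v : approximates D n p u -> approximates D n q v ->
  hat_bracket D (n - 1) p q (iota_hat x) =
  m%:R^-1 * \sum_(r <- reps) hat_bracket D n p q (lift_rep D x r).
Proof.
move=> pu qv; have pu1 := approximates_pred dD ur sr r_ex r_uniq pu.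
have qv1 := approximates_pred dD ur sr r_ex r_uniq qv.
rewrite (hat_bracket_polar pu1 qv1) (hat_bracket_polar pu qv) /=.
rewrite (polar_lim_pred x pu qv) (polar_lim_pred x (approximatesZ (nrm_i R) pu) qv).
rewrite natr_complex -fmorphV; apply: complexP; rewrite ?cReM ?cImM cRe_sum cIm_sum /=.
  by rewrite mul0r subr0.
by rewrite mul0r addr0.
Qed.

End hat_bracket_limit.

Theorem proposition4p7 (R : realType) (d : nat) (D : 'M[int]_d.+1)
    (hD : dilation_matrix R D) :
  [/\ forall (n : int) (p q : 'rV[R]_d.+1 -> R[i]),
        X_hat D n p -> X_hat D n q ->
        forall zeta : torus R d.+1,
          hat_bracket D (n - 1) p q zeta =
          (absdet D)%:R^-1 *
          \sum_(omega \in [set omega | Delta_hat D omega = zeta])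
             hat_bracket D n p q omega,
      forall (n : int) (p : 'rV[R]_d.+1 -> R[i]), X_hat D n p ->
        (Num.sqrt (absdet D)%:R)^-1 * X_hat_norm D n p
          <= X_hat_norm D (n - 1) p <= X_hat_norm D n p,
      forall n k : int, X (R := R) D n = X D k &
      forall n k : int, X_hat (R := R) D n = X_hat D k].
Proof.
have dD := dilation_det hD; have [reps [ur sr r_ex r_uniq]] := lattice_reps dD.
split; [|move=> n p|exact: X_eq|exact: X_hat_eq].
  move=> n p q /(X_hat_approximates dD)[u pu] /(X_hat_approximates dD)[v qv] zeta.
  rewrite -[zeta]iota_hatK (sum_Delta_hat_fiber dD ur r_ex r_uniq).
  exact: hat_bracket_pred pu qv.
move=> /(X_hat_approximates dD)[u pu].
have pu1 := approximates_pred dD ur sr r_ex r_uniq pu.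
rewrite /X_hat_norm (hat_bracket_diag dD pu) (hat_bracket_diag dD pu1).
have [C hC] := fnorm_lim_bounded dD pu.
apply: (sup_sqrt_mean dD sr r_ex (F := sqr_lim D n u) (G := sqr_lim D (n - 1) u) (C := C ^+ 2)).
- by move=> zeta; exact: sqr_ge0.
- move=> zeta; rewrite /sqr_lim ler_sqr ?nnegrE ?(fnorm_lim_ge0 dD pu)//.
  exact: le_trans (fnorm_lim_ge0 dD pu _) (hC (repr zeta)).
by move=> x; exact: sqr_lim_pred pu.
Qed.
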